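(* Let $G$ be a nilpotent group and let $X$ be a 2-dimensional metric space. Then $X \tau K(G,1)$ if and only if $X \tau K(G_{ab},1)$.
   Context: For topological spaces $X$ and $M$, the notation $X \tau M$ (Kuratowski) means that every continuous map from a closed subset of $X$ to $M$ extends to a continuous map $X \to M$. $K(G,1)$ denotes an Eilenberg–MacLane CW complex of type $(G,1)$, and $G_{ab} = G/[G,G]$ is the abelianization of $G$. *)

(* Defs.v *)
From HB Require Import structures.
From mathcomp Require Import all_boot all_order all_algebra.
From mathcomp Require Import all_classical all_reals.
From mathcomp Require Import topology normedtype.
From mathcomp Require Import lra.

Set Implicit Arguments.
Unset Strict Implicit.
Unset Printing Implicit Defensive.

Import Order.TTheory GRing.Theory Num.Theory.
Import numFieldNormedType.Exports.

Local Open Scope classical_set_scope.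
Local Open Scope ring_scope.
Local Open Scope quotient_scope.

Section Groups.
Local Open Scope group_scope.
Variable G : groupType.
Implicit Types (H K : set G) (x y z : G).

Definition is_subgroup H := H 1 /\ (forall x y, H x -> H y -> H (x / y)).

Definition generated H : set G := smallest is_subgroup H.

Definition commutator H K : set G :=
  generated [set z | exists2 x, H x & exists2 y, K y & z = [~ x, y]].

Fixpoint lower_central_series n : set G :=
  if n is n'.+1 then commutator (lower_central_series n') [set: G]
  else [set: G].

Definition nilpotent_group := exists n, lower_central_series n = [set 1].

Definition derived_subgroup : set G := commutator [set: G] [set: G].

Lemma derived1 : derived_subgroup 1.
Proof. by move=> A [[A1 _] _]. Qed.

Lemma derivedF x y :
  derived_subgroup x -> derived_subgroup y -> derived_subgroup (x / y).
Proof.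
move=> dx dy A hA; have [[_ AF] _] := hA.
exact: AF (dx _ hA) (dy _ hA).
Qed.

Lemma derivedV x : derived_subgroup x -> derived_subgroup x^-1.
Proof. by move=> dx; rewrite -div1g; exact: derivedF derived1 dx. Qed.

Lemma derivedM x y :
  derived_subgroup x -> derived_subgroup y -> derived_subgroup (x * y).
Proof. by move=> dx dy; rewrite -[y]invgK; apply: derivedF dx (derivedV dy). Qed.

Lemma derivedR x y : derived_subgroup [~ x, y].
Proof. by move=> A /= [_]; apply; exists x => //; exists y. Qed.

Lemma derivedJ x y : derived_subgroup x -> derived_subgroup (x ^ y).
Proof.
move=> dx; rewrite -[x ^ y](mulVKg x) -commgEl.
by apply: derivedM => //; exact: derivedR.
Qed.

(* x and y have the same coset modulo [G, G] *)
Definition abel_rel x y : bool := `[< derived_subgroup (x^-1 * y) >].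

Lemma abel_rel_refl : reflexive abel_rel.
Proof. by move=> x; apply/asboolP; rewrite mulVg; exact: derived1. Qed.

Lemma abel_rel_sym : symmetric abel_rel.
Proof.
move=> x y; apply/asboolP/asboolP => /derivedV;
  by rewrite invgM invgK.
Qed.

Lemma abel_rel_trans : transitive abel_rel.
Proof.
move=> y x z /asboolP xy /asboolP yz; apply/asboolP.
by rewrite -[z](mulVKg y) mulgA; exact: derivedM.
Qed.

Canonical abel_equiv := EquivRel abel_rel abel_rel_refl abel_rel_sym
  abel_rel_trans.

Definition abelianization : Type := {eq_quot abel_equiv}.

HB.instance Definition _ := Choice.on abelianization.

Definition to_ab : G -> abelianization := \pi_{eq_quot abel_equiv}.

Lemma to_abP x y : to_ab x = to_ab y <-> derived_subgroup (x^-1 * y).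
Proof. by split=> [/eqmodP/asboolP|xy]//; apply/eqmodP/asboolP. Qed.

Lemma to_ab_surj (a : abelianization) : exists x, to_ab x = a.
Proof. by exists (repr a); exact: reprK. Qed.

Definition ab_mul (a b : abelianization) := to_ab (repr a * repr b).
Definition ab_inv (a : abelianization) := to_ab (repr a)^-1.

Lemma ab_mulE x y : ab_mul (to_ab x) (to_ab y) = to_ab (x * y).
Proof.
have /to_abP dx := reprK (to_ab x : {eq_quot abel_equiv}).
have /to_abP dy := reprK (to_ab y : {eq_quot abel_equiv}).
rewrite /ab_mul; set u := repr (to_ab x) in dx *.
set v := repr (to_ab y) in dy *.
apply/to_abP; rewrite invgM.
have -> : v^-1 * u^-1 * (x * y) = (u^-1 * x) ^ v * (v^-1 * y).
  by rewrite conjgE !mulgA mulgK.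
by apply: derivedM => //; exact: derivedJ.
Qed.

Lemma ab_invE x : ab_inv (to_ab x) = to_ab x^-1.
Proof.
have /to_abP dx := reprK (to_ab x : {eq_quot abel_equiv}).
rewrite /ab_inv; set u := repr (to_ab x) in dx *.
apply/to_abP; rewrite invgK.
have -> : u * x^-1 = (u^-1 * x)^-1 ^ u^-1.
  by rewrite conjgE !invgM !invgK !mulgA mulgK.
exact: derivedJ (derivedV dx).
Qed.

Fact ab_mulA : associative ab_mul.
Proof.
move=> a b c; have [x <-] := to_ab_surj a; have [y <-] := to_ab_surj b.
by have [z <-] := to_ab_surj c; rewrite !ab_mulE mulgA.
Qed.

Fact ab_mul1g : left_id (to_ab 1) ab_mul.
Proof. by move=> a; have [x <-] := to_ab_surj a; rewrite ab_mulE mul1g. Qed.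

Fact ab_mulg1 : right_id (to_ab 1) ab_mul.
Proof. by move=> a; have [x <-] := to_ab_surj a; rewrite ab_mulE mulg1. Qed.

Fact ab_mulVg : left_inverse (to_ab 1) ab_inv ab_mul.
Proof.
by move=> a; have [x <-] := to_ab_surj a; rewrite ab_invE ab_mulE mulVg.
Qed.

Fact ab_mulgV : right_inverse (to_ab 1) ab_inv ab_mul.
Proof.
by move=> a; have [x <-] := to_ab_surj a; rewrite ab_invE ab_mulE mulgV.
Qed.

HB.instance Definition _ := isGroup.Build abelianization
  ab_mulA ab_mul1g ab_mulg1 ab_mulVg ab_mulgV.

End Groups.

(* X tau M, in Kuratowski's notation; A carries the subspace topology *)
Definition extension_property (X M : topologicalType) :=
  forall (A : set X) (f : A -> M), closed A -> continuous f ->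
    exists2 g : X -> M, continuous g & forall a : A, g (set_val a) = f a.

Section CoveringDimension.
Variable X : topologicalType.
Implicit Types U V : set (set X).

Definition open_cover U :=
  (forall A, U A -> open A) /\ \bigcup_(A in U) A = [set: X].

Definition refines V U :=
  forall B, V B -> exists2 A, U A & B `<=` A.

(* any n + 2 pairwise distinct members have empty intersection *)
Definition order_le V (n : nat) :=
  forall B : 'I_n.+2 -> set X, injective B -> (forall i, V (B i)) ->
    \bigcap_i B i = set0.

(* Cech-Lebesgue covering dimension, by finite open covers *)
Definition covering_dim_le n :=
  forall U, finite_set U -> open_cover U ->
    exists V, [/\ finite_set V, open_cover V, refines V U & order_le V n].

Definition covering_dim_eq n :=
  covering_dim_le n /\ (forall m, (m < n)%N -> ~ covering_dim_le m).

End CoveringDimension.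

Section Cube.
Variable R : realType.
Implicit Type n : nat.

Definition cube n : set 'rV[R]_n := [set x | forall i, 0 <= x ord0 i <= 1].

Definition cube_boundary n : set 'rV[R]_n :=
  [set x | cube x /\ exists i, x ord0 i = 0 \/ x ord0 i = 1].

(* x with its first coordinate, the one along which loops are concatenated,
   replaced by t *)
Definition update0 n (x : 'rV[R]_n.+1) (t : R) : 'rV[R]_n.+1 :=
  \row_j (if j == ord0 then t else x ord0 j).

Lemma update0E n (x : 'rV[R]_n.+1) t : update0 x t ord0 ord0 = t.
Proof. by rewrite mxE eqxx. Qed.

Lemma update0K n (x : 'rV[R]_n.+1) s t :
  update0 (update0 x s) t = update0 x t.
Proof. by apply/rowP => j; rewrite !mxE; case: eqP. Qed.

Lemma update0_id n (x : 'rV[R]_n.+1) : update0 x (x ord0 ord0) = x.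
Proof. by apply/rowP => j; rewrite !mxE; case: ifP => // /eqP ->. Qed.

Lemma cube_update0 n (x : 'rV[R]_n.+1) t :
  cube x -> 0 <= t <= 1 -> cube (update0 x t).
Proof. by move=> cx t01 j; rewrite mxE; case: ifP => // _; exact: cx. Qed.

Lemma boundary_update0 n (x : 'rV[R]_n.+1) t :
  cube_boundary x -> 0 <= t <= 1 ->
  (x ord0 ord0 = 0 -> t = 0 \/ t = 1) -> (x ord0 ord0 = 1 -> t = 0 \/ t = 1) ->
  cube_boundary (update0 x t).
Proof.
move=> [cx [i xi]] t01 h0 h1; split; first exact: cube_update0.
have [i0|i0] := eqVneq i ord0.
  exists ord0; rewrite update0E; rewrite i0 in xi.
  by case: xi => [/h0|/h1].
by exists i; rewrite mxE (negPf i0).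
Qed.

Lemma coord0_continuous n : continuous (fun x : 'rV[R]_n.+1 => x ord0 ord0).
Proof. by move=> x; exact: coord_continuous. Qed.

Lemma closed_cube n : closed (@cube n).
Proof.
rewrite (_ : @cube n = \bigcap_(i : 'I_n)
  ((fun x : 'rV[R]_n => x ord0 i) @^-1` `[0, 1]%classic)); last first.
  apply/seteqP; split=> x /= h i; first by move=> _ /=; rewrite in_itv/=.
  by have := h i I; rewrite /= in_itv.
apply: closed_bigI => i _; apply: closed_comp => [x _|].
  exact: coord_continuous.
exact: interval_closed.
Qed.

End Cube.
Section ContinuousMaps.
Variables (R : realType) (S T U : topologicalType).

Lemma continuous_fst : continuous (@fst T U).
Proof. by move=> x; exact: cvg_fst. Qed.

Lemma continuous_snd : continuous (@snd T U).
Proof. by move=> x; exact: cvg_snd. Qed.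

Lemma continuous_pair (u : S -> T) (v : S -> U) :
  continuous u -> continuous v -> continuous (fun x => (u x, v x)).
Proof. by move=> cu cv x; apply: cvg_pair; [exact: cu|exact: cv]. Qed.

Lemma continuous_affine (c : S -> R) (a b : R) :
  continuous c -> continuous (fun x => a * c x + b).
Proof.
move=> cc x; apply: cvgD; last exact: cvg_cst.
by apply: cvgM; [exact: cvg_cst|exact: cc].
Qed.

End ContinuousMaps.

Section Gluing.
Variables (R : realType) (S M : topologicalType).

Lemma within_continuousT (T : topologicalType) (A : set S) (B : set T)
    (g : S -> T) (f : T -> M) :
  (forall x, A x -> B (g x)) -> continuous g -> {within B, continuous f} ->
  {within A, continuous (fun x => f (g x))}.
Proof.
move=> AB cg /subspace_continuousP cf; apply/subspace_continuousP => x Ax P.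
move=> /(cf (g x) (AB x Ax)) /= BP.
suff : nbhs x (fun y => A y -> P (f (g y))) by [].
have h : nbhs x (fun y => B (g y) -> P (f (g y))) := cg x _ BP.
by apply: filterS h => y BPy Ay; exact: BPy (AB y Ay).
Qed.

Lemma paste_continuous (A : set S) (c : S -> R) (a : R) (F G : S -> M) :
  closed A -> continuous c ->
  {within A `&` [set x | c x <= a], continuous F} ->
  {within A `&` [set x | a <= c x], continuous G} ->
  (forall x, A x -> c x = a -> F x = G x) ->
  {within A, continuous (fun x => if c x <= a then F x else G x)}.
Proof.
move=> clA cc cF cG FG.
have -> : A = (A `&` [set x | c x <= a]) `|` (A `&` [set x | a <= c x]).
  apply/seteqP; split=> x /=; last by case=> -[].
  by move=> Ax; have [?|/ltW ?] := leP (c x) a; [left|right].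
apply: withinU_continuous.
- apply: closedI => //; apply: (@closed_comp _ _ c [set y | y <= a]).
    by move=> x _; exact: cc.
  exact: closed_le.
- apply: closedI => //; apply: (@closed_comp _ _ c [set y | a <= y]).
    by move=> x _; exact: cc.
  exact: closed_ge.
- apply: subspace_eq_continuous cF => x; rewrite inE => -[Ax /= cxa].
  by rewrite /= /from_subspace cxa.
- apply: subspace_eq_continuous cG => x; rewrite inE => -[Ax /= cxa].
  rewrite /= /from_subspace; case: ifP => // cxa'; apply/esym/FG => //.
  by apply/eqP; rewrite eq_le cxa cxa'.
Qed.

Lemma continuous_update0 n (u : S -> 'rV[R]_n.+1) (t : S -> R) :
  continuous u -> continuous t ->
  continuous (fun s => update0 (u s) (t s)).
Proof.
move=> cu ct s P [B hB sB].
have h : \forall s' \near s, forall ij : 'I_1 * 'I_n.+1,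
    B ij.1 ij.2 (update0 (u s') (t s') ij.1 ij.2).
  apply: filter_forall => -[i j] /=.
  have := hB i j; rewrite mxE; case: ifPn => [j0|j0] hBij.
    have h : nbhs s (fun s' => B i j (t s')) := ct s _ hBij.
    by apply: filterS h => s' h; rewrite mxE j0.
  have cc : continuous (fun s' => u s' ord0 j).
    move=> z; apply: (@continuous_comp _ _ _ u (fun x => x ord0 j)).
      exact: cu.
    exact: coord_continuous.
  have h : nbhs s (fun s' => B i j (u s' ord0 j)) := cc s _ hBij.
  by apply: filterS h => s' h; rewrite mxE (negPf j0).
by apply: filterS h => s' h'; apply: sB => i j; exact: h' (i, j).
Qed.

End Gluing.

Section Loops.
Variables (R : realType) (M : topologicalType) (n : nat) (x0 : M).

Record loop := Loop {
  loop_fun :> 'rV[R]_n -> M;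
  loop_continuous : {within @cube R n, continuous loop_fun};
  loop_boundary : forall x, cube_boundary x -> loop_fun x = x0
}.

HB.instance Definition _ := gen_eqMixin loop.
HB.instance Definition _ := gen_choiceMixin loop.

Definition cylinder : set (R * 'rV[R]_n) :=
  [set tx | 0 <= tx.1 <= 1 /\ cube tx.2].

(* Homotopy relative to the boundary of the cube; values outside the cube are
   irrelevant. *)
Definition homotopic (f g : loop) := exists H : R * 'rV[R]_n -> M,
  [/\ {within cylinder, continuous H},
      forall x, cube x -> H (0, x) = f x,
      forall x, cube x -> H (1, x) = g x &
      forall t x, 0 <= t <= 1 -> cube_boundary x -> H (t, x) = x0].

Lemma closed_cylinder : closed cylinder.
Proof.
rewrite (_ : cylinder = (fst @^-1` [set t | 0 <= t]) `&`
  (fst @^-1` [set t | t <= 1]) `&` (snd @^-1` @cube R n)); last first.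
  apply/seteqP; split=> -[t x] /=; rewrite /cylinder /=.
    by move=> [/andP[t0 t1] cx].
  by move=> [[t0 t1] cx]; split=> //; apply/andP.
apply: closedI; [apply: closedI|]; apply: closed_comp.
- by move=> x _; exact: cvg_fst.
- exact: closed_ge.
- by move=> x _; exact: cvg_fst.
- exact: closed_le.
- by move=> x _; exact: cvg_snd.
- exact: closed_cube.
Qed.

Lemma eq_homotopic (f g : loop) :
  (forall x, cube x -> f x = g x) -> homotopic f g.
Proof.
move=> fg; exists (fun tx => f tx.2); split=> //=.
- apply: (@within_continuousT _ _ _ _ (@cube R n) snd f) => [tx []//|x|].
    exact: cvg_snd.
  exact: loop_continuous.
- by move=> t x _ bx; exact: loop_boundary.
Qed.

Lemma homotopic_sym (f g : loop) : homotopic f g -> homotopic g f.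
Proof.
move=> [H [cH H0 H1 Hb]]; exists (fun tx => H (-1 * tx.1 + 1, tx.2)); split=> /=.
- apply: (within_continuousT (B := cylinder)
    (g := fun tx : R * 'rV[R]_n => (-1 * tx.1 + 1, tx.2))) cH.
    by move=> [t x] /= [/andP[/= t0 t1] cx]; split => //=; lra.
  apply: continuous_pair; last exact: continuous_snd.
  exact/continuous_affine/continuous_fst.
- by move=> x cx; rewrite mulr0 add0r H1.
- by move=> x cx; rewrite mulr1 addNr H0.
- by move=> t x t01 bx; apply: Hb => //; lra.
Qed.

Lemma homotopic_trans (f g h : loop) :
  homotopic f g -> homotopic g h -> homotopic f h.
Proof.
move=> [H [cH H0 H1 Hb]] [K [cK K0 K1 Kb]].
exists (fun tx => if tx.1 <= 2^-1 then H (2 * tx.1 + 0, tx.2)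
                  else K (2 * tx.1 + -1, tx.2)); split => /=.
- apply: (paste_continuous (c := fst)
    (F := fun tx => H (2 * tx.1 + 0, tx.2)) (G := fun tx => K (2 * tx.1 + -1, tx.2))).
  + exact: closed_cylinder.
  + by move=> x; exact: cvg_fst.
  + apply: (within_continuousT (B := cylinder)
      (g := fun tx : R * 'rV[R]_n => (2 * tx.1 + 0, tx.2))) cH.
      by move=> [t x] /= [[/andP[/= t0 t1] cx] /= t2]; split => //=; lra.
    apply: continuous_pair; last exact: continuous_snd.
    exact/continuous_affine/continuous_fst.
  + apply: (within_continuousT (B := cylinder)
      (g := fun tx : R * 'rV[R]_n => (2 * tx.1 + -1, tx.2))) cK.
      by move=> [t x] /= [[/andP[/= t0 t1] cx] /= t2]; split => //=; lra.
    apply: continuous_pair; last exact: continuous_snd.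
    exact/continuous_affine/continuous_fst.
  + move=> [t x] /= [_ /= cx] ->.
    by rewrite divff ?pnatr_eq0// addr0 subrr H1 ?K0.
- by move=> x cx; rewrite ifT ?mulr0 ?addr0 ?H0//; lra.
- move=> x cx; rewrite ifF; last by apply/negbTE; rewrite -ltNge; lra.
  by rewrite (_ : 2 * 1 + -1 = 1) ?K1 //; lra.
- move=> t x t01 bx; case: ifPn => [t2|]; first by apply: Hb => //; lra.
  by rewrite -ltNge => t2; apply: Kb => //; lra.
Qed.

Definition homotopicb (f g : loop) : bool := `[< homotopic f g >].

Fact homotopicb_refl : reflexive homotopicb.
Proof. by move=> f; apply/asboolP/eq_homotopic. Qed.

Fact homotopicb_sym : symmetric homotopicb.
Proof. by move=> f g; apply/asboolP/asboolP => /homotopic_sym. Qed.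

Fact homotopicb_trans : transitive homotopicb.
Proof.
by move=> g f h /asboolP fg /asboolP gh; apply/asboolP/(homotopic_trans fg).
Qed.

Canonical homotopic_equiv :=
  EquivRel homotopicb homotopicb_refl homotopicb_sym homotopicb_trans.

(* pi_n (M, x0); for n = 0 the boundary of the cube is empty and this is the
   set of path components. *)
Definition homotopy_group : Type := {eq_quot homotopic_equiv}.

HB.instance Definition _ := Choice.on homotopy_group.

Definition homotopy_class : loop -> homotopy_group :=
  \pi_{eq_quot homotopic_equiv}.

Lemma homotopy_classP f g :
  homotopy_class f = homotopy_class g <-> homotopic f g.
Proof. by split=> [/eqmodP/asboolP|fg]//; apply/eqmodP/asboolP. Qed.

Lemma homotopy_class_surj (a : homotopy_group) : exists f, homotopy_class f = a.
Proof. by exists (repr a); exact: reprK. Qed.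

Lemma homotopic_repr f : homotopic (repr (homotopy_class f)) f.
Proof. by apply/homotopy_classP; exact: reprK. Qed.

End Loops.

Arguments loop R {M} n x0.
Arguments homotopy_group R {M} n x0.

Section HomotopyGroup.
Variables (R : realType) (M : topologicalType) (n : nat) (x0 : M).
Local Notation loop := (loop R n.+1 x0).
Local Notation pi := (homotopy_group R n.+1 x0).
Local Notation cube := (@cube R n.+1).
Implicit Types f g h : loop.

Lemma cube0 (x : 'rV[R]_n.+1) : cube x -> 0 <= x ord0 ord0 <= 1.
Proof. exact. Qed.

Lemma loop_at0 f (x : 'rV[R]_n.+1) t :
  cube x -> t = 0 \/ t = 1 -> f (update0 x t) = x0.
Proof.
move=> cx t01; apply: loop_boundary; split.
  by apply: cube_update0 => //; case: t01 => ->; rewrite lexx ler01.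
by exists ord0; rewrite update0E.
Qed.

Lemma loop_boundary0 f (x : 'rV[R]_n.+1) t :
  cube_boundary x -> 0 <= t <= 1 ->
  (x ord0 ord0 = 0 -> t = 0 \/ t = 1) -> (x ord0 ord0 = 1 -> t = 0 \/ t = 1) ->
  f (update0 x t) = x0.
Proof. by move=> bx t01 h0 h1; apply/loop_boundary/boundary_update0. Qed.

Lemma continuous_loop_update0 (S : topologicalType) (A : set S)
    (u : S -> 'rV[R]_n.+1) (t : S -> R) f :
  continuous u -> continuous t -> (forall s, A s -> cube (u s)) ->
  (forall s, A s -> 0 <= t s <= 1) ->
  {within A, continuous (fun s => f (update0 (u s) (t s)))}.
Proof.
move=> cu ct Au At; apply: (@within_continuousT _ _ _ _ cube
  (fun s => update0 (u s) (t s)) f) => [s As||].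
- by apply: cube_update0; [exact: Au|exact: At].
- exact: continuous_update0.
- exact: loop_continuous.
Qed.

Lemma reparametrize_homotopic f g h (u v : R -> R) :
  continuous u -> continuous v ->
  (forall t, 0 <= t <= 1 -> 0 <= u t <= 1) ->
  (forall t, 0 <= t <= 1 -> 0 <= v t <= 1) ->
  u 0 = 0 \/ u 0 = 1 -> u 1 = 0 \/ u 1 = 1 -> v 0 = u 0 -> v 1 = u 1 ->
  (forall x, cube x -> g x = f (update0 x (u (x ord0 ord0)))) ->
  (forall x, cube x -> h x = f (update0 x (v (x ord0 ord0)))) ->
  homotopic g h.
Proof.
move=> cu cv u01 v01 u0 u1 v0 v1 gE hE.
pose w (tx : R * 'rV[R]_n.+1) :=
  u (tx.2 ord0 ord0) + tx.1 * (v (tx.2 ord0 ord0) - u (tx.2 ord0 ord0)).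
have w01 t x : 0 <= t <= 1 -> cube x -> 0 <= w (t, x) <= 1.
  move=> t01 /cube0 cx; rewrite /w /=.
  have := u01 _ cx; have := v01 _ cx.
  move: (u _) (v _) t01 => a b /andP[t0 t1] /andP[b0 b1] /andP[a0 a1].
  by apply/andP; split; nra.
have cc : continuous (fun tx : R * 'rV[R]_n.+1 => tx.2 ord0 ord0).
  move=> z; apply: (@continuous_comp _ _ _ snd
    (fun x : 'rV[R]_n.+1 => x ord0 ord0)).
    exact: continuous_snd.
  exact: coord0_continuous.
have cw : continuous w.
  have cu' : continuous (fun tx : R * 'rV[R]_n.+1 => u (tx.2 ord0 ord0)).
    move=> z; apply: (@continuous_comp _ _ _
      (fun tx : R * 'rV[R]_n.+1 => tx.2 ord0 ord0) u); [exact: cc|exact: cu].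
  have cv' : continuous (fun tx : R * 'rV[R]_n.+1 => v (tx.2 ord0 ord0)).
    move=> z; apply: (@continuous_comp _ _ _
      (fun tx : R * 'rV[R]_n.+1 => tx.2 ord0 ord0) v); [exact: cc|exact: cv].
  move=> z; apply: cvgD; first exact: cu'.
  by apply: cvgM; [exact: continuous_fst|apply: cvgB; [exact: cv'|exact: cu']].
exists (fun tx => f (update0 tx.2 (w tx))); split.
- apply: continuous_loop_update0 => //; first exact: continuous_snd.
    by move=> s [].
  by move=> [t x] [/= t01 cx]; exact: w01.
- by move=> x cx /=; rewrite /w /= mul0r addr0 gE.
- by move=> x cx /=; rewrite /w /= mul1r addrC subrK hE.
- move=> t x t01 [cx bx] /=; apply: loop_boundary0 => //; first exact: w01.
    by move=> xE; rewrite /w /= xE v0 subrr mulr0 addr0.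
  by move=> xE; rewrite /w /= xE v1 subrr mulr0 addr0.
Qed.

Definition concat_fun f g (x : 'rV[R]_n.+1) : M :=
  if x ord0 ord0 <= 2^-1 then f (update0 x (2 * x ord0 ord0 + 0))
  else g (update0 x (2 * x ord0 ord0 + -1)).

Fact concat_continuous f g : {within cube, continuous (concat_fun f g)}.
Proof.
apply: (paste_continuous (c := fun x : 'rV[R]_n.+1 => x ord0 ord0)
  (F := fun x : 'rV[R]_n.+1 => f (update0 x (2 * x ord0 ord0 + 0)))
  (G := fun x : 'rV[R]_n.+1 => g (update0 x (2 * x ord0 ord0 + -1)))).
- exact: closed_cube.
- exact: coord0_continuous.
- apply: continuous_loop_update0 => //.
  + by move=> x; exact: cvg_id.
  + apply: continuous_affine; exact: coord0_continuous.
  + by move=> x [].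
  + by move=> x [/cube0/andP[? ?] /= ?]; lra.
- apply: continuous_loop_update0 => //.
  + by move=> x; exact: cvg_id.
  + apply: continuous_affine; exact: coord0_continuous.
  + by move=> x [].
  + by move=> x [/cube0/andP[? ?] /= ?]; lra.
- move=> x cx xE; rewrite !loop_at0//; rewrite xE.
  + by left; rewrite divff ?pnatr_eq0// subrr.
  + by right; rewrite divff ?pnatr_eq0// addr0.
Qed.

Fact concat_boundary f g x : cube_boundary x -> concat_fun f g x = x0.
Proof.
move=> bx; have [/cube0/andP[x_ge0 x_le1] _] := bx.
rewrite /concat_fun; case: ifPn => [xh|]; last rewrite -ltNge => xh.
  apply: loop_boundary0 => //; first lra.
    by move=> ->; left; lra.
  by move=> xE; exfalso; move: xh; rewrite xE; lra.
apply: loop_boundary0 => //; first lra.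
  by move=> xE; exfalso; move: xh; rewrite xE; lra.
by move=> ->; right; lra.
Qed.

Definition concat f g : loop :=
  Loop (@concat_continuous f g) (@concat_boundary f g).

Fact const_continuous : {within cube, continuous (fun=> x0)}.
Proof. by apply: continuous_subspaceT; exact: cst_continuous. Qed.

Definition const_loop : loop := Loop (@const_continuous) (fun _ _ => erefl).

Definition reverse_fun f (x : 'rV[R]_n.+1) : M :=
  f (update0 x (-1 * x ord0 ord0 + 1)).

Fact reverse_continuous f : {within cube, continuous (reverse_fun f)}.
Proof.
apply: continuous_loop_update0 => //.
  by move=> x; exact: cvg_id.
  apply: continuous_affine; exact: coord0_continuous.
by move=> x /cube0/andP[? ?]; lra.
Qed.

Fact reverse_boundary f x : cube_boundary x -> reverse_fun f x = x0.
Proof.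
move=> bx; have [/cube0/andP[x_ge0 x_le1] _] := bx.
apply: loop_boundary0 => //; first lra.
  by move=> ->; right; lra.
by move=> ->; left; lra.
Qed.

Definition reverse f : loop :=
  Loop (@reverse_continuous f) (@reverse_boundary f).

Lemma concat_homotopic f f' g g' :
  homotopic f f' -> homotopic g g' -> homotopic (concat f g) (concat f' g').
Proof.
move=> [H [cH H0 H1 Hb]] [K [cK K0 K1 Kb]].
pose c (tx : R * 'rV[R]_n.+1) := tx.2 ord0 ord0.
have cc : continuous c.
  move=> z; apply: (@continuous_comp _ _ _ snd
    (fun x : 'rV[R]_n.+1 => x ord0 ord0)).
    exact: continuous_snd.
  exact: coord0_continuous.
have cup a b : continuous (fun tx : R * 'rV[R]_n.+1 =>
    (tx.1, update0 tx.2 (a * c tx + b))).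
  apply: continuous_pair; first exact: continuous_fst.
  apply: continuous_update0; first exact: continuous_snd.
  exact: continuous_affine.
exists (fun tx => if c tx <= 2^-1 then H (tx.1, update0 tx.2 (2 * c tx + 0))
  else K (tx.1, update0 tx.2 (2 * c tx + -1))); split.
- apply: (paste_continuous (c := c)
    (F := fun tx => H (tx.1, update0 tx.2 (2 * c tx + 0)))
    (G := fun tx => K (tx.1, update0 tx.2 (2 * c tx + -1)))).
  + exact: closed_cylinder.
  + exact: cc.
  + apply: (within_continuousT (B := @cylinder R n.+1)
      (g := fun tx => (tx.1, update0 tx.2 (2 * c tx + 0)))) cH => //.
    move=> [t x] /= [[/= t01 cx]]; rewrite /c /= => xh; split => //=.
    by apply: cube_update0 => //; have /andP[? ?] := cube0 cx; lra.
  + apply: (within_continuousT (B := @cylinder R n.+1)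
      (g := fun tx => (tx.1, update0 tx.2 (2 * c tx + -1)))) cK => //.
    move=> [t x] /= [[/= t01 cx]]; rewrite /c /= => xh; split => //=.
    by apply: cube_update0 => //; have /andP[? ?] := cube0 cx; lra.
  + move=> [t x] [/= t01 cx] ->.
    rewrite divff ?pnatr_eq0// addr0 subrr Hb ?Kb//.
      split; first by apply: cube_update0 => //; rewrite lexx ler01.
      by exists ord0; rewrite update0E; left.
    split; first by apply: cube_update0 => //; rewrite lexx ler01.
    by exists ord0; rewrite update0E; right.
- move=> x cx; have /andP[? ?] := cube0 cx; rewrite /c /= /concat_fun.
  case: ifPn => [xh|]; last rewrite -ltNge => xh.
    by rewrite H0//; apply: cube_update0 => //; lra.
  by rewrite K0//; apply: cube_update0 => //; lra.
- move=> x cx; have /andP[? ?] := cube0 cx; rewrite /c /= /concat_fun.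
  case: ifPn => [xh|]; last rewrite -ltNge => xh.
    by rewrite H1//; apply: cube_update0 => //; lra.
  by rewrite K1//; apply: cube_update0 => //; lra.
- move=> t x t01 bx; have [/cube0/andP[? ?] _] := bx; rewrite /c /=.
  case: ifPn => [xh|]; last rewrite -ltNge => xh.
    apply: Hb => //; apply: boundary_update0 => //; first lra.
      by move=> ->; left; lra.
    by move=> xE; exfalso; move: xh; rewrite xE; lra.
  apply: Kb => //; apply: boundary_update0 => //; first lra.
    by move=> xE; exfalso; move: xh; rewrite xE; lra.
  by move=> ->; right; lra.
Qed.

Let affine_continuous (a b : R) : continuous (fun t : R => a * t + b).
Proof. by apply: (@continuous_affine _ _ id) => x; exact: cvg_id. Qed.

Let min_continuous (u v : R -> R) : continuous u -> continuous v ->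
  continuous (fun t => Num.min (u t) (v t)).
Proof.
by move=> cu cv x; apply: continuous_min; [exact: cu|exact: cv].
Qed.

Let max_continuous (u v : R -> R) : continuous u -> continuous v ->
  continuous (fun t => Num.max (u t) (v t)).
Proof.
by move=> cu cv x; apply: continuous_max; [exact: cu|exact: cv].
Qed.

Local Ltac split_ifs :=
  repeat match goal with |- context [if ?b then _ else _] =>
    lazymatch b with
    | context [if _ then _ else _] => fail
    | _ => let H := fresh in case: (boolP b); rewrite -?ltNge /= => H
    end
  end.
Local Ltac solve_arg :=
  first [by exfalso; lra | by congr (loop_fun _ (update0 _ _)); lra
        | by rewrite loop_at0//; left; lra | by rewrite loop_at0//; right; lra].

Lemma concatA f g h :
  homotopic (concat f (concat g h)) (concat (concat f g) h).
Proof.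
pose u (t : R) :=
  Num.min (2 * t + 0) (Num.min (1 * t + 4^-1) (2^-1 * t + 2^-1)).
apply: (@reparametrize_homotopic (concat f (concat g h)) _ _ id u) => //.
- by move=> t; exact: cvg_id.
- by rewrite /u; apply: min_continuous => //; apply: min_continuous.
- by move=> t /andP[? ?]; rewrite /u !minEle; split_ifs; lra.
- by left.
- by right.
- by rewrite /u !minEle; split_ifs; lra.
- by rewrite /u !minEle; split_ifs; lra.
- by move=> x _; rewrite update0_id.
- move=> x cx; rewrite /= /concat_fun !update0E /u.
  have /andP[x_ge0 x_le1] := cube0 cx.
  rewrite /= /concat_fun !update0E !update0K !minEle.
  move: (x ord0 ord0) x_ge0 x_le1 => t t_ge0 t_le1.
  split_ifs; rewrite ?update0K; solve_arg.
Qed.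

Lemma concat1l f : homotopic (concat const_loop f) f.
Proof.
pose u (t : R) := Num.max 0 (2 * t + -1).
apply: (@reparametrize_homotopic f _ _ u id) => //.
- by rewrite /u; apply: max_continuous => //; exact: cst_continuous.
- by move=> t; exact: cvg_id.
- by move=> t /andP[? ?]; rewrite /u maxEle; split_ifs; lra.
- by left; rewrite /u maxEle; split_ifs; lra.
- by right; rewrite /u maxEle; split_ifs; lra.
- by rewrite /u maxEle; split_ifs; lra.
- by rewrite /u maxEle; split_ifs; lra.
- move=> x cx; rewrite /= /concat_fun /= /u maxEle.
  by split_ifs; solve_arg.
- by move=> x _; rewrite update0_id.
Qed.

Lemma concatl1 f : homotopic (concat f const_loop) f.
Proof.
pose u (t : R) := Num.min (2 * t + 0) 1.
apply: (@reparametrize_homotopic f _ _ u id) => //.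
- by rewrite /u; apply: min_continuous => //; exact: cst_continuous.
- by move=> t; exact: cvg_id.
- by move=> t /andP[? ?]; rewrite /u minEle; split_ifs; lra.
- by left; rewrite /u minEle; split_ifs; lra.
- by right; rewrite /u minEle; split_ifs; lra.
- by rewrite /u minEle; split_ifs; lra.
- by rewrite /u minEle; split_ifs; lra.
- move=> x cx; rewrite /= /concat_fun /= /u minEle.
  by split_ifs; solve_arg.
- by move=> x _; rewrite update0_id.
Qed.

Lemma concatVl f : homotopic (concat (reverse f) f) const_loop.
Proof.
pose u (t : R) := Num.max (-2 * t + 1) (2 * t + -1).
apply: (@reparametrize_homotopic f _ _ u (fun=> 1)) => //.
- by rewrite /u; apply: max_continuous.
- exact: cst_continuous.
- by move=> t /andP[? ?]; rewrite /u maxEle; split_ifs; lra.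
- by move=> t _; rewrite ler01 lexx.
- by right; rewrite /u maxEle; split_ifs; lra.
- by right; rewrite /u maxEle; split_ifs; lra.
- by rewrite /u maxEle; split_ifs; lra.
- by rewrite /u maxEle; split_ifs; lra.
- move=> x cx; rewrite /= /concat_fun /= /reverse_fun /u maxEle.
  rewrite update0E update0K.
  by split_ifs; solve_arg.
- by move=> x cx; rewrite loop_at0//; right.
Qed.

Lemma concatlV f : homotopic (concat f (reverse f)) const_loop.
Proof.
pose u (t : R) := Num.min (2 * t + 0) (-2 * t + 2).
apply: (@reparametrize_homotopic f _ _ u (fun=> 0)) => //.
- by rewrite /u; apply: min_continuous.
- exact: cst_continuous.
- by move=> t /andP[? ?]; rewrite /u minEle; split_ifs; lra.
- by move=> t _; rewrite ler01 lexx.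
- by left; rewrite /u minEle; split_ifs; lra.
- by left; rewrite /u minEle; split_ifs; lra.
- by rewrite /u minEle; split_ifs; lra.
- by rewrite /u minEle; split_ifs; lra.
- move=> x cx; rewrite /= /concat_fun /= /reverse_fun /u minEle.
  rewrite update0E update0K.
  by split_ifs; solve_arg.
- by move=> x cx; rewrite loop_at0//; left.
Qed.

Lemma reverse_homotopic f g :
  homotopic f g -> homotopic (reverse f) (reverse g).
Proof.
move=> fg; apply: (homotopic_trans (homotopic_sym (concatl1 _))).
apply: (homotopic_trans
  (concat_homotopic (eq_homotopic _) (homotopic_sym (concatlV g)))) => //.
apply: (homotopic_trans (concatA _ _ _)).
apply: homotopic_trans (concat1l _).
apply: concat_homotopic; last exact: eq_homotopic.
apply: homotopic_trans (concatVl f).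
apply: concat_homotopic; first exact: eq_homotopic.
exact: homotopic_sym.
Qed.

Local Notation class := (@homotopy_class R M n.+1 x0).

Definition pi_mul (a b : pi) : pi := class (concat (repr a) (repr b)).
Definition pi_inv (a : pi) : pi := class (reverse (repr a)).

Lemma pi_mulE f g : pi_mul (class f) (class g) = class (concat f g).
Proof. by apply/homotopy_classP/concat_homotopic; exact: homotopic_repr. Qed.

Lemma pi_invE f : pi_inv (class f) = class (reverse f).
Proof. by apply/homotopy_classP/reverse_homotopic/homotopic_repr. Qed.

Fact pi_mulA : associative pi_mul.
Proof.
move=> a b c; have [f <-] := homotopy_class_surj a.
have [g <-] := homotopy_class_surj b; have [h <-] := homotopy_class_surj c.
by rewrite !pi_mulE; exact/homotopy_classP/concatA.
Qed.

Fact pi_mul1g : left_id (class const_loop) pi_mul.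
Proof.
move=> a; have [f <-] := homotopy_class_surj a.
by rewrite pi_mulE; exact/homotopy_classP/concat1l.
Qed.

Fact pi_mulg1 : right_id (class const_loop) pi_mul.
Proof.
move=> a; have [f <-] := homotopy_class_surj a.
by rewrite pi_mulE; exact/homotopy_classP/concatl1.
Qed.

Fact pi_mulVg : left_inverse (class const_loop) pi_inv pi_mul.
Proof.
move=> a; have [f <-] := homotopy_class_surj a.
by rewrite pi_invE pi_mulE; exact/homotopy_classP/concatVl.
Qed.

Fact pi_mulgV : right_inverse (class const_loop) pi_inv pi_mul.
Proof.
move=> a; have [f <-] := homotopy_class_surj a.
by rewrite pi_invE pi_mulE; exact/homotopy_classP/concatlV.
Qed.

HB.instance Definition _ := isGroup.Build pi
  pi_mulA pi_mul1g pi_mulg1 pi_mulVg pi_mulgV.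

End HomotopyGroup.

Section Disk.
Variables (R : realType) (n : nat).

Definition sqnorm (x : 'rV[R]_n) : R := \sum_i x ord0 i ^+ 2.

Definition closed_disk : set 'rV[R]_n := [set x | sqnorm x <= 1].
Definition open_disk : set 'rV[R]_n := [set x | sqnorm x < 1].
Definition sphere : set 'rV[R]_n := [set x | sqnorm x = 1].

End Disk.

(* The interiors of the cells partition the Hausdorff space M, the boundary of
   each cell lies in finitely many cells of lower dimension, and M carries the
   weak topology. *)
Record cw_structure (R : realType) (M : topologicalType) := CWStructure {
  cell : Type;
  dim_cell : cell -> nat;
  char_map : forall e : cell, 'rV[R]_(dim_cell e) -> M;
  open_cell := fun e : cell => @char_map e @` @open_disk R (dim_cell e);
  cw_hausdorff : hausdorff_space M;
  char_map_continuous : forall e,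
    {within @closed_disk R (dim_cell e), continuous (@char_map e)};
  char_map_inj : forall e,
    {in @open_disk R (dim_cell e) &, injective (@char_map e)};
  open_cells_disjoint : trivIset [set: cell] open_cell;
  open_cells_cover : \bigcup_e open_cell e = [set: M];
  closure_finite : forall e, exists D : set cell,
    [/\ finite_set D, forall d, D d -> (dim_cell d < dim_cell e)%N &
        @char_map e @` @sphere R (dim_cell e) `<=` \bigcup_(d in D) open_cell d];
  cw_weak_topology : forall A : set M,
    (forall e, closed (@closed_disk R (dim_cell e) `&` @char_map e @^-1` A)) ->
    closed A
}.

(* M is a CW complex K(G,1); triviality of pi_0 is path-connectedness. *)
Definition eilenberg_maclane1 (R : realType) (G : groupType)
    (M : topologicalType) :=
  [/\ inhabited (cw_structure R M),
      [set: M] !=set0,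
      forall x0 : M, exists f : {multiplicative G -> homotopy_group R 1 x0},
        bijective f &
      forall (x0 : M) (n : nat), n <> 1%N ->
        forall a b : homotopy_group R n x0, a = b].

(* Main.v *)
(** For K = K(G,1), the property X tau K is equivalent to a statement E(G) about
    principal bundles: whenever u is a circle-valued map on a closed subset A
    of X and g is in G, the pullback under u of the G-bundle on the circle with
    monodromy g extends from A to X. Bundles are given by cocycles on locally
    finite systems of coordinates, so that E makes sense for cocycles modulo a
    normal subgroup.

    If X tau K, extend to X the composite of u with a loop of class g; the
    holonomies of short paths between its values form the required cocycle.
    Conversely, as dim X <= 2, a map f from A to K is extended in the manner of
    Kuratowski and Dugundji over the 2-dimensional nerve of a cover of the
    complement of A. Small triangles are filled by the local structure of K. For
    a large triangle only the map on the part of X lying over its boundary has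
    to be extended, and E(G) does this: a map to K on a 2-dimensional system is
    a cocycle.

    E(G) gives E(G_ab) by change of group. Conversely E(G_ab) is E(G) modulo the
    second term L_1 of the lower central series L_0 = G, L_1, L_2, ... For a in
    L_n the map x |-> [a,x] induces a homomorphism from G_ab to L_(n+1)/L_(n+2),
    so that E(G_ab) implies E for monodromy in L_(n+1) modulo L_(n+2); and the
    defects of a cocycle modulo L_(n+1) on the triangles of a 2-dimensional
    system are removed by such extensions, leading to a cocycle modulo L_(n+2).
    Nilpotency makes the induction end with E(G). *)

(* Neither space carries a triangulation on which obstruction theory could run: X is any metric
   space of covering dimension 2, and K is any CW complex, perhaps not metrizable. On the side of X
   the substitute is a locally finite system of coordinates. Dimension enters through one fact: a
   map into a simplex with four or more vertices can be pushed into the boundary. Hence at most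
   three coordinates need be positive at a point, and only vertices, edges and triangles are ever
   filled. On the side of K, a map from a metric space lies locally in a finite subcomplex, which is
   a neighborhood retract of a normed space; retracted segments give short paths and small fillings,
   needed for continuity at the points of A.

   A triangle whose boundary has nontrivial holonomy cannot be filled in K, but it need not be: it
   is enough to map the part of X over it, and there the obstruction is a circle map with a
   monodromy. This is why E speaks of circle maps. Working with G-valued functions that are cocycles
   modulo a normal subgroup avoids building a complex for each quotient of G; only the two given
   complexes ever appear. *)
From HB Require Import structures.
Require Import Defs.
From mathcomp Require Import all_boot all_order all_algebra finmap.
From mathcomp Require Import all_classical all_reals.
From mathcomp Require Import topology normedtype numfun realfun wochoice.
From mathcomp Require Import interval_inference ring lra.

Set Implicit Arguments.
Unset Strict Implicit.
Unset Printing Implicit Defensive.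
Set SsrOldRewriteGoalsOrder.

Import Order.TTheory GRing.Theory Num.Theory.
Import numFieldNormedType.Exports.

Local Open Scope classical_set_scope.
Local Open Scope ring_scope.

(** * Relative continuity *)

Section RelativeContinuity.
Variables (S T U : topologicalType).
Implicit Types (A B : set S) (f g : S -> T).

(** The function is total and its values off [A] are junk, possibly discontinuous. Partial maps,
    such as ratios of coordinates, are thus handled without subspace types. *)
Definition cts A f := forall x, A x -> f @ within A (nbhs x) --> f x.

Lemma continuous_cts A f : continuous f -> cts A f.
Proof.
move=> cf x _ P /(cf x) h.
suff : nbhs x (fun y => A y -> P (f y)) by [].
by move: h; rewrite nbhs_simpl /=; apply: filterS => y.
Qed.

Lemma cts_continuous f : cts [set: S] f -> continuous f.
Proof.
move=> cf x P /(cf x I) h.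
have {}h : nbhs x (fun y => setT y -> P (f y)) by [].
by rewrite nbhs_simpl /=; apply: filterS h => y; apply.
Qed.

Lemma within_cts A f : {within A, continuous f} -> cts A f.
Proof. by move=> /subspace_continuousP cf x /cf. Qed.

Lemma cts_within A f : cts A f -> {within A, continuous f}.
Proof. by move=> cf; apply/subspace_continuousP => x /cf. Qed.

Lemma ctsP A f : cts A f <->
  forall x (P : set T), A x -> nbhs (f x) P -> \forall y \near x, A y -> P (f y).
Proof. by split=> [cf x P /cf h /h|cf x Ax P /(cf x P Ax)]. Qed.

Lemma sub_cts A B f : A `<=` B -> cts B f -> cts A f.
Proof.
move=> AB /ctsP cf; apply/ctsP => x P /AB Bx /(cf _ _ Bx).
by apply: filterS => y + /AB; apply.
Qed.

Lemma eq_cts A f g : (forall x, A x -> f x = g x) -> cts A f -> cts A g.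
Proof.
move=> fg /ctsP cf; apply/ctsP => x P Ax; rewrite -fg// => /(cf _ _ Ax).
by apply: filterS => y + Ay; rewrite -fg//; apply.
Qed.

Lemma ctsU A B f : closed A -> closed B -> cts A f -> cts B f -> cts (A `|` B) f.
Proof.
by move=> cA cB /cts_within hA /cts_within hB; apply/within_cts/withinU_continuous.
Qed.

Lemma cts_near A f (x : S) (P : set T) :
  cts A f -> A x -> nbhs (f x) P -> \forall y \near x, A y -> P (f y).
Proof. by move=> /ctsP; apply. Qed.

Lemma cts_nbhs A f x : nbhs x A -> cts A f -> f @ x --> f x.
Proof.
move=> xA cf P fP; have Ax := nbhs_singleton xA.
apply: filterS2 xA (cts_near cf Ax fP) => y Ay h; exact: h.
Qed.

Lemma cts_local A f :
  (forall x, A x -> exists2 N : set S, nbhs x N & cts (A `&` N) f) -> cts A f.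
Proof.
move=> loc; apply/ctsP => x P Ax fP; have [N Nx cf] := loc x Ax.
have ANx : (A `&` N) x by split=> //; exact: nbhs_singleton.
apply: filterS2 Nx (cts_near cf ANx fP) => y Ny h Ay; exact: h.
Qed.

Lemma closed_preimage_cts A f (C : set T) :
  closed A -> cts A f -> closed C -> closed (A `&` f @^-1` C).
Proof.
move=> cA cf cC x clx; have Ax : A x.
  by apply: cA => P /clx [y [[Ay _] Py]]; exists y.
split=> //=; apply: cC => P /(cts_near cf Ax) h.
have [y [[Ay Cy] Py]] := clx _ h; by exists (f y); split=> //; exact: Py.
Qed.

End RelativeContinuity.

Lemma cts_comp (S T U : topologicalType) (A : set S) (B : set T) (f : S -> T)
    (g : T -> U) :
  (forall x, A x -> B (f x)) -> cts A f -> cts B g -> cts A (g \o f).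
Proof.
move=> AB cf cg; apply/ctsP => x P Ax gP.
apply: filterS (cts_near cf Ax (cts_near cg (AB _ Ax) gP)) => y h Ay.
exact: h Ay (AB _ Ay).
Qed.

Lemma continuous_comp_cts (S T U : topologicalType) (A : set S) (f : S -> T)
    (g : T -> U) : continuous g -> cts A f -> cts A (g \o f).
Proof.
by move=> cg cf; apply: (@cts_comp _ _ _ _ setT) => //; exact: continuous_cts.
Qed.

Lemma cts_pair (S T U : topologicalType) (A : set S) (f : S -> T) (g : S -> U) :
  cts A f -> cts A g -> cts A (fun x => (f x, g x)).
Proof. by move=> cf cg x Ax; apply: cvg_pair; [exact: cf|exact: cg]. Qed.

Lemma cts_cst (S T : topologicalType) (A : set S) (c : T) : cts A (fun=> c).
Proof. by move=> x _; exact: cvg_cst. Qed.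

Lemma cts_id (S : topologicalType) (A : set S) : cts A id.
Proof. by apply: continuous_cts => x; exact: cvg_id. Qed.

Section RealCts.
Variables (R : realType) (S : topologicalType) (A : set S).
Implicit Types f g : S -> R.

Lemma ctsD f g : cts A f -> cts A g -> cts A (fun x => f x + g x).
Proof. by move=> cf cg x Ax; apply: cvgD; [exact: cf|exact: cg]. Qed.

Lemma ctsN f : cts A f -> cts A (fun x => - f x).
Proof. by move=> cf x Ax; apply: cvgN; exact: cf. Qed.

Lemma ctsB f g : cts A f -> cts A g -> cts A (fun x => f x - g x).
Proof. by move=> cf cg; apply: ctsD => //; exact: ctsN. Qed.

Lemma ctsM f g : cts A f -> cts A g -> cts A (fun x => f x * g x).
Proof. by move=> cf cg x Ax; apply: cvgM; [exact: cf|exact: cg]. Qed.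

Lemma ctsV f : (forall x, A x -> f x != 0) -> cts A f -> cts A (fun x => (f x)^-1).
Proof. by move=> f0 cf x Ax; apply: cvgV; [exact: f0|exact: cf]. Qed.

Lemma cts_div f g : (forall x, A x -> g x != 0) -> cts A f -> cts A g ->
  cts A (fun x => f x / g x).
Proof. by move=> g0 cf cg; apply: ctsM => //; exact: ctsV. Qed.

Lemma cts_min f g : cts A f -> cts A g -> cts A (fun x => Num.min (f x) (g x)).
Proof.
by move=> cf cg; apply: (continuous_comp_cts (g := fun p : R * R => Num.min p.1 p.2)
   (f := fun x => (f x, g x))) (cts_pair cf cg) => x;
  apply: continuous_min; [exact: cvg_fst|exact: cvg_snd].
Qed.

Lemma cts_max f g : cts A f -> cts A g -> cts A (fun x => Num.max (f x) (g x)).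
Proof.
by move=> cf cg; apply: (continuous_comp_cts (g := fun p : R * R => Num.max p.1 p.2)
   (f := fun x => (f x, g x))) (cts_pair cf cg) => x;
  apply: continuous_max; [exact: cvg_fst|exact: cvg_snd].
Qed.

Lemma cts_sum (I : Type) (r : seq I) (P : pred I) (F : I -> S -> R) :
  (forall i, P i -> cts A (F i)) -> cts A (fun x => \sum_(i <- r | P i) F i x).
Proof.
move=> cF; elim: r => [|i r IH].
  by apply: eq_cts (cts_cst (c := 0)) => x _; rewrite big_nil.
case Pi : (P i).
  by apply: eq_cts (ctsD (cF i Pi) IH) => x _; rewrite big_cons Pi.
by apply: eq_cts IH => x _; rewrite big_cons Pi.
Qed.

(** [A] need not be closed: near a point the sign of [f x - a] decides which branch is active, and
    only at zero are both. [attach_cell_retract] applies this on an open set. *)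
Lemma cts_paste f (T : topologicalType) (a : R) (F G : S -> T) :
  cts A f ->
  cts (A `&` [set x | f x <= a]) F -> cts (A `&` [set x | a <= f x]) G ->
  (forall x, A x -> f x = a -> F x = G x) ->
  cts A (fun x => if f x <= a then F x else G x).
Proof.
move=> cf cF cG FG; apply/ctsP => x P Ax.
have hG : a <= f x -> nbhs (G x) P ->
    \forall y \near x, A y -> a <= f y -> P (G y).
  move=> afx GP; have := cts_near cG (conj Ax afx) GP.
  by apply: filterS => y h Ay afy; exact: h.
have hF : f x <= a -> nbhs (F x) P ->
    \forall y \near x, A y -> f y <= a -> P (F y).
  move=> fxa FP; have := cts_near cF (conj Ax fxa) FP.
  by apply: filterS => y h Ay fya; exact: h.
case: (ltgtP (f x) a) => [fxa|afx|fxa].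
- move=> FP; have lt_a : nbhs (f x) [set t | t < a].
    by apply: open_nbhs_nbhs; split=> //; exact: open_lt.
  apply: filterS2 (cts_near cf Ax lt_a) (hF (ltW fxa) FP) => y h1 h2 Ay.
  by have /ltW fya := h1 Ay; rewrite fya; exact: h2.
- move=> GP; have gt_a : nbhs (f x) [set t | a < t].
    by apply: open_nbhs_nbhs; split=> //; exact: open_gt.
  apply: filterS2 (cts_near cf Ax gt_a) (hG (ltW afx) GP) => y h1 h2 Ay.
  by have afy := h1 Ay; rewrite leNgt afy; exact: h2 Ay (ltW afy).
move=> FP; have GP : nbhs (G x) P by rewrite -FG.
apply: filterS2 (hF _ FP) (hG _ GP); rewrite ?fxa// => y h1 h2 Ay.
by case: leP => [|/ltW]; [exact: h1|exact: h2].
Qed.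

Lemma cts_if f (T : topologicalType) (a : R) (F G : S -> T) :
  closed A -> cts A f ->
  cts (A `&` [set x | f x <= a]) F -> cts (A `&` [set x | a <= f x]) G ->
  (forall x, A x -> f x = a -> F x = G x) ->
  cts A (fun x => if f x <= a then F x else G x).
Proof.
move=> cA cf cF cG FG.
have -> : A = (A `&` [set x | f x <= a]) `|` (A `&` [set x | a <= f x]).
  rewrite -setIUr; apply/seteqP; split=> x //=; last by case.
  by move=> Ax; split=> //; have [?|/ltW ?] := leP (f x) a; [left|right].
apply: ctsU.
- exact: closed_preimage_cts cA cf (@closed_le _ a).
- exact: closed_preimage_cts cA cf (@closed_ge _ a).
- by apply: eq_cts cF => x [_ /= ->].
- apply: eq_cts cG => x [Ax /= afx]; case: ifPn => // fxa.
  by apply/esym/FG => //; apply/eqP; rewrite eq_le fxa.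
Qed.

End RealCts.

Section ClosedCover.
Variables (S T : topologicalType).

Lemma closed_bigU_seq (I : eqType) (s : seq I) (C : I -> set S) :
  (forall i, i \in s -> closed (C i)) -> closed (fun x => exists2 i, i \in s & C i x).
Proof.
elim: s => [|i s IH] cC.
  by rewrite (_ : (fun _ => _) = set0); [exact: closed0|apply/seteqP; split=> x // [? ]].
rewrite (_ : (fun _ => _) = C i `|` (fun x => exists2 i, i \in s & C i x)).
  apply: closedU; first exact: cC (mem_head _ _).
  by apply: IH => j js; apply: cC; rewrite inE js orbT.
apply/seteqP; split=> x.
  move=> [j]; rewrite inE => /orP[/eqP ->|js] Cx; [by left|by right; exists j].
by move=> [Cx|[j js Cx]]; [exists i => //; exact: mem_head|exists j => //; rewrite inE js orbT].
Qed.

Lemma cts_bigU_seq (I : eqType) (s : seq I) (C : I -> set S) (f : S -> T) :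
  (forall i, i \in s -> closed (C i)) -> (forall i, i \in s -> cts (C i) f) ->
  cts (fun x => exists2 i, i \in s & C i x) f.
Proof.
elim: s => [|i s IH] cC cf; first by move=> x [].
have sub j : j \in s -> j \in i :: s by rewrite inE => ->; rewrite orbT.
have h : cts (C i `|` (fun x => exists2 i, i \in s & C i x)) f.
  apply: ctsU => //.
  - exact: cC (mem_head _ _).
  - by apply: closed_bigU_seq => j /sub; exact: cC.
  - exact: cf (mem_head _ _).
  - by apply: IH => j /sub; [exact: cC|exact: cf].
apply: sub_cts h => x [j]; rewrite inE => /orP[/eqP ->|js] Cx; [by left|by right; exists j].
Qed.

End ClosedCover.

(** * Distance to the complement of a set *)

Section Radius.
Variables (R : realType) (X : metricType R).
Implicit Types (U : set X) (x y : X).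
Local Notation d := (@mdist R X).

Definition lip1 (f : X -> R) := forall x y, f x <= f y + d x y.

Lemma lip1_continuous f : lip1 f -> continuous f.
Proof.
move=> lf x; apply/cvgrPdist_lt => e e0.
have : nbhs x (ball x e) by exact: nbhsx_ballx.
apply: filterS => y; rewrite ballEmdist /= => xy.
have := lf x y; have := lf y x; rewrite (metric_sym y) => h1 h2.
by rewrite ltr_norml; apply/andP; split; lra.
Qed.

Let radset U x : set R := [set r | 0 <= r <= 1 /\ forall y, d x y < r -> U y].

(* the distance from x to the complement of U, truncated at 1 *)
Definition codist U x : R := sup (radset U x).

Let radset0 U x : radset U x 0.
Proof. by split=> [|y]; rewrite ?lexx ?ler01// ltNge mdist_ge0. Qed.

Let has_sup_codist U x : has_sup (radset U x).
Proof. by split; [exists 0|exists 1 => r [/andP[]]]. Qed.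

Lemma codist_ge U x r : 0 <= r <= 1 -> (forall y, d x y < r -> U y) -> r <= codist U x.
Proof. by move=> r01 h; apply: ub_le_sup => //; case: (has_sup_codist U x). Qed.

Lemma codist_ge0 U x : 0 <= codist U x.
Proof. by apply: ub_le_sup => //; case: (has_sup_codist U x). Qed.

Lemma codist_le1 U x : codist U x <= 1.
Proof. by apply: ge_sup; [exists 0|move=> r [/andP[]]]. Qed.

Lemma codist_sub U x y : d x y < codist U x -> U y.
Proof.
move=> /(sup_gt (has_sup_codist U x).1) [r [_ h] dr]; exact: h.
Qed.

Lemma codist_lip U : lip1 (codist U).
Proof.
move=> x y; apply: ge_sup; first by exists 0.
move=> r [/andP[r0 r1] h].
have [|dr] := ltP (d x y) r; last by rewrite (le_trans dr)// lerDr codist_ge0.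
move=> dr; rewrite -lerBlDr; apply: codist_ge.
  by have := mdist_ge0 x y; lra.
move=> z yz; apply: h; apply: le_lt_trans (metric_triangle x y z) _; lra.
Qed.

Lemma continuous_codist U : continuous (codist U).
Proof. exact/lip1_continuous/codist_lip. Qed.

Lemma codist_gt0 U x : 0 < codist U x -> U x.
Proof. by move=> h; apply: (@codist_sub U x); rewrite mdistxx. Qed.

Lemma codist_open_gt0 U x : open U -> U x -> 0 < codist U x.
Proof.
move=> oU Ux; have : nbhs x U by apply: open_nbhs_nbhs.
rewrite -nbhs_ballE => -[e /= e0 eU].
have : Num.min e 1 <= codist U x.
  apply: codist_ge; first by rewrite ge_min lexx orbT andbT le_min ler01 ltW.
  by move=> y; rewrite lt_min => /andP[xy _]; apply: eU; rewrite ballEmdist.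
by apply: lt_le_trans; rewrite lt_min e0 ltr01.
Qed.

Lemma codist_eq0 U x : ~ U x -> codist U x = 0.
Proof.
move=> nU; apply/eqP; rewrite eq_le codist_ge0 andbT leNgt.
by apply/negP => /codist_gt0.
Qed.

(** Truncation forces the bound [e <= 1]: if [U] is the whole space, [codist] is 1 and there is no
    outer point. *)
Lemma codist_out U x e : codist U x < e <= 1 -> exists2 y, ~ U y & d x y < e.
Proof.
move=> /andP[re e1]; apply: contrapT => h.
have : e <= codist U x.
  apply: codist_ge; first by rewrite e1 andbT (le_trans (codist_ge0 U x))// ltW.
  by move=> y xy; apply: contrapT => nU; apply: h; exists y.
by rewrite leNgt re.
Qed.

(** Zero is adjoined so that an empty index set gives 0; the members being nonnegative, it changes
    nothing otherwise. *)
Lemma sup_lip1 (I : Type) (P : set I) (f : I -> X -> R) :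
  (forall i x, 0 <= f i x <= 1) -> (forall i, lip1 (f i)) ->
  lip1 (fun x => sup ([set 0] `|` [set f i x | i in P])).
Proof.
move=> f01 lf x y; apply: ge_sup; first by exists 0; left.
have hb : has_ubound ([set 0] `|` [set f i y | i in P]).
  exists 1 => r [->|[i _ <-]]; first exact: ler01.
  by case/andP: (f01 i y).
have s0 : 0 <= sup ([set 0] `|` [set f i y | i in P]).
  by apply: ub_le_sup => //; left.
move=> r [->|[i Pi <-]]; first by rewrite addr_ge0// mdist_ge0.
apply: le_trans (lf i x y) _; rewrite lerD2r; apply: ub_le_sup => //.
by right; exists i.
Qed.

End Radius.

Definition itv01 {R : realType} : set R := [set t | 0 <= t <= 1].

Section VectorCts.
Variables (R : realType) (V : normedModType R) (S : topologicalType) (A : set S).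
Implicit Types (f g : S -> V) (a : S -> R).

Lemma ctsDv f g : cts A f -> cts A g -> cts A (fun x => f x + g x).
Proof. by move=> cf cg x Ax; apply: cvgD; [exact: cf|exact: cg]. Qed.

Lemma ctsBv f g : cts A f -> cts A g -> cts A (fun x => f x - g x).
Proof. by move=> cf cg x Ax; apply: cvgB; [exact: cf|exact: cg]. Qed.

Lemma ctsZ a f : cts A a -> cts A f -> cts A (fun x => a x *: f x).
Proof. by move=> ca cf x Ax; apply: cvgZ; [exact: ca|exact: cf]. Qed.

Lemma cts_normv f : cts A f -> cts A (fun x => `|f x|).
Proof. by move=> cf x Ax; apply: cvg_norm; exact: cf. Qed.

Lemma cts_distP (f : S -> V) : cts A f <->
  forall x e, A x -> 0 < e -> \forall y \near x, A y -> `|f x - f y| < e.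
Proof.
split=> [cf x e Ax e0|h].
  have o : nbhs (f x) (ball (f x) e) by exact: nbhsx_ballx.
  by apply: filterS (cts_near cf Ax o) => y h Ay; have := h Ay; rewrite -ball_normE.
apply/ctsP => x P Ax /nbhs_ballP[e /= e0 eP].
by apply: filterS (h x e Ax e0) => y h1 Ay; apply: eP; rewrite -ball_normE; exact: h1.
Qed.

End VectorCts.

(** * Systems of coordinates *)

(** The strict part of a well-ordering. Minimal elements serve Stone's theorem; elsewhere only the
    trichotomy is used, to pick one orientation of each unordered pair and so make choices
    antisymmetric. *)
Lemma well_founded_total (J : eqType) : exists lt : rel J,
  (forall i j, i != j -> lt i j = ~~ lt j i) /\
  forall P : set J, P !=set0 -> exists2 j, P j & forall i, lt i j -> ~ P i.
Proof.
have [le wo] := well_ordering_principle J.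
have ler i : le i i.
  have [k [[/eqP ki lbk] _]] := wo (pred1 i) (ex_intro _ i (eqxx i)).
  by subst k; apply: lbk; rewrite inE.
exists (fun i j => ~~ le j i); split=> [i j ij|P [i Pi]]; last first.
  have [|j [[/asboolP Pj lbj] _]] := wo (fun j => `[< P j >]).
    by exists i; apply/asboolP.
  by exists j => // k /negP jk Pk; apply: jk; apply: lbj; apply/asboolP.
have [|k [[k2 lbk] unk]] := wo (pred2 i j); first by exists i; rewrite inE eqxx.
have [ki kj] : le k i /\ le k j by split; apply: lbk; rewrite inE eqxx ?orbT.
have ijF : ~ (le i j /\ le j i).
  move=> [leij leji]; move/eqP: ij; apply.
  have -> : i = k.
    by apply/esym/unk; split=> [|z /pred2P[]->//]; rewrite inE eqxx.
  by apply: unk; split=> [|z /pred2P[]->//]; rewrite inE eqxx orbT.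
have {k2} : le i j || le j i by case/pred2P: k2 ki kj => -> h1 h2; rewrite ?h1 ?h2 ?orbT.
by move: ijF; case: (le i j); case: (le j i) => // h; case: h.
Qed.

Section Refinement.
Variables (R : realType) (X : metricType R) (J : choiceType) (U : J -> set X).
Hypothesis openU : forall j, open (U j).
Local Notation d := (@mdist R X).

(* Stone's theorem with functions instead of sets: the n-th layer of the
   functions g n j is uniformly discrete, and subtracting multiples of the
   lower layers makes the whole family locally finite. *)
Lemma locally_finite_refinement :
  exists q : nat * J -> X -> R, [/\
    forall a, continuous (q a), forall a x, 0 <= q a x,
    forall a x, 0 < q a x -> U a.2 x,
    forall j x, U j x -> exists a, 0 < q a x &
    forall j x, U j x -> exists s : seq (nat * J),
      \forall y \near x, forall a, 0 < q a y -> a \in s].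
Proof.
have [lt [lt_total wo]] := well_founded_total J.
pose e n : R := n.+1%:R^-1.
have e_gt0 n : 0 < e n by rewrite invr_gt0 ltr0n.
have e_le1 n : e n <= 1 by rewrite invf_le1 ?ltr0n// ler1n.
have e_le m n : (m <= n)%N -> e n <= e m.
  by move=> mn; rewrite lef_pV2 ?posrE ?ltr0n// ler_nat.
pose f j := codist (U j).
have f01 j x : 0 <= f j x <= 1 by rewrite codist_ge0 codist_le1.
pose m j x := sup ([set 0] `|` [set f i x | i in fun i => lt i j]).
have m_lip j : lip1 (m j) by apply: sup_lip1 => // i; exact: codist_lip.
have f_le_m i j x : lt i j -> f i x <= m j x.
  move=> ij; apply: ub_le_sup; last by right; exists i.
  by exists 1 => r [->|[k _ <-]]; [exact: ler01|case/andP: (f01 k x)].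
(* Positive exactly at points more than [2 * e n] deep in [U j] where the earlier depths have
   supremum below [e n]. For [i] before [j], the depth in [U i] drops by more than [e n] from the
   support of [g n i] to that of [g n j]; this gives [g_disc]. *)
pose g n j x := Num.max 0 (Num.min (f j x - 2 * e n) (e n - m j x)).
have g_gt0 n j x : (0 < g n j x) = (2 * e n < f j x) && (m j x < e n).
  by rewrite lt_max ltxx lt_min !subr_gt0.
have g_lip n j : lip1 (g n j).
  move=> x y; rewrite /g; have := mdist_ge0 x y.
  have := codist_lip (U j) x y; rewrite -/(f j) => h1.
  have := m_lip j y x; rewrite (metric_sym y) => h2.
  by rewrite !maxEle !minEle; do ! case: ifPn; rewrite -?ltNge; lra.
have m_ge0 j x : 0 <= m j x.
  apply: ub_le_sup; last by left.
  by exists 1 => r [->|[k _ <-]]; [exact: ler01|case/andP: (f01 k x)].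
have g01 n j x : 0 <= g n j x <= 1.
  rewrite /g; have /andP[? ?] := f01 j x; have := m_ge0 j x.
  have := e_gt0 n; have := e_le1 n.
  by rewrite !maxEle !minEle; do ! case: ifPn; rewrite -?ltNge; lra.
have g_disc n i j x y : i != j -> 0 < g n i x -> 0 < g n j y -> e n <= d x y.
  move=> ij; wlog ltij : i j x y ij / lt i j.
    move=> H gx gy; case: (boolP (lt i j)) => h; first exact: (H i j).
    rewrite metric_sym; apply: (H j i) => //; first by rewrite eq_sym.
    by rewrite lt_total// eq_sym.
  rewrite !g_gt0 => /andP[h1 _] /andP[_ h2].
  have := f_le_m _ _ y ltij; have := codist_lip (U i) x y; rewrite -/(f i).
  by move: (f i x) (f i y) (m j y) h1 h2 => fx fy my *; lra.
pose G n x := sup ([set 0] `|` [set g n j x | j in setT]).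
have G_lip n : lip1 (G n) by apply: sup_lip1.
have g_le_G n j x : g n j x <= G n x.
  apply: ub_le_sup; last by right; exists j.
  by exists 1 => r [->|[k _ <-]]; [exact: ler01|case/andP: (g01 n k x)].
have G_ge0 n x : 0 <= G n x.
  apply: ub_le_sup; last by left.
  by exists 1 => r [->|[k _ <-]]; [exact: ler01|case/andP: (g01 n k x)].
pose S n x := \sum_(i < n) G i x.
have cS n : continuous (S n).
  apply: cts_continuous; apply: cts_sum => i _.
  exact/continuous_cts/lip1_continuous/G_lip.
(* Where a lower layer is at least c > 0, layer n is killed as soon as n c >= 1, because [g <= 1].
   This bounds the layers that occur near a point. *)
pose q (a : nat * J) x := Num.max 0 (g a.1 a.2 x - a.1%:R * S a.1 x).
have q_le_g a x : q a x <= g a.1 a.2 x.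
  rewrite /q ge_max; have /andP[-> _] := g01 a.1 a.2 x.
  by rewrite gerBl mulr_ge0// sumr_ge0.
have g_pos j x : U j x -> exists n i, 0 < g n i x.
  move=> Ujx; have [|i Ui ltU] := wo (fun i => U i x); first by exists j.
  have fi : 0 < f i x by apply: codist_open_gt0.
  have mi : m i x = 0.
    apply/eqP; rewrite eq_le m_ge0 andbT; apply: ge_sup; first by exists 0; left.
    by move=> r [->//|[k /ltU Uk <-]]; rewrite /f codist_eq0.
  have [n] : exists n, e n < f i x / 2.
    have [n _ /(_ n (leqnn n))] := near_infty_natSinv_lt (PosNum (divr_gt0 fi (ltr0Sn R 1))).
    by exists n.
  by move=> en; exists n, i; rewrite g_gt0 mi e_gt0 andbT; lra.
exists q; split.
- move=> a; apply: cts_continuous; apply: cts_max; first exact: cts_cst.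
  apply: ctsB; first exact/continuous_cts/lip1_continuous/g_lip.
  by apply: ctsM; [exact: cts_cst|exact: continuous_cts].
- by move=> a x; rewrite le_max lexx.
- move=> [n j] x /lt_le_trans/(_ (q_le_g _ _)) /=; rewrite g_gt0 => /andP[h _].
  by apply: codist_gt0; apply: lt_trans h; have := e_gt0 n; lra.
(* At the first layer that is positive at [x], nothing is subtracted. *)
- move=> j x /g_pos gx; pose P n := `[< exists i, 0 < g n i x >].
  have exP : exists n, P n by have [n [i gi]] := gx; exists n; apply/asboolP; exists i.
  case: (ex_minnP exP) => n /asboolP[i gi] minn; exists (n, i).
  suff S0 : S n x = 0 by rewrite /q /= S0 mulr0 subr0 lt_max gi orbT.
  rewrite /S big1// => k _; apply/eqP; rewrite eq_le G_ge0 andbT.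
  apply: ge_sup; first by exists 0; left.
  move=> r [->//|[l _ <-]]; rewrite leNgt; apply/negP => gl.
  have : P k by apply/asboolP; exists l.
  by move=> /minn; rewrite leqNgt ltn_ord.
move=> j x /g_pos [n0 [i0 gi0]].
have G0 : 0 < G n0 x by apply: lt_le_trans gi0 _.
pose c := G n0 x / 2; have c0 : 0 < c by rewrite divr_gt0.
have [N n0N Nc] : exists2 N, (n0 < N)%N & 1 <= N%:R * c.
  have [n _ h] := near_infty_natSinv_lt (PosNum c0).
  exists (maxn n.+1 n0.+1); first by rewrite leq_max ltnSn orbT.
  have hn : n.+1%:R^-1 < c by exact: (h n (leqnn n)).
  have : n.+1%:R * c <= (maxn n.+1 n0.+1)%:R * c.
    by apply: ler_wpM2r; rewrite ?ler_nat ?leq_maxl ?ltW.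
  apply: le_trans; rewrite -ler_pdivrMl ?ltr0n// mulr1; exact: ltW.
(* In a layer [n < N], the supports of two indices are at least [e n >= e N] apart, so a ball of
   radius [e N / 2] meets at most one of them. *)
pose Q n i := exists2 z, d x z < e N / 2 & 0 < g n i z.
have [jn jnP] : exists jn : nat -> option J,
    forall n, (n < N)%N -> forall i, Q n i -> jn n = Some i.
  have /choice : forall n, exists o : option J,
      (n < N)%N -> forall i, Q n i -> o = Some i.
    move=> n; have [[i Qi]|nQ] := pselect (exists i, Q n i); last first.
      by exists None => _ i Qi; case: nQ; exists i.
    exists (Some i) => nN k [z xz gz]; congr Some; apply/eqP.
    apply: contraT => ik; case: Qi => y xy gy.
    have := g_disc n _ _ _ _ ik gy gz.
    have := metric_triangle y x z; rewrite (metric_sym y x).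
    by have := e_le _ _ (ltnW nN); lra.
  by move=> [jn jnP]; exists jn.
exists (pmap (fun n => omap (pair n) (jn n)) (iota 0 N)).
have near1 : \forall y \near x, d x y < e N / 2.
  have : nbhs x (ball x (e N / 2)) by apply: nbhsx_ballx; rewrite divr_gt0.
  by apply: filterS => y; rewrite ballEmdist.
have near2 : \forall y \near x, c < G n0 y.
  have /cvgrPdist_lt/(_ _ c0) := lip1_continuous (G_lip n0) (x := x).
  apply: filterS => y; rewrite ltr_norml => /andP[_ h].
  by move: h; rewrite /c; lra.
apply: filterS2 near1 near2 => y xy cy [n i] qy.
have gy : 0 < g n i y := lt_le_trans qy (q_le_g _ _).
have nN : (n < N)%N.
  rewrite ltnNge; apply/negP => Nn; move: qy; rewrite ltNge => /negP; apply.
  rewrite /q /= ge_max lexx subr_le0.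
  have /andP[_ g1] := g01 n i y; apply: le_trans g1 _.
  apply: le_trans Nc _; apply: ler_pM; [exact: ler0n|exact: ltW|by rewrite ler_nat|rewrite /=].
  apply: le_trans (ltW cy) _; rewrite /S (bigD1 (Ordinal (leq_trans n0N Nn)))//=.
  by rewrite lerDl sumr_ge0.
rewrite mem_pmap; apply/mapP; exists n; first by rewrite mem_iota.
by rewrite (jnP n nN i) //; exists y.
Qed.

End Refinement.

Section MinSeq.
Variables (R : realType) (I : eqType).

(** The cap 1 gives a value to the empty list; it does not affect coordinates, which are at most
    1. *)
Definition minseq (T : seq I) (f : I -> R) : R := \big[Num.min/1]_(t <- T) f t.

Lemma minseq_le T f t : t \in T -> minseq T f <= f t.
Proof.
rewrite /minseq; elim: T => // a T IH; rewrite inE big_cons ge_min.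
by move=> /predU1P[->|/IH ->]; rewrite ?lexx ?orbT.
Qed.

Lemma minseq_attained T f : T != [::] -> (forall t, t \in T -> f t <= 1) ->
  exists2 t, t \in T & minseq T f = f t.
Proof.
rewrite /minseq; elim: T => // a [|b T] IH _ f1.
  exists a; first exact: mem_head.
  by rewrite big_cons big_nil; apply/min_idPl/f1/mem_head.
have [//||t tT tE] := IH; first by move=> t tT; apply: f1; rewrite inE tT orbT.
rewrite big_cons tE minEle; case: ifP => _; [exists a|exists t] => //.
  exact: mem_head.
by rewrite inE tT orbT.
Qed.

Lemma cts_minseq (S : topologicalType) (A : set S) T (f : I -> S -> R) :
  (forall t, t \in T -> cts A (f t)) -> cts A (fun x => minseq T (f ^~ x)).
Proof.
rewrite /minseq; elim: T => [|a T IH] cf.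
  by apply: eq_cts (cts_cst (c := 1 : R)) => x _; rewrite big_nil.
have h : cts A (fun x => \big[Num.min/1]_(t <- T) f t x).
  by apply: IH => t tT; apply: cf; rewrite inE tT orbT.
apply: eq_cts (cts_min (cf a (mem_head _ _)) h) => x _.
by rewrite big_cons.
Qed.

End MinSeq.

(** * Lowering the order of a system on a space of dimension at most 2 *)

Section OrderReduction.
Variables (R : realType) (X : metricType R) (I : choiceType).
Hypothesis dimX : covering_dim_le X 2.
Implicit Types (C : set X) (T : seq I) (q : I -> X -> R).

(* barycentric-like coordinates: a map from C to the cone over the simplex on T *)
Definition coords C T q := [/\ forall i, i \in T -> cts C (q i),
  forall i x, i \in T -> C x -> 0 <= q i x <= 1 &
  forall x, C x -> exists2 i, i \in T & 0 < q i x].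

(** With four or more vertices the simplex has dimension at least 3, and a map into it from a space
    of dimension 2 can be pushed off the interior, fixing what is on the boundary. A cover of order
    2 indexed by the vertices yields functions [v], at each point one of them positive and one of
    them zero. Deep inside the simplex [q] is replaced by [v], in between they are blended, and
    subtracting the minimum makes one coordinate vanish. The blended coordinates are never all
    equal, so another one stays positive. *)
Lemma push_to_boundary C T q : closed C -> uniq T -> (3 < size T)%N ->
  coords C T q -> exists r, [/\ coords C T r,
    forall x, C x -> exists2 i, i \in T & r i x = 0 &
    forall x, C x -> (exists2 i, i \in T & q i x = 0) ->
      forall i, i \in T -> r i x = q i x].
Proof.
move=> clC uT sT [cq q01 q_pos].
(* [th] is below 1/N, so at each point some coordinate exceeds [th * S]. *)
pose N : R := (size T)%:R; pose th : R := (N + 1)^-1.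
have N0 : 0 < N by rewrite ltr0n; apply: leq_trans sT.
have th0 : 0 < th by rewrite invr_gt0 ltr_wpDl// ltW.
pose S x := \sum_(t <- T) q t x.
have T0 : T != [::] by case: (T) sT.
have q0 i x : i \in T -> C x -> 0 <= q i x by move=> iT Cx; case/andP: (q01 i x iT Cx).
have q_le_S i x : i \in T -> C x -> q i x <= S x.
  move=> iT Cx; rewrite /S (big_rem i iT) /= lerDl big_seq_cond.
  by apply: sumr_ge0 => j /andP[/mem_rem jT _]; exact: q0.
have S0 x : C x -> 0 < S x.
  by move=> Cx; have [i iT qi] := q_pos x Cx; apply: lt_le_trans qi (q_le_S _ _ iT Cx).
have big_q x : C x -> exists2 i, i \in T & th * S x < q i x.
  move=> Cx; apply: contrapT => h.
  have : S x <= \sum_(t <- T) th * S x.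
    rewrite {1}/S; move: (th * S x) h => c h.
    rewrite big_seq_cond [leRHS]big_seq_cond; apply: ler_sum => i /andP[iT _].
    by rewrite leNgt; apply/negP => qi; apply: h; exists i.
  rewrite big_const_seq count_predT iter_addr addr0 -mulr_natl -/N mulrA.
  rewrite leNgt => /negP; apply; rewrite gtr_pMl ?S0// ltr_pdivrMr ?mul1r ?ltrDl//.
  by rewrite addr_gt0.
have cS : cts C S.
  rewrite /S; have : forall s, {subset s <= T} -> cts C (fun x => \sum_(t <- s) q t x).
    elim=> [|a s IH] sub.
      by apply: eq_cts (cts_cst (c := 0 : R)) => x _; rewrite big_nil.
    have h : cts C (fun x => \sum_(t <- s) q t x).
      by apply: IH => t ts; apply: sub; rewrite inE ts orbT.
    apply: eq_cts (ctsD (cq a (sub _ (mem_head _ _))) h) => x _.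
    by rewrite big_cons.
  exact.
(* The implication puts every point off [C] into every [U t], so that these sets are open in [X] and
   cover it. *)
pose U t := [set x | C x -> th * S x < q t x].
have oU t : t \in T -> open (U t).
  move=> tT; rewrite -closedC.
  have -> : ~` U t = C `&` (fun x => q t x - th * S x) @^-1` [set y | y <= 0].
    apply/seteqP; split=> x /=; rewrite subr_le0.
      by move=> /not_implyP[Cx /negP]; rewrite -leNgt.
    by move=> [Cx h] /(_ Cx); rewrite ltNge h.
  apply: (closed_preimage_cts clC _ (@closed_le _ 0)).
  by apply: ctsB; [exact: cq|apply: ctsM => //; exact: cts_cst].
have [W [finW [oW covW] refW ordW]] : exists V, [/\ finite_set V, open_cover V,
    refines V [set U t | t in [set` T]] & order_le V 2].
  apply: dimX; first by apply: finite_image; exact: finite_seq.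
  split; first by move=> _ [t tT <-]; exact: oU.
  apply/seteqP; split=> // x _.
  have [Cx|nCx] := pselect (C x).
    by have [i iT qi] := big_q x Cx; exists (U i); [exists i|].
  by case: (T) T0 => // a s _; exists (U a); [exists a => //=; exact: mem_head|].
have /choice[tt ttP] : forall V : set X, exists t, W V -> t \in T /\ V `<=` U t.
  move=> V; have [WV|nW] := pselect (W V); last by case: (T) T0 => // a s _; exists a.
  by have [_ [t tT <-] VU] := refW V WV; exists t.
pose V t := \bigcup_(B in [set B | W B /\ tt B = t]) B.
have oV t : open (V t) by apply: bigcup_open => B [WB _]; exact: oW.
have VU t : V t `<=` U t by move=> x [B [/ttP[_ BU] <-]]; exact: BU.
have V_cov x : exists2 t, t \in T & V t x.
  have : (\bigcup_(A in W) A) x by rewrite covW.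
  by move=> [B WB Bx]; exists (tt B); [case: (ttP B WB)|exists B].
have V_ex x : exists2 t, t \in T & ~ V t x.
  apply: contrapT => h.
  (* A point in all [V t] would lie in four members of [W] assigned to four different vertices. They
     are distinct, against order 2. *)
  have h4 (i : 'I_4) : exists B, [/\ W B, tt B = nth (tt set0) T i & B x].
    have iT : nth (tt set0) T i \in T by apply: mem_nth; apply: leq_trans (ltn_ord i) sT.
    apply: contrapT => hB; apply: h; exists (nth (tt set0) T i) => //.
    by move=> [B [WB tB] Bx]; apply: hB; exists B.
  have /choice[B BP] := h4.
  have : (\bigcap_i B i) x by move=> i _; case: (BP i).
  rewrite ordW //; last by move=> i; case: (BP i).
  move=> i j /(congr1 tt); case: (BP i) => _ -> _; case: (BP j) => _ -> _ /eqP.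
  by rewrite nth_uniq ?(leq_trans (ltn_ord _) sT)// => /eqP/val_inj.
pose v t := codist (V t).
pose mu x := minseq T (q ^~ x).
(* [la] is 0 on the boundary and 1 once every coordinate is at least [th * S]. Where [la < 1], the
   vertex with the least coordinate is outside its [U t], hence has [v] equal to 0, while some other
   coordinate exceeds [th * S]. *)
pose la x := Num.min 1 (mu x / (th * S x)).
pose w t x := (1 - la x) * q t x + la x * v t x.
pose mw x := minseq T (w ^~ x).
have thS x : C x -> 0 < th * S x by move=> Cx; rewrite mulr_gt0// S0.
have mu0 x : C x -> 0 <= mu x <= 1.
  move=> Cx; have [|t tT tE] := @minseq_attained R I T (q ^~ x) T0.
    by move=> t tT; case/andP: (q01 t x tT Cx).
  by rewrite /mu tE; exact: q01.
have la01 x : C x -> 0 <= la x <= 1.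
  move=> Cx; rewrite /la ge_min lexx andbT le_min ler01 /=.
  by rewrite divr_ge0 ?(ltW (thS x Cx))//; case/andP: (mu0 x Cx).
have w01 t x : t \in T -> C x -> 0 <= w t x <= 1.
  move=> tT Cx; rewrite /w; have := la01 x Cx; have := q01 t x tT Cx.
  have := codist_ge0 (V t) x; have := codist_le1 (V t) x; rewrite -/(v t x).
  move: (la x) (q t x) (v t x) => l a b b1 b0 /andP[? ?] /andP[? ?].
  by apply/andP; split; nra.
have mw_att x : C x -> exists2 t, t \in T & mw x = w t x.
  by move=> Cx; apply: minseq_attained => // t tT; case/andP: (w01 t x tT Cx).
have cla : cts C la.
  apply: cts_min; first exact: cts_cst.
  apply: cts_div => [x Cx||]; first by rewrite gt_eqF// thS.
    exact: cts_minseq.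
  by apply: ctsM => //; exact: cts_cst.
have cw t : t \in T -> cts C (w t).
  move=> tT; apply: ctsD; apply: ctsM => //.
  - by apply: ctsB => //; exact: cts_cst.
  - exact: cq.
  - exact/continuous_cts/continuous_codist.
exists (fun t x => w t x - mw x); split; first split.
- by move=> t tT; apply: ctsB; [exact: cw|exact: cts_minseq].
- move=> t x tT Cx; have [s s1T s1E] := mw_att x Cx.
  have := @minseq_le R I T (w ^~ x) t tT; rewrite -/(mw x).
  have := w01 t x tT Cx; have := w01 s x s1T Cx; rewrite -s1E => /andP[? ?] /andP[? ?] ?.
  by apply/andP; split; lra.
- move=> x Cx; apply: contrapT => h.
  have wE t : t \in T -> w t x = mw x.
    move=> tT; apply/eqP; rewrite eq_le (@minseq_le R I T (w ^~ x) t tT) andbT.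
    by rewrite leNgt; apply/negP => wt; apply: h; exists t => //; rewrite subr_gt0.
  have [muS|Smu] := ltP (mu x) (th * S x).
    have la1 : la x < 1 by rewrite /la gt_min ltxx /= ltr_pdivrMr ?mul1r// thS.
    have [|t0 t0T t0E] := @minseq_attained R I T (q ^~ x) T0.
      by move=> t tT; case/andP: (q01 t x tT Cx).
    have v0 : v t0 x = 0.
      rewrite /v codist_eq0// => /VU /(_ Cx); rewrite ltNge => /negP; apply.
      by rewrite -t0E ltW.
    have [t1 t1T t1q] := big_q x Cx.
    have := wE t1 t1T; rewrite -(wE t0 t0T) /w v0 -t0E -/(mu x).
    have := codist_ge0 (V t1) x; rewrite -/(v t1 x).
    have /andP[] := la01 x Cx.
    move: (la x) (mu x) (q t1 x) (v t1 x) la1 muS t1q => l m a b; nra.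
  have la1 : la x = 1.
    by rewrite /la; apply/min_idPl; rewrite ler_pdivlMr ?mul1r// thS.
  have [t1 t1T Vt1] := V_cov x; have [t0 t0T nVt0] := V_ex x.
  have := wE t1 t1T; rewrite -(wE t0 t0T) /w la1 subrr !mul0r !add0r !mul1r.
  by rewrite /v (codist_eq0 nVt0) => /eqP; rewrite gt_eqF// codist_open_gt0.
- by move=> x Cx; have [s s1T ->] := mw_att x Cx; exists s; rewrite ?subrr.
move=> x Cx [i iT qi0] t tT.
have mux : mu x = 0.
  apply/eqP; rewrite eq_le; case/andP: (mu0 x Cx) => -> _; rewrite andbT -qi0.
  exact: minseq_le.
have lax : la x = 0 by rewrite /la mux mul0r; apply/min_idPr.
have wq s : w s x = q s x by rewrite /w lax subr0 mul1r mul0r addr0.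
suff -> : mw x = 0 by rewrite subr0.
by rewrite -mux /mw /mu; congr minseq; apply/funext => s; exact: wq.
Qed.

Definition supp_seq T q x := [seq i <- T | 0 < q i x].

(** Subsequences rather than subsets: keeping the order of [T] gives each face a unique name. *)
Definition sublists T := [seq mask (val m) T | m <- enum {: (size T).-tuple bool}].

Lemma mem_sublists (P : pred I) T : [seq i <- T | P i] \in sublists T.
Proof.
rewrite filter_mask; apply/mapP; exists [tuple of map P (in_tuple T)] => //.
by rewrite mem_enum.
Qed.

Lemma sublistsP T T' : T' \in sublists T -> exists m, T' = mask m T.
Proof. by move=> /mapP[m _ ->]; exists m. Qed.

Lemma sublists_subset T T' : T' \in sublists T -> {subset T' <= T}.
Proof. by move=> /sublistsP[m ->] i; exact: mem_mask. Qed.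

Lemma sublists_uniq T T' : uniq T -> T' \in sublists T -> uniq T'.
Proof. by move=> uT /sublistsP[m ->]; exact: mask_uniq. Qed.

Definition reduces C T q q' := [/\ coords C T q',
  forall x i, C x -> i \in T -> q i x = 0 -> q' i x = 0 &
  forall x, C x -> (size (supp_seq T q x) <= 3)%N ->
      forall i, i \in T -> q' i x = q i x].

(** The push is made separately on each face with [n.+1] vertices. Two such faces meet only where
    some coordinate of each vanishes; there the push is the identity, so the pieces agree. *)
Lemma reduce_step C T q n : closed C -> uniq T -> coords C T q -> (3 <= n)%N ->
  (forall x, C x -> (size (supp_seq T q x) <= n.+1)%N) ->
  exists2 q', reduces C T q q' &
    forall x, C x -> (size (supp_seq T q' x) <= n)%N.
Proof.
move=> clC uT [cq q01 q_pos] n3 ordq.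
have q0 i x : i \in T -> C x -> 0 <= q i x by move=> iT Cx; case/andP: (q01 i x iT Cx).
have qE i x : i \in T -> C x -> ~~ (0 < q i x) -> q i x = 0.
  by move=> iT Cx; rewrite lt_neqAle q0// andbT negbK => /eqP.
pose F T' := C `&` [set x | forall i, i \in T -> i \notin T' -> q i x = 0].
have clF T' : closed (F T').
  have -> : F T' = C `&` \bigcap_(i in [set i | i \in T /\ i \notin T'])
      (C `&` q i @^-1` [set 0]).
    apply/seteqP; split=> x [Cx h]; split=> //.
      by move=> i [iT iT']; split=> //; exact: h.
    by move=> i iT iT'; have [] := h i (conj iT iT').
  apply: closedI => //; apply: closed_bigI => i [iT _].
  by apply: (closed_preimage_cts clC (cq i iT)); exact: closed_eq.
have FT x : C x -> F (supp_seq T q x) x.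
  move=> Cx; split=> // i iT; rewrite mem_filter iT andbT => h; exact: qE.
have cF T' : T' \in sublists T -> coords (F T') T' q.
  move=> T'T; have sub := sublists_subset T'T; split.
  - by move=> i /sub iT; apply: sub_cts (cq i iT) => x [].
  - by move=> i x /sub iT [Cx _]; exact: q01.
  - move=> x [Cx h]; have [i iT qi] := q_pos x Cx; exists i => //.
    by apply: contraT => /(h i iT) qi0; rewrite qi0 ltxx in qi.
have /choice[r rP] : forall T', exists r, T' \in sublists T -> (3 < size T')%N ->
    [/\ coords (F T') T' r, forall x, F T' x -> exists2 i, i \in T' & r i x = 0 &
    forall x, F T' x -> (exists2 i, i \in T' & q i x = 0) ->
      forall i, i \in T' -> r i x = q i x].
  move=> T'; have [T'T|] := pselect (T' \in sublists T); last by exists q.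
  have [s3|] := pselect (3 < size T')%N; last by exists q.
  have [|r rP] := push_to_boundary (clF T') _ s3 (cF T' T'T); last by exists r.
  exact: sublists_uniq T'T.
have n4 (T' : seq I) : size T' = n.+1 -> (3 < size T')%N by move=> ->.
pose q' i x := let T' := supp_seq T q x in
  if (size T' == n.+1) && (i \in T') then r T' i x else q i x.
have q'E T' x : T' \in sublists T -> size T' = n.+1 -> F T' x ->
    forall i, i \in T' -> q' i x = r T' i x.
  move=> T'T sT' Fx i iT'; have [_ _ rq] := rP T' T'T (n4 _ sT').
  have Cx := Fx.1; have subT' : {subset supp_seq T q x <= T'}.
    move=> j; rewrite mem_filter => /andP[qj jT]; apply: contraT => /(proj2 Fx j jT) qj0.
    by rewrite qj0 ltxx in qj.
  rewrite /q'; case: ifPn => [/andP[/eqP sE iS]|].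
    suff -> : supp_seq T q x = T' by [].
    have memE : supp_seq T q x =i T'.
      by have [||//] := @uniq_min_size _ (supp_seq T q x) T' _ subT';
        [exact: filter_uniq|rewrite sE sT'].
    have TE : T' = [seq i <- T | i \in T'].
      by have [m ->] := sublistsP T'T; exact: mask_filter.
    by rewrite TE; apply: eq_in_filter => j jT; rewrite -memE mem_filter jT andbT.
  move=> h; rewrite rq//; apply: contrapT => nz.
  have pos j : j \in T' -> 0 < q j x.
    move=> jT'; rewrite ltNge; apply/negP => qj; apply: nz; exists j => //.
    by apply/eqP; rewrite eq_le qj q0//; exact: (sublists_subset T'T).
  have memE : supp_seq T q x =i T'.
    move=> j; apply/idP/idP; first exact: subT'.
    by move=> jT'; rewrite mem_filter pos// (sublists_subset T'T).
  have sE : size (supp_seq T q x) = size T'.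
    apply/eqP; rewrite -uniq_size_uniq//; last exact: sublists_uniq T'T.
    exact: filter_uniq.
  by move: h; rewrite sE sT' eqxx memE iT'.
have q'q i x : size (supp_seq T q x) != n.+1 -> q' i x = q i x.
  by rewrite /q' => /negbTE ->.
have supp_sub i x : C x -> i \in T -> q i x = 0 -> q' i x = 0.
  by move=> Cx iT qi0; rewrite /q' mem_filter qi0 ltxx andbF.
have pt x : C x -> size (supp_seq T q x) = n.+1 -> let T' := supp_seq T q x in
    [/\ T' \in sublists T, F T' x, forall i, i \in T' -> q' i x = r T' i x &
     forall i, i \in T -> i \notin T' -> q' i x = 0].
  move=> Cx sE T'; have T'T : T' \in sublists T by exact: mem_sublists.
  split=> //; first exact: FT.
    by move=> i; apply: q'E => //; exact: FT.
  by move=> i iT /(proj2 (FT x Cx) i iT); exact: supp_sub.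
have q'01 i x : i \in T -> C x -> 0 <= q' i x <= 1.
  move=> iT Cx; have [sE|/q'q ->] := eqVneq (size (supp_seq T q x)) n.+1; last exact: q01.
  have [T'T Fx q'r q'0] := pt x Cx sE.
  have [iT'|iT'] := boolP (i \in supp_seq T q x); last by rewrite q'0// lexx ler01.
  have [[_ r01 _] _ _] := rP _ T'T (n4 _ sE).
  by rewrite q'r//; exact: r01.
exists q'; first split=> //; first split=> //.
- move=> i iT; pose L := [seq T' <- sublists T | (size T' <= n.+1)%N].
  have sub : C `<=` (fun x => exists2 T', T' \in L & F T' x).
    move=> x Cx; exists (supp_seq T q x); last exact: FT.
    by rewrite mem_filter mem_sublists andbT ordq.
  apply: sub_cts sub _; apply: cts_bigU_seq => T' //.
  rewrite mem_filter => /andP[sT' T'T].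
  have [iT'|iT'] := boolP (i \in T'); last first.
    by apply: eq_cts (cts_cst (c := 0 : R)) => x [Cx h]; rewrite supp_sub// h.
  have [sE|sN] := eqVneq (size T') n.+1.
    have [[cr _ _] _ _] := rP _ T'T (n4 _ sE).
    by apply: eq_cts (cr i iT') => x Fx; rewrite (q'E T').
  have : cts (F T') (q i) by apply: sub_cts (cq i iT) => x [].
  apply: eq_cts => x [Cx h]; rewrite q'q// ltn_eqF// ltnS.
  have : (size T' < n.+1)%N by rewrite ltn_neqAle sN.
  rewrite ltnS; apply: leq_trans; apply: uniq_leq_size; first exact: filter_uniq.
  move=> j; rewrite mem_filter => /andP[qj jT]; apply: contraT => /(h j jT) qj0.
  by rewrite qj0 ltxx in qj.
- move=> x Cx; have [sE|/q'q q'qx] := eqVneq (size (supp_seq T q x)) n.+1.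
    have [T'T Fx q'r q'0] := pt x Cx sE.
    have [[_ _ r_pos] _ _] := rP _ T'T (n4 _ sE).
    have [i iT' ri] := r_pos x Fx; exists i; last by rewrite q'r.
    exact: (sublists_subset T'T).
  by have [i iT qi] := q_pos x Cx; exists i; rewrite // q'qx.
- by move=> x i; exact: supp_sub.
- by move=> x Cx s3 i iT; rewrite q'q// ltn_eqF// ltnS (leq_trans s3).
move=> x Cx; have [sE|sN] := eqVneq (size (supp_seq T q x)) n.+1.
  have [T'T Fx q'r q'0] := pt x Cx sE.
  have [_ r_0 _] := rP _ T'T (n4 _ sE).
  have [i iT' ri0] := r_0 x Fx; rewrite -ltnS -sE.
  apply: (@leq_ltn_trans (size (rem i (supp_seq T q x)))); last first.
    by rewrite size_rem// ltn_predL; case: (supp_seq T q x) iT'.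
  apply: uniq_leq_size; first exact: filter_uniq.
  move=> j; rewrite mem_filter => /andP[qj jT].
  rewrite mem_rem_uniq ?filter_uniq// inE; apply/andP; split.
    by apply: contraTneq qj => ->; rewrite q'r// ri0 ltxx.
  by apply: contraT => jT'; rewrite q'0// ltxx in qj.
rewrite (_ : supp_seq T q' x = supp_seq T q x); last first.
  by apply: eq_filter => i; rewrite q'q.
by rewrite -ltnS ltn_neqAle sN ordq.
Qed.

Lemma reduce_finite C T q : closed C -> uniq T -> coords C T q ->
  exists2 q', reduces C T q q' &
    forall x, C x -> (size (supp_seq T q' x) <= 3)%N.
Proof.
move=> clC uT; move: {2}(size T) (leqnn (size T)) => n sT.
have : forall x, C x -> (size (supp_seq T q x) <= n + 3)%N.
  move=> x _; apply: leq_trans (leq_addr _ _); apply: leq_trans sT.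
  by rewrite size_filter count_size.
elim: n q {sT} => [|n IH] q ordq cq; first by exists q.
have [q1 [cq1 z1 e1] o1] := @reduce_step C T q (n + 3) clC uT cq (leq_addl _ _) ordq.
have [q2 [cq2 z2 e2] o2] := IH q1 o1 cq1.
exists q2 => //; split=> //; first by move=> x i Cx iT /(z1 x i Cx iT); exact: z2.
move=> x Cx s3 i iT; rewrite e2 ?e1//.
rewrite (_ : supp_seq T q1 x = supp_seq T q x)//.
by apply: eq_in_filter => j jT; rewrite e1.
Qed.

End OrderReduction.

Section Systems.
Variables (R : realType) (X : metricType R) (I : choiceType).
Implicit Types (O : set X) (T : seq I) (p : I -> X -> R).

(* locally finite unnormalized coordinates on O: a map from O to the cone over
   the full simplex on I *)
Record psys O p : Prop := PSys {
  psys_cts : forall i, cts O (p i);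
  psys_ge0 : forall i x, O x -> 0 <= p i x;
  psys_le1 : forall i x, O x -> p i x <= 1;
  psys_fin : forall x, O x ->
    exists s : seq I, \forall y \near x, O y -> forall i, 0 < p i y -> i \in s;
  psys_cov : forall x, O x -> exists i, 0 < p i x;
  psys_out : forall i z, ~ O z -> \forall y \near z, O y -> p i y = 0
}.

Arguments psys_cts {O p} _ i.
Arguments psys_ge0 {O p} _ {i x}.
Arguments psys_le1 {O p} _ {i x}.
Arguments psys_fin {O p} _ {x}.
Arguments psys_cov {O p} _ {x}.
Arguments psys_out {O p} _ i {z}.

Definition face O p T := [set x | O x /\ forall i, 0 < p i x -> i \in T].

Lemma psys_eq0 O p i x : psys O p -> O x -> ~~ (0 < p i x) -> p i x = 0.
Proof.
by move=> hp Ox; rewrite lt_neqAle (psys_ge0 hp)// andbT negbK => /eqP.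
Qed.

(** Closed in the whole space, not only in [O]: near a point outside [O] the finitely many
    coordinates in [T] vanish, whereas every point of the face has a positive one. *)
Lemma closed_face O p T : psys O p -> closed (face O p T).
Proof.
move=> hp z clz; have [Oz|nOz] := pselect (O z); last first.
  have : \forall y \near z, forall i, i \in T -> O y -> p i y = 0.
    elim: T {clz} => [|a T IH]; first by apply: filterE.
    apply: filterS2 (psys_out hp a nOz) IH => y h1 h2 i.
    by rewrite inE => /predU1P[->|/h2]//.
  move=> /clz [y [[Oy hy] h]]; have [i pi] := psys_cov hp Oy.
  by move: (pi); rewrite (h i (hy i pi) Oy) ltxx.
split=> // i pi; have : nbhs (p i z) [set t | 0 < t].
  by apply: open_nbhs_nbhs; split=> //; exact: open_gt.
move=> /(cts_near (psys_cts hp i) Oz) /clz [y [[Oy hy] h]].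
exact/hy/h.
Qed.

Lemma face_cts (Z : topologicalType) O p (h : X -> Z) : psys O p ->
  (forall T, cts (face O p T) h) -> cts O h.
Proof.
move=> hp ch; apply: cts_local => x Ox; have [s sP] := psys_fin hp Ox.
exists (fun y => O y -> forall i, 0 < p i y -> i \in s) => //.
by apply: sub_cts (ch s) => y [Oy h']; split=> //; exact: h'.
Qed.

(** The enumeration is canonical: two points with the same positive coordinates have the same list.
    Data on simplices can therefore be indexed by lists. *)
Definition supp p x : seq I := enum_fset (fset_set [set i | 0 < p i x]).

Lemma supp_uniq p x : uniq (supp p x).
Proof. exact: fset_uniq. Qed.

Lemma finite_supp O p x : psys O p -> O x -> finite_set [set i | 0 < p i x].
Proof.
move=> hp Ox; have [s /nbhs_singleton sP] := psys_fin hp Ox.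
by apply: (sub_finite_set _ (finite_seq s)) => i /(sP Ox).
Qed.

Lemma mem_supp O p x i : psys O p -> O x -> (i \in supp p x) = (0 < p i x).
Proof.
move=> hp Ox; rewrite /supp in_fset_set; last exact: finite_supp hp Ox.
by apply/idP/idP; rewrite inE.
Qed.

Lemma supp_eq p x x' : (forall i, (0 < p i x) = (0 < p i x')) -> supp p x = supp p x'.
Proof.
move=> h; rewrite /supp; do 2 congr (_ _); apply/seteqP.
by split=> i /=; rewrite h.
Qed.

Lemma face_supp O p x : psys O p -> O x -> face O p (supp p x) x.
Proof. by move=> hp Ox; split=> // i; rewrite (mem_supp _ hp Ox). Qed.

Lemma size_supp_face O p T x : psys O p -> face O p T x -> (size (supp p x) <= size T)%N.
Proof.
move=> hp [Ox h]; apply: uniq_leq_size; first exact: supp_uniq.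
by move=> i; rewrite (mem_supp _ hp Ox) => /h.
Qed.

Lemma tietze01 (B : set X) (f : X -> R) : closed B -> cts B f ->
  (forall x, B x -> 0 <= f x <= 1) ->
  exists g, [/\ continuous g, forall x, B x -> g x = f x & forall x, 0 <= g x <= 1].
Proof.
move=> clB cf f01.
have nX : normal_space X by exact: pseudometric_normal.
have [|g [fg cg g1]] := continuous_bounded_extension nX clB (@ltr01 R) (cts_within cf).
  by move=> x /f01/andP[f0 f1]; rewrite ger0_norm.
exists (fun x => Num.max 0 (g x)); split.
- by apply: cts_continuous; apply: cts_max; [exact: cts_cst|exact: continuous_cts].
- move=> x Bx; rewrite -fg ?inE//; apply/max_idPr.
  by case/andP: (f01 x Bx).
- move=> x; rewrite le_max lexx /= ge_max ler01 /=.
  exact: le_trans (ler_norm _) (g1 x).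
Qed.

Definition reduction O p p' := [/\ psys O p',
  forall i x, O x -> 0 < p' i x -> 0 < p i x,
  forall x, O x -> (size (supp p' x) <= 3)%N &
  forall x, O x -> (size (supp p x) <= 3)%N -> forall i, p' i x = p i x].

Hypothesis dimX : covering_dim_le X 2.

(* the values at order n, on the set where at most n coordinates are nonzero *)
Let inv O p n (F : I -> X -> R) := [/\
  forall T i, (size T <= n)%N -> cts (face O p T) (F i),
  forall x, O x -> (size (supp p x) <= n)%N -> (forall i, 0 <= F i x <= 1) /\
    (exists i, 0 < F i x),
  forall x i, O x -> 0 < F i x -> 0 < p i x,
  forall x, O x -> (size (supp p x) <= n)%N -> exists2 s : seq I, (size s <= 3)%N &
     forall i, 0 < F i x -> i \in s &
  forall x, O x -> (size (supp p x) <= 3)%N -> forall i, F i x = p i x].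

(** Induction over skeleta: the values found on the boundary of a face with [n.+1] vertices are
    extended over the face by Tietze's theorem, then reduced to three positive coordinates. The
    reduction fixes the boundary values, which already have at most three. *)
Let inv_step O p n F : psys O p -> (3 <= n)%N -> inv O p n F ->
  exists2 F', inv O p n.+1 F' &
    forall x i, O x -> (size (supp p x) <= n)%N -> F' i x = F i x.
Proof.
move=> hp n3 [cF F01 Fp F3 Fe].
have F0 i x : O x -> (size (supp p x) <= n)%N -> ~~ (0 < p i x) -> F i x = 0.
  move=> Ox sx npi; have /andP[h _] := (F01 x Ox sx).1 i.
  apply/eqP; rewrite eq_le h andbT leNgt; apply/negP => /(Fp _ _ Ox).
  by rewrite (negbTE npi).
pose B T := fun x => exists2 i, i \in T & face O p (rem i T) x.
have clB T : closed (B T) by apply: closed_bigU_seq => i _; exact: closed_face.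
have BP T x : uniq T -> size T = n.+1 -> face O p T x ->
    (size (supp p x) <= n)%N <-> B T x.
  move=> uT sT fx; have [Ox hx] := fx; split=> [sx|[i iT fi]]; last first.
    by apply: leq_trans (size_supp_face hp fi) _; rewrite size_rem// sT.
  have [/allP h|/allPn[i iT ni]] := boolP (all (mem (supp p x)) T).
    by have := uniq_leq_size uT h; rewrite sT ltnNge sx.
  exists i => //; split=> // j pj; rewrite mem_rem_uniq// inE hx// andbT.
  by apply: contraNneq ni => <-; rewrite inE (mem_supp _ hp Ox).
have cFB T i : uniq T -> size T = n.+1 -> cts (B T) (F i).
  move=> uT sT; apply: cts_bigU_seq => j jT; first exact: closed_face.
  by apply: cF; rewrite size_rem// sT.
have step T : exists q, uniq T -> size T = n.+1 -> [/\ coords (face O p T) T q,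
    forall x, face O p T x -> (size (supp_seq T q x) <= 3)%N &
    forall x i, i \in T -> face O p T x -> B T x -> q i x = F i x].
  have [uT|] := pselect (uniq T); last by exists p.
  have [sT|] := pselect (size T = n.+1); last by exists p.
  have subB x : B T x -> face O p T x.
    by move=> [i iT [Ox h]]; split=> // j /h /mem_rem.
  have FB x : B T x -> O x /\ (size (supp p x) <= n)%N.
    by move=> Bx; have fx := subB x Bx; split; [case: fx|apply/(BP T)].
  have /choice[g gP] : forall i, exists g, [/\ continuous g,
      forall x, B T x -> g x = F i x & forall x, 0 <= g x <= 1].
    move=> i; apply: tietze01 => //; first exact: cFB.
    by move=> x /FB[Ox sx]; case: (F01 x Ox sx) => h _; exact: h.
  (* Tietze's extension could vanish in all coordinates. The added distance to [B T] prevents this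
     off the boundary and changes nothing on it. *)
  pose q i x := Num.min 1 (g i x + codist (~` B T) x).
  have qF i x : B T x -> q i x = F i x.
    move=> Bx; rewrite /q codist_eq0; last by move=> /(_ Bx).
    rewrite addr0; case: (gP i) => _ gF g01; rewrite gF//; apply/min_idPr.
    by rewrite -gF//; case/andP: (g01 x).
  have cq : coords (face O p T) T q.
    split=> [i iT|i x iT fx|x fx].
    - apply/continuous_cts/cts_continuous/cts_min; first exact: cts_cst.
      by apply: ctsD; apply: continuous_cts; [case: (gP i)|exact: continuous_codist].
    - rewrite /q ge_min lexx /= andbT le_min ler01 /= addr_ge0 ?codist_ge0//.
      by case: (gP i) => _ _ /(_ x)/andP[].
    - have [Bx|nBx] := pselect (B T x).
        have [Ox sx] := FB x Bx; have [_ [i Fi]] := F01 x Ox sx.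
        by exists i; [apply: fx.2; exact: Fp Fi|rewrite qF].
      case: (T) sT (fun i => (gP i)) => // a s _ gP'; exists a; first exact: mem_head.
      rewrite /q lt_min ltr01 /=; apply: ltr_wpDl.
        by case: (gP a) => _ _ /(_ x)/andP[].
      by apply: codist_open_gt0 => //; exact: closed_openC.
  have [q' [cq' z e] o3] := reduce_finite dimX (@closed_face O p T hp) uT cq.
  exists q' => _ _; split=> // x i iT fx Bx; rewrite e ?qF//.
  have [Ox sx] := FB x Bx; have [s s3 sF] := F3 x Ox sx.
  apply: leq_trans s3; apply: uniq_leq_size; first exact: filter_uniq.
  by move=> j; rewrite mem_filter => /andP[qj _]; apply: sF; rewrite -qF.
have /choice[q qP] := step.
pose F' i x := let T := supp p x in
  if size T == n.+1 then (if i \in T then q T i x else 0) else F i x.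
have F'F x i : (size (supp p x) <= n)%N -> F' i x = F i x.
  by move=> sx; rewrite /F' ltn_eqF.
(* A face may be given by any list, whereas [F'] is defined through the canonical list of a support;
   [can] passes from one to the other. *)
pose can T := enum_fset (fset_set [set` T]).
have can_mem T i : (i \in can T) = (i \in T).
  by rewrite /can in_fset_set//; apply/idP/idP; rewrite inE.
have can_uniq T : uniq (can T) by exact: fset_uniq.
have can_face T : face O p (can T) = face O p T.
  by apply/seteqP; split=> x [Ox h]; split=> // i /h; rewrite can_mem.
have can_size T : (size (can T) <= size T)%N.
  by apply: uniq_leq_size => // i; rewrite can_mem.
have can_supp T x : face O p T x -> (size (supp p x) = size (can T)) ->
    supp p x = can T.
  move=> [Ox h] sx; rewrite /supp /can; do 2 congr (_ _).
  have [||_ memE] := @uniq_min_size _ (supp p x) (can T) (supp_uniq p x).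
  - by move=> i; rewrite (mem_supp _ hp Ox) can_mem => /h.
  - by rewrite sx.
  apply/seteqP; split=> i /=; first exact: h.
  by move=> iT; rewrite -(mem_supp _ hp Ox) memE can_mem.
have F'q T x i : size (can T) = n.+1 -> face O p T x ->
    F' i x = if i \in can T then q (can T) i x else 0.
  move=> sT fx; have fcx : face O p (can T) x by rewrite can_face.
  have [Ox hx] := fx.
  have := size_supp_face hp fcx; rewrite sT leq_eqVlt => /predU1P[sx|].
    by rewrite /F' (can_supp T x fx) ?sT// eqxx.
  rewrite ltnS => sx; rewrite F'F//; case: ifPn => iT.
    have [_ _ e] := qP (can T) (can_uniq T) sT; rewrite e//.
    by apply/(BP (can T)).
  by rewrite F0//; apply: contra iT => /hx; rewrite can_mem.
have big x : O x -> size (supp p x) = n.+1 -> let T := supp p x in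
    [/\ can T = T, face O p T x & coords (face O p T) T (q T)].
  move=> Ox sx T; have fx : face O p T x by exact: face_supp.
  have cT : can T = T.
    apply/esym/can_supp => //; apply/eqP; rewrite -uniq_size_uniq ?supp_uniq//.
  by split=> //; have [] := qP T (supp_uniq p x) sx.
exists F'; last by move=> x i _; exact: F'F.
split.
- move=> T i sT; have [sc|sc] := eqVneq (size (can T)) n.+1.
    have [[cq _ _] _ _] := qP (can T) (can_uniq T) sc.
    rewrite can_face in cq.
    have [iT|iT] := boolP (i \in can T).
      by apply: eq_cts (cq i iT) => x fx; rewrite (F'q T)// iT.
    by apply: eq_cts (cts_cst (c := 0 : R)) => x fx; rewrite (F'q T)// (negbTE iT).
  have sc' : (size (can T) <= n)%N.
    by rewrite -ltnS ltn_neqAle sc (leq_trans (can_size T)).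
  have := cF (can T) i sc'; rewrite can_face; apply: eq_cts => x fx.
  by rewrite F'F// (leq_trans (size_supp_face hp _) sc')// can_face.
- move=> x Ox; rewrite leq_eqVlt => /predU1P[sx|]; last first.
    rewrite ltnS => sx; have [h1 [i Fi]] := F01 x Ox sx.
    by split=> [j|]; [|exists i]; rewrite F'F.
  have [cT fx [_ c01 c_pos]] := big x Ox sx; split=> [i|].
    rewrite (F'q (supp p x)) ?cT//; case: ifP => iT; first exact: c01.
    by rewrite lexx ler01.
  by have [i iT qi] := c_pos x fx; exists i; rewrite (F'q (supp p x)) ?cT// iT.
- move=> x i Ox; rewrite /F'; case: ifP => _; last exact: Fp.
  by case: ifP; rewrite ?ltxx// (mem_supp _ hp Ox).
- move=> x Ox; rewrite leq_eqVlt => /predU1P[sx|]; last first.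
    rewrite ltnS => sx; have [s s3 sF] := F3 x Ox sx.
    by exists s => // i; rewrite F'F//; exact: sF.
  have [cT fx _] := big x Ox sx.
  have [_ o3 _] := qP (supp p x) (supp_uniq p x) sx.
  exists (supp_seq (supp p x) (q (supp p x)) x); first exact: o3.
  move=> i; rewrite (F'q (supp p x)) ?cT//; case: ifP; rewrite ?ltxx// => iT qi.
  by rewrite mem_filter qi.
- by move=> x Ox sx i; rewrite F'F ?Fe// (leq_trans sx).
Qed.

(** Local finiteness bounds the number of positive coordinates only locally, so infinitely many
    stages may occur. The value at [x] is final once faces of the size of its support have been
    treated, and finitely many stages settle each face. *)
Lemma order_reduction O p : psys O p -> exists p', reduction O p p'.
Proof.
move=> hp.
have inv0 : inv O p 3 p.
  split=> //.
  - by move=> T i _; apply: sub_cts (psys_cts hp i) => x [].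
  - move=> x Ox _; split; last by have := psys_cov hp Ox.
    by move=> i; rewrite (psys_ge0 hp) ?(psys_le1 hp).
  - by move=> x Ox sx; exists (supp p x) => // i; rewrite (mem_supp _ hp Ox).
have /choice[nx nxP] : forall nF : nat * (I -> X -> R), exists F',
    (3 <= nF.1)%N -> inv O p nF.1 nF.2 -> inv O p nF.1.+1 F' /\
    forall x i, O x -> (size (supp p x) <= nF.1)%N -> F' i x = nF.2 i x.
  move=> [n F] /=; have [n3|] := pselect (3 <= n)%N; last by exists F.
  have [iF|] := pselect (inv O p n F); last by exists F.
  by have [F' i1 i2] := inv_step hp n3 iF; exists F'.
pose F := fix F k := if k is k'.+1 then nx ((k' + 3)%N, F k') else p.
have invF k : inv O p (k + 3) (F k).
  elim: k => [//|k IH]; rewrite addSn /=.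
  by have [] := nxP (k + 3, F k)%N (leq_addl _ _) IH.
have stab k l x i : O x -> (size (supp p x) <= k + 3)%N -> F (l + k)%N i x = F k i x.
  move=> Ox sx; elim: l => // l <-; rewrite addSn /=.
  have [_ ->//] := nxP (l + k + 3, F (l + k))%N (leq_addl _ _) (invF _).
  by rewrite (leq_trans sx)// leq_add2r leq_addl.
have stab' k l x i : O x -> (size (supp p x) <= k)%N -> (size (supp p x) <= l)%N ->
    F k i x = F l i x.
  move=> Ox; wlog kl : k l / (k <= l)%N.
    by move=> H sk sl; have [|/ltnW] := leqP k l => h; [|apply/esym]; exact: H.
  by move=> sk _; rewrite -(subnK kl) stab// (leq_trans sk)// leq_addr.
pose p' i x := F (size (supp p x)) i x.
have p'E k x i : O x -> (size (supp p x) <= k)%N -> p' i x = F k i x.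
  by move=> Ox sx; apply: stab'.
have p'P x : O x -> [/\ (forall i, 0 <= p' i x <= 1), (exists i, 0 < p' i x),
    (exists2 s : seq I, (size s <= 3)%N & forall i, 0 < p' i x -> i \in s) &
    forall i, 0 < p' i x -> 0 < p i x].
  move=> Ox; have [_ h1 h2 h3 _] := invF (size (supp p x)).
  have sx : (size (supp p x) <= size (supp p x) + 3)%N by exact: leq_addr.
  have [? ?] := h1 x Ox sx; have ? := h3 x Ox sx.
  by split=> // i; exact: h2.
have hp' : psys O p'.
  split.
  - move=> i; apply: (face_cts hp) => T; have [h _ _ _ _] := invF (size T).
    apply: eq_cts (h T i (leq_addr _ _)) => x fx; rewrite -p'E//; first by case: fx.
    exact: size_supp_face fx.
  - by move=> i x /p'P[h _ _ _]; case/andP: (h i).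
  - by move=> i x /p'P[h _ _ _]; case/andP: (h i).
  - move=> x Ox; have [s sP] := psys_fin hp Ox; exists s.
    apply: filterS sP => y h Oy i p'i; apply: h => //.
    by have [_ _ _] := p'P y Oy; apply.
  - by move=> x /p'P[].
  - move=> i z nOz; apply: filterS (psys_out hp i nOz) => y h Oy.
    have [p01 _ _ hh] := p'P y Oy; have /andP[h0 _] := p01 i.
    apply/eqP; rewrite eq_le h0 andbT leNgt; apply/negP => /hh.
    by rewrite h// ltxx.
exists p'; split=> //.
- by move=> i x Ox; have [_ _ _] := p'P x Ox; apply.
- move=> x Ox; have [_ _ [s s3 sP] _] := p'P x Ox.
  apply: leq_trans s3; apply: uniq_leq_size; first exact: supp_uniq.
  by move=> i; rewrite (mem_supp _ hp' Ox) => /sP.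
- move=> x Ox sx i; have [_ _ _ _ h] := invF 3.
  by rewrite (p'E 3 x i Ox sx); exact: h.
Qed.

End Systems.

Arguments psys_cts {R X I O p} _ i.
Arguments psys_ge0 {R X I O p} _ {i x}.
Arguments psys_le1 {R X I O p} _ {i x}.
Arguments psys_fin {R X I O p} _ {x}.
Arguments psys_cov {R X I O p} _ {x}.
Arguments psys_out {R X I O p} _ i {z}.

(** * Maps defined simplex by simplex over the nerve *)

Section Gluing.
Variables (R : realType) (X : metricType R) (I : choiceType).
Variables (O : set X) (p : I -> X -> R).
Hypothesis hp : psys O p.
Implicit Types (T : seq I).

(** Only supports of actual points count: over such a triangle there is a point at which the cocycle
    relation can be read off. *)
Definition simplex T := exists2 x, O x & supp p x = T.

Let can T := enum_fset (fset_set [set` T]).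

Lemma face_simplices T : exists2 L : seq (seq I), (forall T', T' \in L -> simplex T') &
  forall x, face O p T x -> supp p x \in L.
Proof.
exists [seq T' <- [seq can T' | T' <- sublists T] | `[< simplex T' >]].
  by move=> T'; rewrite mem_filter => /andP[/asboolP].
move=> x [Ox h]; rewrite mem_filter; apply/andP; split; first by apply/asboolP; exists x.
apply/mapP; exists [seq i <- T | 0 < p i x]; first exact: mem_sublists.
rewrite /supp /can; do 2 congr (_ _); apply/seteqP; split=> i /=.
  by move=> pi; rewrite mem_filter pi h.
by rewrite mem_filter => /andP[].
Qed.

(** By local finiteness continuity may be checked on faces, and each face is a finite union of
    closed faces of realised simplices, on which the glued function is [h T']. *)
Lemma glue_faces (Z : topologicalType) (h : seq I -> X -> Z) :
  (forall T, simplex T -> cts (face O p T) (h T)) ->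
  (forall T x, simplex T -> face O p T x -> supp p x != T -> h T x = h (supp p x) x) ->
  cts O (fun x => h (supp p x) x).
Proof.
move=> ch hE; apply: (face_cts hp) => T.
have [L LP Lsupp] := face_simplices T.
have sub : face O p T `<=` (fun x => exists2 T', T' \in L & face O p T' x).
  by move=> x fx; exists (supp p x); [exact: Lsupp|case: fx => Ox _; exact: face_supp].
apply: sub_cts sub _.
apply: cts_bigU_seq => T' /LP sT'; first exact: closed_face.
apply: eq_cts (ch T' sT') => x fx.
by have [<-//|sx] := eqVneq (supp p x) T'; exact: hE.
Qed.

Lemma simplex_supp T x : simplex T -> face O p T x -> (size T <= size (supp p x))%N ->
  supp p x = T.
Proof.
move=> [x0 Ox0 <-] fx sT; have [Ox hx] := fx; apply: supp_eq => j.
have [|_ memE] := @uniq_min_size _ (supp p x) (supp p x0) (supp_uniq p x) _ sT.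
  by move=> k; rewrite (mem_supp _ hp Ox) => /hx.
by rewrite -(mem_supp _ hp Ox) memE (mem_supp _ hp Ox0).
Qed.

Lemma supp_proper T x : simplex T -> face O p T x -> supp p x != T ->
  (size (supp p x) < size T)%N.
Proof. by move=> sT fx; apply: contraNT; rewrite -leqNgt => /(simplex_supp sT fx) ->. Qed.

Section NerveMap.
Variables (Z : topologicalType) (y : I -> Z) (e : I -> I -> R -> Z).
Variable H : seq I -> X -> Z.
Hypothesis ord3 : forall x, O x -> (size (supp p x) <= 3)%N.
Hypothesis e_cts : forall i j : I, i != j -> cts (@itv01 R) (e i j).
Hypothesis e0 : forall i j : I, i != j -> e i j 0 = y i.
Hypothesis e_sym : forall (i j : I) t, i != j -> e i j t = e j i (1 - t).

Definition edge_ratio i j x := p j x / (p i x + p j x).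

Hypothesis H_cts : forall T, simplex T -> size T = 3%N -> cts (face O p T) (H T).
Hypothesis H_edge : forall T a b x, simplex T -> size T = 3%N -> a \in T -> b \in T ->
  a != b -> face O p [:: a; b] x -> H T x = e a b (edge_ratio a b x).

Let h T x := if T is [:: i] then y i else
  if T is [:: i; j] then e i j (edge_ratio i j x) else H T x.

(** The datum [H T] on a triangle is a map on the part of the space over it, not on the triangle
    itself. So a triangle whose boundary is an essential loop in [Z] may still be admissible. *)
Definition nerve_map x := h (supp p x) x.

Lemma ratio01 i j x : O x -> 0 < p i x + p j x -> 0 <= edge_ratio i j x <= 1.
Proof.
move=> Ox s0; have pi := psys_ge0 hp (i := i) Ox; have pj := psys_ge0 hp (i := j) Ox.
by apply/andP; split; [rewrite divr_ge0// ltW|rewrite ler_pdivrMr// mul1r lerDr].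
Qed.

Lemma pair_pos i j x : face O p [:: i; j] x -> 0 < p i x + p j x.
Proof.
move=> [Ox hx]; have [k pk] := psys_cov hp Ox.
have := psys_ge0 hp (i := i) Ox; have := psys_ge0 hp (i := j) Ox.
by move: (pk) => /hx; rewrite !inE => /orP[]/eqP kE; subst k; lra.
Qed.

Lemma ratioC i j x : 0 < p i x + p j x -> edge_ratio j i x = 1 - edge_ratio i j x.
Proof.
move=> s0; have s1 : p i x + p j x != 0 by rewrite gt_eqF.
by rewrite /edge_ratio [p j x + _]addrC; field.
Qed.

Lemma supp_face1 i x : face O p [:: i] x -> supp p x = [:: i].
Proof.
move=> fx; have [Ox hx] := fx; have := supp_uniq p x.
have : {subset supp p x <= [:: i]} by move=> j; rewrite (mem_supp _ hp Ox) => /hx.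
have [k] := psys_cov hp Ox; rewrite -(mem_supp _ hp Ox).
case: (supp p x) => // a [|b s] _ sub /=; first by have := sub a (mem_head _ _); rewrite inE => /eqP ->.
have := sub a (mem_head _ _); have := sub b; rewrite !inE eqxx orbT => /(_ isT) /eqP -> /eqP ->.
by rewrite eqxx.
Qed.

Lemma nerve_map1 i x : face O p [:: i] x -> nerve_map x = y i.
Proof. by move=> fx; rewrite /nerve_map /h (supp_face1 fx). Qed.

Let e1 i j : i != j -> e i j 1 = y j.
Proof. by move=> ij; rewrite e_sym// subrr e0// eq_sym. Qed.

Let edge1 i j x : i != j -> face O p [:: i; j] x -> p j x = 0 ->
  e i j (edge_ratio i j x) = y i /\ e j i (edge_ratio j i x) = y i.
Proof.
move=> ij fx pj; have := pair_pos fx; rewrite pj addr0 => pi.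
by rewrite /edge_ratio pj mul0r add0r divff ?gt_eqF// e0// e1// eq_sym.
Qed.

Lemma supp_face2 i j x : i != j -> face O p [:: i; j] x ->
  [\/ supp p x = [:: i; j], supp p x = [:: j; i],
      supp p x = [:: i] /\ p j x = 0 | supp p x = [:: j] /\ p i x = 0].
Proof.
move=> ij fx; have [Ox hx] := fx.
have p0 k : k \notin supp p x -> p k x = 0.
  by rewrite (mem_supp _ hp Ox) => npk; apply/eqP; rewrite eq_le (psys_ge0 hp Ox) andbT leNgt.
have := supp_uniq p x; have sub : {subset supp p x <= [:: i; j]}.
  by move=> k; rewrite (mem_supp _ hp Ox) => /hx.
have [k] := psys_cov hp Ox; rewrite -(mem_supp _ hp Ox).
case: (supp p x) sub p0 => // a [|b [|c s]] sub p0 _ /=.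
- have := sub a (mem_head _ _); rewrite !inE => /orP[]/eqP aE; subst a => _.
    by constructor 3; rewrite p0// inE eq_sym.
  by constructor 4; rewrite p0// inE.
- have := sub a (mem_head _ _); have := sub b; rewrite !inE eqxx orbT => /(_ isT).
  move=> /orP[]/eqP-> /orP[]/eqP->; rewrite ?eqxx// => _.
    by constructor 2.
  by constructor 1.
- have := sub a (mem_head _ _); have := sub b; have := sub c; rewrite !inE !eqxx !orbT.
  move=> /(_ isT) h1 /(_ isT) h2 h3.
  by case/orP: h1 => /eqP->; case/orP: h2 => /eqP->; case/orP: h3 => /eqP->; rewrite ?eqxx ?orbT ?andbF.
Qed.

Lemma nerve_map2 i j x : i != j -> face O p [:: i; j] x ->
  nerve_map x = e i j (edge_ratio i j x).
Proof.
move=> ij fx; have fx' : face O p [:: j; i] x.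
  by case: fx => Ox hx; split=> // k /hx; rewrite !inE orbC.
have ji : j != i by rewrite eq_sym.
case: (supp_face2 ij fx) => [s|s|[s pj]|[s pi]]; rewrite /nerve_map /h s//.
- by rewrite e_sym// (ratioC (pair_pos fx)) subKr.
- by have [->] := edge1 ij fx pj.
- by have [_ ->] := edge1 ji fx' pi.
Qed.

Lemma nerve_map3 x : size (supp p x) = 3%N -> nerve_map x = H (supp p x) x.
Proof. by rewrite /nerve_map /h; case: (supp p x) => [|a [|b [|c []]]]. Qed.

Lemma nerve_map_cts : cts O nerve_map.
Proof.
apply: glue_faces => [T sT|T x sT fx sx].
  have [x0 Ox0 sE] := sT; have uT : uniq T by rewrite -sE supp_uniq.
  have := ord3 Ox0; have T0 : T != [::].
    have [k] := psys_cov hp Ox0; rewrite -(mem_supp _ hp Ox0) sE.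
    by case: (T).
  rewrite sE; case: T sT T0 uT {sE} => [|i [|j [|k []]]]//= sT _ uT _.
  - exact: cts_cst.
  - have ij : i != j by move: uT; rewrite inE andbT.
    apply: (cts_comp (f := edge_ratio i j) (B := (@itv01 R))).
    + by move=> x fx; apply: ratio01; [case: fx|exact: pair_pos].
    + have sub : face O p [:: i; j] `<=` O by move=> x [].
      apply: cts_div => [x fx||]; first by rewrite gt_eqF// pair_pos.
        exact: sub_cts sub (psys_cts hp j).
      by apply: ctsD; apply: sub_cts sub (psys_cts hp _).
    + exact: e_cts.
  - exact: H_cts.
have := supp_proper sT fx sx; have Ox : O x by case: fx.
have [x0 Ox0 sE] := sT; have uT : uniq T by rewrite -sE supp_uniq.
have T3 : (size T <= 3)%N by rewrite -sE ord3.
have sub : {subset supp p x <= T} by move=> i; rewrite (mem_supp _ hp Ox) => /(proj2 fx).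
have fs := face_supp hp Ox; have us := supp_uniq p x.
have s0 : supp p x != [::].
  by have [k] := psys_cov hp Ox; rewrite -(mem_supp _ hp Ox); case: (supp p x).
have one a : supp p x = [:: a] -> nerve_map x = y a.
  by move=> s; rewrite /nerve_map /h s.
case: T T3 sT fx sx sub uT sE => [|i [|j [|k []]]]//= _ sT fx sx sub uT sE sz.
- by case: (supp p x) s0 sz.
- have ij : i != j by move: uT; rewrite inE andbT.
  rewrite -/(h (supp p x) x) -/(nerve_map x).
  by rewrite (nerve_map2 ij fx).
- rewrite -/(h (supp p x) x) -/(nerve_map x).
  case sE' : (supp p x) s0 sz us sub fs => [|a [|b []]]//= _ _ us sub fs.
    have aT := sub a (mem_head _ _).
    have [b bT ab] : exists2 b, b \in [:: i; j; k] & a != b.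
      have [->|ai] := eqVneq a i; last by exists i; rewrite // mem_head.
      by exists j; move: uT; rewrite !inE ?eqxx ?orbT// negb_or => /andP[/andP[]].
    have fab : face O p [:: a; b] x.
      by split=> // l /(proj2 fs); rewrite !inE => ->.
    rewrite (H_edge sT _ aT bT ab fab)// (one a sE').
    apply: (proj1 (edge1 ab fab _)).
    have : b \notin supp p x by rewrite sE' inE eq_sym.
    rewrite (mem_supp _ hp Ox) => npb.
    by apply/eqP; rewrite eq_le (psys_ge0 hp Ox) andbT leNgt.
  have ab : a != b by move: us; rewrite inE andbT.
  rewrite (H_edge sT _ _ _ ab fs)//; [|exact: sub (mem_head _ _)|].
    by rewrite (nerve_map2 ab fs).
  by apply: sub; rewrite !inE eqxx orbT.
Qed.

End NerveMap.

End Gluing.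

(** * Cocycles *)

Section Congruence.
Local Open Scope group_scope.
Variable G : groupType.
Implicit Types (N : set G) (x y z : G).

Definition normal_subgroup N := is_subgroup N /\ forall x y, N x -> N (x ^ y).

(** Cosets are compared but quotient groups are not formed: a cocycle modulo [N] is a function with
    values in [G], ready to be corrected modulo a smaller subgroup. *)
Definition eqmod N x y := N (x^-1 * y).

Lemma subgroup1 N : is_subgroup N -> N 1. Proof. by case. Qed.

Lemma subgroupV N x : is_subgroup N -> N x -> N x^-1.
Proof. by move=> [N1 NF] Nx; rewrite -div1g; exact: NF. Qed.

Lemma subgroupM N x y : is_subgroup N -> N x -> N y -> N (x * y).
Proof. by move=> hN Nx Ny; rewrite -[y]invgK; apply: hN.2 => //; exact: subgroupV. Qed.

Lemma eqmod_refl N x : is_subgroup N -> eqmod N x x.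
Proof. by move=> hN; rewrite /eqmod mulVg; exact: subgroup1. Qed.

Lemma eqmod_sym N x y : is_subgroup N -> eqmod N x y -> eqmod N y x.
Proof. by move=> hN /(subgroupV hN); rewrite /eqmod invgM invgK. Qed.

Lemma eqmod_trans N y x z : is_subgroup N -> eqmod N x y -> eqmod N y z -> eqmod N x z.
Proof.
by move=> hN xy yz; rewrite /eqmod -[z](mulVKg y) mulgA; exact: subgroupM.
Qed.

Lemma eqmodM N x y x' y' : normal_subgroup N -> eqmod N x y -> eqmod N x' y' ->
  eqmod N (x * x') (y * y').
Proof.
move=> [hN hJ] xy xy'; rewrite /eqmod invgM.
have -> : x'^-1 * x^-1 * (y * y') = (x^-1 * y) ^ x' * (x'^-1 * y').
  by rewrite conjgE !mulgA mulgK.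
by apply: subgroupM => //; exact: hJ.
Qed.

Lemma eqmodV N x y : normal_subgroup N -> eqmod N x y -> eqmod N x^-1 y^-1.
Proof.
move=> [hN hJ] xy; rewrite /eqmod invgK.
have -> : x * y^-1 = ((x^-1 * y)^-1) ^ x^-1.
  by rewrite conjgE !invgM !invgK !mulgA mulgK.
exact: hJ (subgroupV hN xy).
Qed.

Lemma trivial_normal : normal_subgroup [set (1 : G)].
Proof.
split=> [|x y /= ->]; last by rewrite conj1g.
by split=> //= x y -> ->; rewrite divg1.
Qed.

Lemma eqmod1 x y : eqmod [set (1 : G)] x y -> x = y.
Proof. by move=> /= h; rewrite -[y](mulVKg x) h mulg1. Qed.

Lemma full_subgroup : is_subgroup [set: G].
Proof. by []. Qed.

(** Transition elements over the boundary of a triangle, with the whole monodromy [g] placed on the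
    edge from vertex 2 to vertex 0. Three distinct vertices never occur together there, so no
    relation constrains [g]. *)
Definition std (g : G) (k l : 'I_3) : G :=
  if (val k, val l) == (2, 0)%N then g
  else if (val k, val l) == (0, 2)%N then g^-1 else 1.

Lemma stdV g k l : std g l k = (std g k l)^-1.
Proof.
by case: k => -[|[|[|//]]] ?; case: l => -[|[|[|//]]] ?; rewrite /std /= ?invg1 ?invgK.
Qed.

Lemma std_subgroup V g k l : is_subgroup V -> V g -> V (std g k l).
Proof.
move=> hV Vg; rewrite /std; case: ifP => _ //; case: ifP => _; first exact: subgroupV.
exact: subgroup1.
Qed.

End Congruence.

Section CocycleExtension.
Variables (R : realType) (X : metricType R).

(* a map from A to the boundary of the triangle, in homogeneous coordinates *)
Definition circle_map (A : set X) (u : 'I_3 -> X -> R) := [/\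
  forall k, cts A (u k), forall k x, A x -> 0 <= u k x <= 1,
  forall x, A x -> exists k, 0 < u k x &
  forall x, A x -> exists k, u k x = 0].

Definition cocycle_on (G : groupType) (V N : set G) (I : choiceType)
    (p : I -> X -> R) (c : I -> I -> G) :=
  (forall a b, V (c a b)) /\
  forall x a b d, 0 < p a x -> 0 < p b x -> 0 < p d x ->
    eqmod N (c a b * c b d)%g (c a d).

(* The principal bundle on a closed set A pulled back along a circle map from
   the one with monodromy g extends to X: it is described by coordinates p on X
   extending u and by transition elements c in V, a cocycle modulo N. *)
Definition extends_cocycle (G : groupType) (V N : set G) (g : G) :=
  forall A u, closed A -> circle_map A u ->
  exists (J : choiceType) (p : 'I_3 + J -> X -> R) (c : 'I_3 + J -> 'I_3 + J -> G),
  [/\ psys [set: X] p, forall k x, A x -> p (inl k) x = u k x,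
    forall j x, A x -> p (inr j) x = 0, cocycle_on V N p c &
    forall k l, eqmod N (std g k l) (c (inl k) (inl l))].

(** Change of group along a homomorphism from V/N to H/N'. Since [phi] need be multiplicative only
    modulo [N'], commutation with a fixed element and the choice of coset representatives both
    qualify. *)
Lemma extends_cocycle_mor (G H : groupType) (V N : set G) (V' N' : set H)
    (phi : G -> H) g : is_subgroup V -> normal_subgroup N' ->
  (forall x, V x -> V' (phi x)) ->
  (forall x y, V x -> V y -> eqmod N' (phi (x * y)%g) (phi x * phi y)%g) ->
  (forall x y, V x -> V y -> eqmod N x y -> eqmod N' (phi x) (phi y)) ->
  V g -> extends_cocycle V N g -> extends_cocycle V' N' (phi g).
Proof.
move=> hV [sN' nN'] VV' phiM phiN Vg E A u clA cu.
have [J [p [c [hp pu p0 [Vc hc] cstd]]]] := E A u clA cu.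
have phi1 : eqmod N' 1%g (phi 1%g).
  have := phiM _ _ (subgroup1 hV) (subgroup1 hV); rewrite mulg1 => h.
  have := eqmodM (conj sN' nN') (eqmod_refl (phi 1%g)^-1%g sN') h.
  by rewrite mulKg mulVg.
have phiV x : V x -> eqmod N' (phi x)^-1%g (phi x^-1%g).
  move=> Vx; have Vx' := subgroupV hV Vx.
  have := phiM _ _ Vx Vx'; rewrite mulgV => h.
  have := eqmod_trans sN' phi1 h => {}h.
  have := eqmodM (conj sN' nN') (eqmod_refl (phi x)^-1%g sN') h.
  by rewrite mulg1 mulKg.
have phi_std k l : eqmod N' (std (phi g) k l) (phi (std g k l)).
  rewrite /std; case: ifP => _; first exact: eqmod_refl.
  by case: ifP => _ //; exact: phiV.
exists J, p, (fun a b => phi (c a b)); split=> //; first split.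
- by move=> a b; exact: VV'.
- move=> x a b d pa pb pd.
  apply: (eqmod_trans sN' (eqmod_sym sN' (phiM _ _ (Vc _ _) (Vc _ _)))).
  by apply: phiN; [exact: subgroupM|exact: Vc|exact: hc pd].
- move=> k l; apply: (eqmod_trans sN' (phi_std k l)); apply: phiN => //.
  exact: std_subgroup.
Qed.

(** The boundary of a triangle is a neighborhood retract: after extending the three coordinates by
    Tietze's theorem, subtracting their minimum makes one vanish, and another stays positive on the
    open set [D] where they are not all equal. [A'] consists of the points at least as close to [A]
    as to the complement of [D], and [lam] is positive only strictly inside this region. *)
Lemma thicken A u : closed A -> circle_map A u ->
  exists A' u' (lam : X -> R), [/\ closed A' /\ A `<=` A', circle_map A' u',
    forall k x, A x -> u' k x = u k x &
    [/\ continuous lam, forall x, 0 <= lam x <= 1, forall x, A x -> lam x = 1 &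
        forall x, 0 < lam x -> A' x]].
Proof.
move=> clA [cu u01 u_pos u_0].
have /choice[w wP] : forall k, exists g, [/\ continuous g,
    forall x, A x -> g x = u k x & forall x, 0 <= g x <= 1].
  by move=> k; apply: tietze01 => // x Ax; exact: u01.
have cw k : continuous (w k) by case: (wP k).
have wu k x : A x -> w k x = u k x by case: (wP k) => _ h _; exact: h.
have w01 k x : 0 <= w k x <= 1 by case: (wP k).
pose m x := minseq (enum 'I_3) (w ^~ x).
have cm : continuous m.
  by apply: cts_continuous; apply: cts_minseq => t _; exact: continuous_cts.
have m_le k x : m x <= w k x by apply: (@minseq_le R _ _ (w ^~ x)); rewrite mem_enum.
have m_att x : exists k, m x = w k x.
  have [||k _ h] := @minseq_attained R 'I_3 (enum 'I_3) (w ^~ x).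
  - by rewrite -size_eq0 size_enum_ord.
  - by move=> k _; case/andP: (w01 k x).
  by exists k.
pose D := \bigcup_k [set x | 0 < w k x - m x].
have oD : open D.
  apply: bigcup_open => k _; rewrite -[X in open X]/((fun x => w k x - m x) @^-1` [set t | 0 < t]).
  apply: open_comp; last exact: open_gt.
  by move=> x _; apply: cvgB; [exact: cw|exact: cm].
have mA x : A x -> m x = 0.
  move=> Ax; have [k uk] := u_0 x Ax; have [l ml] := m_att x.
  apply/eqP; rewrite eq_le; apply/andP; split; first by rewrite -uk -wu.
  by rewrite ml; case/andP: (w01 l x).
have AD : A `<=` D.
  by move=> x Ax; have [k uk] := u_pos x Ax; exists k => //=; rewrite mA// subr0 wu.
pose a x := codist (~` A) x; pose d x := codist D x.
have ca : continuous a by exact: continuous_codist.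
have cd : continuous d by exact: continuous_codist.
have a0 x : A x -> a x = 0 by move=> Ax; rewrite /a codist_eq0// => /(_ Ax).
have ad x : 0 < a x + d x.
  have [Dx|nD] := pselect (D x).
    by rewrite ltr_wpDl ?codist_ge0// codist_open_gt0.
  rewrite ltr_pwDl ?codist_ge0// codist_open_gt0//; first exact: closed_openC.
  by move=> /AD.
pose A' := [set x | a x <= d x].
have A'D x : A' x -> D x.
  rewrite /A' /= => h; apply: (@codist_gt0 R X); rewrite -/(d x).
  by have := ad x; lra.
exists A', (fun k x => w k x - m x),
  (fun x => Num.max 0 (1 - 2 * (a x / (a x + d x)))); split.
- split; last by move=> x Ax; rewrite /A' /= a0// codist_ge0.
  rewrite (_ : A' = setT `&` (fun x => a x - d x) @^-1` [set t | t <= 0]).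
    apply: (closed_preimage_cts (@closedT _) _ (@closed_le _ 0)).
    by apply: ctsB; exact: continuous_cts.
  by apply/seteqP; split=> x; rewrite /A' /= subr_le0; [|case].
- split=> [k|k x _|x /A'D[k _ h]|x _].
  + by apply: ctsB; exact: continuous_cts.
  + have [l ml] := m_att x; have := m_le k x; have := w01 k x; have := w01 l x.
    by rewrite -ml => /andP[? ?] /andP[? ?] ?; apply/andP; split; lra.
  + by exists k.
  + by have [l ->] := m_att x; exists l; rewrite subrr.
- by move=> k x Ax; rewrite mA// subr0 wu.
split.
- apply: cts_continuous; apply: cts_max; first exact: cts_cst.
  apply: ctsB; first exact: cts_cst.
  apply: ctsM; first exact: cts_cst.
  apply: cts_div => [x _||]; first by rewrite gt_eqF.
    exact: continuous_cts.
  by apply: ctsD; exact: continuous_cts.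
- move=> x; have h : 0 <= a x / (a x + d x) by rewrite divr_ge0 ?codist_ge0// ltW.
  by rewrite le_max lexx /= ge_max ler01 /=; lra.
- by move=> x Ax; rewrite a0// mul0r mulr0 subr0; apply/max_idPr.
move=> x; rewrite lt_max ltxx /= subr_gt0 => h.
have {}h : a x / (a x + d x) < 2^-1 by lra.
by move: h; rewrite ltr_pdivrMr ?ad// /A' /=; lra.
Qed.

(** The product of two cocycles on a common refinement is a cocycle because the values commute
    modulo [N]. *)
Lemma extends_cocycleM (G : groupType) (V N : set G) z z' :
  is_subgroup V -> normal_subgroup N ->
  (forall x y, V x -> V y -> eqmod N (x * y)%g (y * x)%g) ->
  V z -> V z' ->
  extends_cocycle V N z -> extends_cocycle V N z' -> extends_cocycle V N (z * z')%g.
Proof.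
move=> hV nN VC Vz Vz' E E' A u clA cu; have [sN _] := nN.
have [A' [u' [lam [[clA' AA'] cu' u'u [clam lam01 lam1 lamA']]]]] := thicken clA cu.
have [J [p [c [hp pu p0 [Vc hc] cstd]]]] := E A' u' clA' cu'.
have [J' [p' [c' [hp' pu' p0' [Vc' hc'] cstd']]]] := E' A' u' clA' cu'.
pose K : choiceType := (('I_3 + J) * ('I_3 + J'))%type.
(* Over [A] only the three coordinates [u] may remain, which the product of two systems would
   violate. Hence the cutoff [lam]: where it is positive both systems have the same first three
   coordinates, and where it is below 1 the products take over. *)
pose q (m : 'I_3 + K) x := match m with
  | inl k => lam x * p (inl k) x
  | inr ab => (1 - lam x) * (p ab.1 x * p' ab.2 x) end.
pose r (m : 'I_3 + K) := match m with inl k => inl k | inr ab => ab.1 end.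
pose r' (m : 'I_3 + K) := match m with inl k => inl k | inr ab => ab.2 end.
have ge0 (L : choiceType) (s : L -> X -> R) (hs : psys setT s) i x : 0 <= s i x.
  exact: (psys_ge0 hs (i := i) (x := x) I).
have le1 (L : choiceType) (s : L -> X -> R) (hs : psys setT s) i x : s i x <= 1.
  exact: (psys_le1 hs (i := i) (x := x) I).
have gt0 (t : R) : 0 <= t -> (0 < t) = (t != 0) by move=> t0; rewrite lt_neqAle t0 andbT eq_sym.
have qr m x : 0 < q m x -> 0 < p (r m) x /\ 0 < p' (r' m) x.
  have /andP[l0 l1] := lam01 x; case: m => [k|[a b]] /=.
    move=> h; have lx : 0 < lam x.
      by rewrite gt0//; apply: contraTneq h => ->; rewrite mul0r ltxx.
    have pk : 0 < p (inl k) x.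
      by rewrite gt0 ?ge0//; apply: contraTneq h => ->; rewrite mulr0 ltxx.
    by split=> //; move: pk; rewrite pu ?pu'//; exact: lamA'.
  move=> h; rewrite !gt0 ?ge0//.
  by split; apply: contraTneq h => ->; rewrite ?mulr0 ?mul0r ?mulr0 ltxx.
exists K, q, (fun m n => (c (r m) (r n) * c' (r' m) (r' n))%g); split.
- split.
  + move=> [k|[a b]] /=; apply: ctsM.
    * exact: continuous_cts.
    * exact: psys_cts.
    * by apply: ctsB; [exact: cts_cst|exact: continuous_cts].
    * by apply: ctsM; exact: psys_cts.
  + move=> [k|[a b]] x _ /=; have /andP[l0 l1] := lam01 x.
      by rewrite mulr_ge0// ge0.
    by rewrite mulr_ge0 ?subr_ge0// mulr_ge0// ge0.
  + move=> [k|[a b]] x _ /=; have /andP[l0 l1] := lam01 x.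
      by rewrite mulr_ile1// ?ge0 ?le1.
    by rewrite mulr_ile1 ?subr_ge0 ?lerBlDr ?lerDl ?mulr_ile1// ?mulr_ge0 ?ge0 ?le1.
  + move=> x _; have [s sP] := psys_fin hp (I : setT x).
    have [s' sP'] := psys_fin hp' (I : setT x).
    exists ([seq inl k | k <- enum 'I_3] ++ [seq inr ab | ab <- [seq (a, b) | a <- s, b <- s']]).
    apply: filterS2 sP sP' => y h h' _ m /qr[h1 h2]; rewrite mem_cat.
    case: m h1 h2 => [k|[a b]] h1 h2; first by rewrite map_f// mem_enum.
    by rewrite [X in _ || X]map_f ?orbT//; apply/allpairsP; exists (a, b); split;
      [exact: h|exact: h'|].
  + move=> x _; have /andP[l0 l1] := lam01 x.
    have [a pa] := psys_cov hp (I : setT x); have [b pb] := psys_cov hp' (I : setT x).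
    have [lx|] := ltP 0 (lam x); last first.
      move=> lx; exists (inr (a, b)) => /=; rewrite mulr_gt0 ?mulr_gt0// subr_gt0.
      exact: le_lt_trans lx ltr01.
    have Ax := lamA' x lx; case: cu' => _ _ /(_ x Ax)[k uk] _.
    by exists (inl k) => /=; rewrite mulr_gt0// pu.
  + by move=> i t /(_ I).
- by move=> k x Ax /=; rewrite lam1// mul1r pu ?u'u//; exact: AA'.
- by move=> [a b] x Ax /=; rewrite lam1// subrr mul0r.
- split=> [a b|x a b d /qr[a1 a2] /qr[b1 b2] /qr[d1 d2]]; first exact: subgroupM.
  apply: (eqmod_trans sN _ (eqmodM nN (hc _ _ _ _ a1 b1 d1) (hc' _ _ _ _ a2 b2 d2))).
  rewrite -!mulgA; apply: eqmodM => //; first exact: eqmod_refl.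
  by rewrite !mulgA; apply: eqmodM => //; [exact: VC|exact: eqmod_refl].
move=> k l /=; apply: (eqmod_trans sN _ (eqmodM nN (cstd k l) (cstd' k l))).
rewrite /std; case: ifP => _; first exact: eqmod_refl.
case: ifP => _; last by rewrite mulg1; exact: eqmod_refl.
by rewrite invgM; apply: VC; exact: subgroupV.
Qed.

End CocycleExtension.

(** * Lifting a cocycle through a smaller normal subgroup *)

Section Step.
Variables (R : realType) (X : metricType R) (G : groupType).
Hypothesis dimX : covering_dim_le X 2.
Local Open Scope group_scope.

(** A cocycle modulo [M] satisfies the inverse law only modulo [M]. Keeping one orientation of each
    pair makes it exact, so over edges the relation holds in [G] itself and defects occur only on
    triangles. *)
Lemma antisymmetric_transitions (I : eqType) (c s : I -> I -> G) (E : pred I) :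
  (forall a b, s b a = (s a b)^-1) -> (forall a, s a a = 1) ->
  exists d : I -> I -> G, [/\ forall a b, d b a = (d a b)^-1, forall a, d a a = 1,
    forall a b, E a -> E b -> d a b = s a b &
    forall a b, ~~ (E a && E b) -> a != b -> d a b = c a b \/ d a b = (c b a)^-1].
Proof.
move=> sV s1; have [lt [lt_total _]] := well_founded_total I.
exists (fun a b => if E a && E b then s a b else if a == b then 1
  else if lt a b then c a b else (c b a)^-1); split.
- move=> a b; rewrite andbC; case: ifP => _ //; rewrite eq_sym.
  case: eqVneq => [_|ab]; first by rewrite invg1.
  by rewrite lt_total 1?eq_sym//; case: (lt a b); rewrite ?invgK.
- by move=> a; case: ifP => _ //; rewrite eqxx.
- by move=> a b -> ->.
by move=> a b /negbTE -> /negbTE ->; case: ifP => _; [left|right].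
Qed.

(* On a 2-dimensional system the defect of the cocycle condition on a triangle is
   an element of M; over the part of X mapped to that triangle it is absorbed by
   a cocycle extending the boundary circle map with this monodromy. *)
Lemma extends_cocycle_step (M N : set G) g : normal_subgroup M -> normal_subgroup N ->
  extends_cocycle X [set: G] M g ->
  (forall z, M z -> extends_cocycle X [set: G] N z) ->
  extends_cocycle X [set: G] N g.
Proof.
move=> nM nN EM EN A u clA cu; have [sM _] := nM; have [sN _] := nN.
have [J [p0 [c [hp0 p0u p00 [_ hc] cstd]]]] := EM A u clA cu.
pose I : choiceType := ('I_3 + J)%type.
have [p [hp pp0 ord3 pE]] := order_reduction dimX hp0.
have ge0 a x : (0 <= p a x)%R by exact: (psys_ge0 hp (i := a) (x := x) Logic.I).
have suppP a x : (a \in supp p x) = (0 < p a x)%R by rewrite (mem_supp _ hp Logic.I).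
(* Over [A] only the three coordinates of the circle map can be positive, so the reduction leaves
   them unchanged. *)
have pA a x : A x -> p a x = p0 a x.
  move=> Ax; apply: pE => //; apply: leq_trans (_ : (size (map (@inl _ J) (enum 'I_3)) <= 3)%N).
    apply: uniq_leq_size; first exact: supp_uniq.
    move=> b; rewrite (mem_supp _ hp0 Logic.I); case: b => [k|j].
      by move=> _; rewrite map_f// mem_enum.
    by rewrite p00// ltxx.
  by rewrite size_map size_enum_ord.
pose E (a : I) := if a is inl _ then true else false.
pose s (a b : I) := if a is inl k then if b is inl l then std g k l else 1 else 1.
have [d [dV d1 ds dc]] : exists d : I -> I -> G, [/\ forall a b, d b a = (d a b)^-1,
    forall a, d a a = 1, forall a b, E a -> E b -> d a b = s a b &
    forall a b, ~~ (E a && E b) -> a != b -> d a b = c a b \/ d a b = (c b a)^-1].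
  apply: antisymmetric_transitions.
    by move=> [k|j] [l|j'] /=; rewrite ?invg1// stdV.
  move=> [k|j] //=; rewrite /std; case: ifP => [/eqP[-> //]|_]; case: ifP => [/eqP[-> //]|//].
have caa a x : (0 < p a x)%R -> eqmod M 1 (c a a).
  move=> pa; have pa0 := pp0 _ _ Logic.I pa; have h := hc x a a a pa0 pa0 pa0.
  have := eqmodM nM (eqmod_refl (c a a)^-1 sM) h; rewrite mulKg mulVg.
  exact: eqmod_sym.
have dM x a b : (0 < p a x)%R -> (0 < p b x)%R -> eqmod M (d a b) (c a b).
  move=> pa pb; have pa0 := pp0 _ _ Logic.I pa; have pb0 := pp0 _ _ Logic.I pb.
  have [Eab|nE] := boolP (E a && E b).
    case/andP: Eab => Ea Eb; rewrite ds//; case: (a) Ea => // k _; case: (b) Eb => // l _.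
    exact: cstd.
  have [<-|ab] := eqVneq a b; first by rewrite d1; exact: caa pa.
  case: (dc a b nE ab) => ->; first exact: eqmod_refl.
  have h := eqmod_trans sM (hc x b a b pb0 pa0 pb0) (eqmod_sym sM (caa b x pb)).
  have := eqmodM nM (eqmod_refl (c b a)^-1 sM) h; rewrite mulKg mulg1.
  exact: eqmod_sym.
pose v (T : seq I) (k : 'I_3) := nth (inl ord0) T k.
pose z (T : seq I) := d (v T 0) (v T 1%R) * d (v T 1%R) (v T 2%:R) * d (v T 2%:R) (v T 0).
pose B (T : seq I) := fun x => exists2 k, k \in enum 'I_3 &
  (face [set: X] p T `&` p (v T k) @^-1` [set 0%R]) x.
have clB T : closed (B T).
  apply: closed_bigU_seq => k _; apply: closed_preimage_cts.
  - exact: closed_face.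
  - by apply: sub_cts (psys_cts hp (v T k)) => x _.
  - exact: closed_eq.
have memv (T : seq I) a : size T = 3%N -> a \in T ->
    v T (inord (index a T)) = a /\ (index a T < 3)%N.
  move=> sT aT; have iT : (index a T < 3)%N by rewrite -sT index_mem.
  by rewrite /v inordK// nth_index.
have vmem (T : seq I) k : size T = 3%N -> v T k \in T by move=> sT; rewrite mem_nth// sT.
have cB T : simplex [set: X] p T -> size T = 3%N ->
    circle_map (B T) (fun k => p (v T k)).
  move=> sT s3; split.
  - by move=> k; apply: sub_cts (psys_cts hp (v T k)) => x _.
  - by move=> k x _; rewrite ge0 (psys_le1 hp).
  - move=> x [k _ [[_ hx] _]]; have [a pa] := psys_cov hp (Logic.I : setT x).
    by have [va _] := memv T a s3 (hx a pa); exists (inord (index a T)); rewrite va.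
  - by move=> x [k _ [_ pk]]; exists k.
(* [T] is the support of a point, where the relations of [c] modulo [M] hold; the product around [T]
   is therefore trivial modulo [M]. *)
have zM T : simplex [set: X] p T -> size T = 3%N -> M (z T).
  move=> [x _ <-] s3; have pv k : (0 < p (v (supp p x) k) x)%R by rewrite -suppP vmem.
  pose c' k l := c (v (supp p x) k) (v (supp p x) l).
  have h1 := hc x _ _ _ (pp0 _ _ Logic.I (pv 0)) (pp0 _ _ Logic.I (pv 1%R)) (pp0 _ _ Logic.I (pv 2%:R)).
  have h2 := hc x _ _ _ (pp0 _ _ Logic.I (pv 0)) (pp0 _ _ Logic.I (pv 2%:R)) (pp0 _ _ Logic.I (pv 0)).
  have h3 := eqmod_trans sM (eqmodM nM h1 (eqmod_refl (c' 2%:R 0) sM)) h2.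
  have h4 := eqmod_trans sM h3 (eqmod_sym sM (caa _ _ (pv 0))).
  have h5 := eqmodM nM (eqmodM nM (dM x _ _ (pv 0) (pv 1%R)) (dM x _ _ (pv 1%R) (pv 2%:R)))
    (dM x _ _ (pv 2%:R) (pv 0)).
  have := subgroupV sM (eqmod_trans sM h5 h4).
  by rewrite mulg1 invgK.
have /choice[D DP] : forall T : seq I, exists D : {J : choiceType &
    (('I_3 + J -> X -> R) * ('I_3 + J -> 'I_3 + J -> G))%type},
    simplex [set: X] p T -> size T = 3%N ->
    [/\ psys [set: X] (projT2 D).1, forall k x, B T x -> (projT2 D).1 (inl k) x = p (v T k) x,
    forall j x, B T x -> (projT2 D).1 (inr j) x = 0%R,
    cocycle_on [set: G] N (projT2 D).1 (projT2 D).2 &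
    forall k l, eqmod N (std (z T) k l) ((projT2 D).2 (inl k) (inl l))].
  move=> T; have [sT|] := pselect (simplex [set: X] p T); last first.
    by exists (existT _ J (p0, c)).
  have [s3|] := pselect (size T = 3%N); last by exists (existT _ J (p0, c)).
  have [J' [q [e H]]] := EN _ (zM T sT s3) _ _ (clB T) (cB T sT s3).
  by exists (existT _ J' (q, e)).
pose J_ T : choiceType := projT1 (D T).
pose q T : 'I_3 + J_ T -> X -> R := (projT2 (D T)).1.
pose e T : 'I_3 + J_ T -> 'I_3 + J_ T -> G := (projT2 (D T)).2.
pose S : choiceType := {T : seq I & J_ T}.
pose W : choiceType := (I + S)%type.
pose loc T (w : W) : 'I_3 + J_ T := match w with
  | inl a => inl (inord (index a T)) | inr t => untag (inl ord0) (fun j => inr j) t end.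
(* Change of frame: the product of [d] along the edges from the first vertex of [T]. Conjugating
   [std (z T)] by it returns [d] on all three edges. *)
pose tw T (w : W) : G := match w with
  | inl a => match index a T with 0%N => 1 | 1%N => d (v T 0) (v T 1%R)
             | _ => d (v T 0) (v T 1%R) * d (v T 1%R) (v T 2%:R) end
  | inr _ => 1 end.
(* Over a triangle the system [p] is replaced by the local one of [DP]. They agree over the
   boundary, where the local system has the coordinates of [p] and its new coordinates vanish. *)
pose h (w : W) (T : seq I) x : R := match w with
  | inl a => if size T == 3%N then (if a \in T then q T (loc T w) x else 0%R) else p a x
  | inr t => if (T == tag t) && (size T == 3%N) then q T (loc T w) x else 0%R end.
pose P w x := h w (supp p x) x.
pose f (w w' : W) : G := match w, w' with
  | inl a, inl b => d a b
  | inr t, _ => (tw (tag t) w)^-1 * e (tag t) (loc (tag t) w) (loc (tag t) w') * tw (tag t) w'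
  | _, inr t => (tw (tag t) w)^-1 * e (tag t) (loc (tag t) w) (loc (tag t) w') * tw (tag t) w'
  end.
pose toW (m : 'I_3 + (J + S)) : W := match m with
  | inl k => inl (inl k) | inr (inl j) => inl (inr j) | inr (inr t) => inr t end.
pose ofW (w : W) : 'I_3 + (J + S) := match w with
  | inl (inl k) => inl k | inl (inr j) => inr (inl j) | inr t => inr (inr t) end.
pose inT (T : seq I) (w : W) : Prop :=
  match w with inl a => a \in T | inr t => tag t = T end.
have ofWK : cancel ofW toW by case=> [[]|].
have qE T w x : simplex [set: X] p T -> face [set: X] p T x -> supp p x != T ->
    h w T x = h w (supp p x) x.
  move=> sT fx sx; have sz := supp_proper hp sT fx sx.
  have [x0 _ s0] := sT; have s3 : (size T <= 3)%N by rewrite -s0; exact: ord3.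
  have szn : size (supp p x) == 3%N = false by rewrite ltn_eqF// (leq_trans sz).
  rewrite /h szn; case: w => [a|t]; last first.
    rewrite andbF; case: ifP => // /andP[/eqP Tt /eqP sT3].
    have Bx : B T x.
      have /allPn[b bT nb] : ~~ all (mem (supp p x)) T.
        apply/negP => /allP sub; have := uniq_leq_size _ sub.
        by rewrite leqNgt sz -s0 supp_uniq => /(_ isT).
      have [vb _] := memv T b sT3 bT; exists (inord (index b T)); first by rewrite mem_enum.
      by split=> //=; rewrite vb; apply: (psys_eq0 hp) => //; rewrite -suppP.
    have [_ _ q0 _ _] := DP T sT sT3.
    by rewrite /loc /= (untagE _ _ (esym Tt)); exact: q0.
  case: ifP => // /eqP sT3; have Bx : B T x.
    have /allPn[b bT nb] : ~~ all (mem (supp p x)) T.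
      apply/negP => /allP sub; have := uniq_leq_size _ sub.
      by rewrite leqNgt sz -s0 supp_uniq => /(_ isT).
    have [vb _] := memv T b sT3 bT; exists (inord (index b T)); first by rewrite mem_enum.
    by split=> //=; rewrite vb; apply: (psys_eq0 hp) => //; rewrite -suppP.
  have [_ qv _ _ _] := DP T sT sT3.
  case: ifPn => aT; last by apply/esym/(psys_eq0 hp) => //; apply: contra aT => /(proj2 fx).
  by rewrite /loc /q qv//; have [-> _] := memv T a sT3 aT.
have ch w T : simplex [set: X] p T -> cts (face [set: X] p T) (h w T).
  move=> sT; have [s3|s3] := eqVneq (size T) 3%N; last first.
    case: w => [a|t]; rewrite /h ?(negbTE s3) ?andbF; last exact: cts_cst.
    by apply: sub_cts (psys_cts hp a) => x.
  have [hq _ _ _ _] := DP T sT s3; rewrite /h s3 eqxx.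
  case: w => [a|t].
    case: (a \in T); last exact: cts_cst.
    by apply: sub_cts (psys_cts hq _) => x.
  case: (T == tag t); last exact: cts_cst.
  by apply: sub_cts (psys_cts hq _) => x.
have cP w : cts [set: X] (P w).
  by apply: (glue_faces hp) => T; [exact: ch|move=> x; exact: qE].
have simp x : simplex [set: X] p (supp p x) by exists x.
have P3 w x : size (supp p x) = 3%N -> P w x = 0%R \/ [/\ P w x = q (supp p x) (loc (supp p x) w) x &
    inT (supp p x) w].
  move=> s3; rewrite /P /h s3 eqxx; case: w => [a|t].
    by case: ifP => aT; [right|left].
  by rewrite andbT; case: eqP => [->|_]; [right|left].
have Pn w x : size (supp p x) != 3%N -> P w x = match w with inl a => p a x | inr _ => 0%R end.
  by move=> s3; rewrite /P /h (negbTE s3); case: w => // t; rewrite andbF.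
have P01 w x : (0 <= P w x <= 1)%R.
  have [s3|s3] := eqVneq (size (supp p x)) 3%N; last first.
    rewrite Pn//; case: w => [a|_]; last by rewrite lexx ler01.
    by rewrite ge0 (psys_le1 hp).
  have [hq _ _ _ _] := DP _ (simp x) s3.
  case: (P3 w x s3) => [->|[-> _]]; first by rewrite lexx ler01.
  by rewrite (psys_ge0 hq)// (psys_le1 hq).
have fE T (w w' : W) : simplex [set: X] p T -> size T = 3%N ->
    inT T w -> inT T w' ->
    eqmod N (f w w') ((tw T w)^-1 * e T (loc T w) (loc T w') * tw T w').
  move=> sT s3; have [_ _ _ _ estd] := DP T sT s3.
  case: w => [a|t] hw; last by rewrite /f -(hw : tag t = T) => _; exact: (eqmod_refl _ sN).
  case: w' => [b|t'] hw'; last by rewrite /f -(hw' : tag t' = T); exact: (eqmod_refl _ sN).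
  have [va ia] := memv T a s3 hw; have [vb ib] := memv T b s3 hw'.
  have h1 := eqmodM nN (eqmodM nN (eqmod_refl (tw T (inl a))^-1 sN)
    (estd (inord (index a T)) (inord (index b T)))) (eqmod_refl (tw T (inl b)) sN).
  apply: (eqmod_trans sN _ h1); rewrite /= -{1}va -{1}vb.
  suff -> : d (v T (inord (index a T))) (v T (inord (index b T))) =
    (tw T (inl a))^-1 * std (z T) (inord (index a T)) (inord (index b T)) * tw T (inl b).
    exact: eqmod_refl.
  rewrite /tw /z.
  have v0 : (inord 0 : 'I_3) = 0%R by apply/val_inj; rewrite /= inordK.
  have v1 : (inord 1 : 'I_3) = 1%R by apply/val_inj; rewrite /= inordK.
  have v2 : (inord 2 : 'I_3) = 2%:R%R by apply/val_inj; rewrite /= inordK.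
  case: (index a T) ia => [|[|[|//]]] _; case: (index b T) ib => [|[|[|//]]] _ /=;
    rewrite ?v0 ?v1 ?v2 /std /= ?d1 ?invg1 ?mulg1 ?mul1g ?mulVg ?invgM ?mulgA//.
  - by rewrite !mulgVK -dV.
  - by rewrite mulVg mul1g.
  - by rewrite mulgVK mulVg mul1g.
  - by rewrite mulgVK dV.
(* A circle map has a vanishing coordinate, so [A] meets no open triangle and keeps its original
   coordinates. *)
have s3A x : A x -> size (supp p x) != 3%N.
  move=> Ax; have [_ _ _ /(_ x Ax)[k uk]] := cu; rewrite ltn_eqF// ltnS.
  apply: (@leq_trans (size [seq inl l : I | l <- rem k (enum 'I_3)])); last first.
    by rewrite size_map size_rem ?mem_enum// size_enum_ord.
  apply: uniq_leq_size; first exact: supp_uniq.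
  move=> b; rewrite suppP pA//; case: b => [l|j]; last by rewrite p00// ltxx.
  rewrite p0u// => ul; apply: map_f; rewrite mem_rem_uniq ?enum_uniq// inE mem_enum andbT.
  by apply: contraTneq ul => ->; rewrite uk ltxx.
exists (J + S)%type, (fun m => P (toW m)), (fun m n => f (toW m) (toW n)); split.
- split.
  + by move=> m; exact: cP.
  + by move=> m x _; case/andP: (P01 (toW m) x).
  + by move=> m x _; case/andP: (P01 (toW m) x).
  + move=> x _; have [s0 s0P] := psys_fin hp (Logic.I : setT x).
    have [L LP Lsub] := face_simplices [set: X] p s0.
    have fin T : exists sq : seq ('I_3 + J_ T), simplex [set: X] p T -> size T = 3%N ->
        \forall y \near x, forall m, (0 < q T m y)%R -> m \in sq.
      have [sT|] := pselect (simplex [set: X] p T); last by exists [::].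
      have [s3|] := pselect (size T = 3%N); last by exists [::].
      have [hq _ _ _ _] := DP T sT s3; have [sq sqP] := psys_fin hq (Logic.I : setT x).
      by exists sq => _ _; apply: filterS sqP => y; apply.
    pose sq T := projT1 (cid (fin T)).
    pose js T : seq (J_ T) := pmap (fun m : 'I_3 + J_ T => if m is inr j then Some j else None) (sq T).
    exists ([seq ofW (inl a) | a <- s0] ++
      flatten [seq [seq ofW (inr (Tagged J_ j)) | j <- js T] | T <- L]).
    have near2 : \forall y \near x, forall T, T \in L -> size T = 3%N ->
        forall m, (0 < q T m y)%R -> m \in sq T.
      elim: (L) LP => [|T L' IH] LP; first by apply: filterE.
      have sT := LP T (mem_head _ _).
      have [s3|s3] := pselect (size T = 3%N).
        have h1 := projT2 (cid (fin T)) sT s3.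
        have h2 : \forall y \near x, forall T, T \in L' -> size T = 3%N ->
            forall m, (0 < q T m y)%R -> m \in sq T.
          by apply: IH => T' T'L; apply: LP; rewrite inE T'L orbT.
        by apply: filterS2 h1 h2 => y k1 k2 T'; rewrite inE => /predU1P[->|/k2].
      have h2 : \forall y \near x, forall T, T \in L' -> size T = 3%N ->
          forall m, (0 < q T m y)%R -> m \in sq T.
        by apply: IH => T' T'L; apply: LP; rewrite inE T'L orbT.
      by apply: filterS h2 => y k2 T'; rewrite inE => /predU1P[->|/k2].
    apply: filterS2 s0P near2 => y y1 y2 _ m; rewrite mem_cat.
    have sub a : a \in supp p y -> a \in s0 by rewrite suppP; exact: y1.
    have mE : m = ofW (toW m) by case: (m) => [k|[j|t]].
    rewrite {2 3}mE; move: (toW m) => w pw; apply/orP.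
    have [s3|s3] := eqVneq (size (supp p y)) 3%N; last first.
      left; move: pw; rewrite Pn//; case: w => [a pa|t]; last by rewrite ltxx.
      by apply: map_f; apply: sub; rewrite suppP.
    case: (P3 w y s3) pw => [->|[-> hw]]; first by rewrite ltxx.
    case: w hw => [a /= aT _|t /= tT qt]; [left; apply: map_f; exact: sub|right].
    have TL : supp p y \in L by apply: Lsub; split=> // a; exact: y1.
    apply/flattenP; exists [seq ofW (inr (Tagged J_ j)) | j <- js (supp p y)].
      exact: map_f.
    move: qt; rewrite /loc (untagE _ _ tT) => /(y2 _ TL s3) jq.
    apply/mapP; exists (etagged tT); last by congr (ofW (inr _)); exact/esym/etaggedK.
    by rewrite mem_pmap; apply/mapP; exists (inr (etagged tT)).
  + move=> x _; have [s3|s3] := eqVneq (size (supp p x)) 3%N; last first.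
      have [a pa] := psys_cov hp (Logic.I : setT x).
      by exists (ofW (inl a)); rewrite ofWK Pn.
    have [hq _ _ _ _] := DP _ (simp x) s3.
    have [m qm] := psys_cov hq (Logic.I : setT x).
    case: m qm => [k|j] qk.
      have aT := vmem (supp p x) k s3.
      exists (ofW (inl (v (supp p x) k))); rewrite ofWK /P /h s3 eqxx aT /loc.
      have -> : inord (index (v (supp p x) k) (supp p x)) = k.
        by apply/val_inj; rewrite /= /v index_uniq ?supp_uniq ?s3// inordK.
      exact: qk.
    exists (ofW (inr (Tagged J_ j))); rewrite ofWK /P /h s3 /= !eqxx /=.
    suff : (0 < q (supp p x) (loc (supp p x) (inr (Tagged (fun T => J_ T) j))) x)%R by [].
    suff -> : loc (supp p x) (inr (Tagged (fun T => J_ T) j)) = inr j by [].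
    by rewrite /loc /untag; case: eqP => // e0; congr inr; rewrite /etagged (eq_axiomK e0).
  + by move=> m x /(_ Logic.I).
- by move=> k x Ax; rewrite Pn ?s3A//= pA// p0u.
- by move=> [j|t] x Ax; rewrite Pn ?s3A//= pA// p00.
- split=> // x m1 m2 m3.
  move: (toW m1) (toW m2) (toW m3) => w1 w2 w3 {m1 m2 m3}.
  have [s3|s3] := eqVneq (size (supp p x)) 3%N.
    have [_ _ _ [_ ec] _] := DP _ (simp x) s3.
    have pos w : (0 < P w x)%R -> (0 < q (supp p x) (loc (supp p x) w) x)%R /\
        inT (supp p x) w.
      by case: (P3 w x s3) => [->|[-> ?]//]; rewrite ltxx.
    move=> /pos[q1 h1] /pos[q2 h2] /pos[q3 h3].
    have f12 := fE _ _ _ (simp x) s3 h1 h2; have f23 := fE _ _ _ (simp x) s3 h2 h3.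
    have f13 := fE _ _ _ (simp x) s3 h1 h3.
    apply: (eqmod_trans sN (eqmodM nN f12 f23)); apply: (eqmod_trans sN _ (eqmod_sym sN f13)).
    set t1 := tw _ w1; set t2 := tw _ w2; set t3 := tw _ w3.
    rewrite -!mulgA mulVKg; apply: (eqmodM nN (eqmod_refl _ sN)).
    rewrite mulgA; apply: (eqmodM nN _ (eqmod_refl _ sN)).
    exact: ec q1 q2 q3.
  (* With at most two vertices, two of the three indices coincide, and the relation reduces to
     [d a a = 1] or to antisymmetry. *)
  have s2 : (size (supp p x) <= 2)%N by have := ord3 x Logic.I; rewrite leq_eqVlt (negbTE s3).
  rewrite !Pn//; case: w1 => [a|]; rewrite ?ltxx//; case: w2 => [b|]; rewrite ?ltxx//.
  case: w3 => [b'|]; rewrite ?ltxx//; rewrite -!suppP => a1 b1 b2 /=.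
  have [->|ab] := eqVneq a b; first by rewrite d1 mul1g; exact: eqmod_refl.
  have [->|bb] := eqVneq b b'; first by rewrite d1 mulg1; exact: eqmod_refl.
  have [->|ab'] := eqVneq a b'; first by rewrite d1 (dV b b') mulVg; exact: eqmod_refl.
  have : uniq [:: a; b; b'] by rewrite /= !inE negb_or ab ab' bb.
  move=> /uniq_leq_size -/(_ (supp p x)) /=; rewrite leqNgt ltnS s2 => /(_ _)/negP.
  by case=> // i; rewrite !inE => /or3P[]/eqP->.
move=> k l /=; rewrite ds//; exact: eqmod_refl.
Qed.

End Step.

(** * The lower central series and its layers *)

Section LowerCentralSeries.
Local Open Scope group_scope.
Variable G : groupType.
Implicit Types (H K N : set G) (x y z a b : G).

Lemma generated_subgroup H : is_subgroup (generated H).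
Proof.
split=> [A [[A1 _] _] //|x y gx gy A hA].
by have [[_ AF] _] := hA; apply: AF; [exact: gx|exact: gy].
Qed.

Lemma generated_min H K : is_subgroup K -> H `<=` K -> generated H `<=` K.
Proof. by move=> sK HK x; apply; split. Qed.

Lemma mem_generated H x : H x -> generated H x.
Proof. by move=> Hx A [_ HA]; exact: HA. Qed.

Lemma mem_commutator H K x y : H x -> K y -> commutator H K [~ x, y].
Proof. by move=> Hx Ky; apply: mem_generated; exists x => //; exists y. Qed.

Lemma conj_commg x y z : [~ x, y] ^ z = [~ x ^ z, y ^ z].
Proof. by rewrite !commgEl conjMg conjVg -!conjgM -conjgC. Qed.

Lemma normal_commutatorT H : normal_subgroup H ->
  normal_subgroup (commutator H [set: G]).
Proof.
move=> [sH nH]; split; first exact: generated_subgroup.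
move=> x y cx; suff : commutator H [set: G] `<=` [set t | commutator H [set: G] (t ^ y)].
  exact.
apply: generated_min => [|t [a Ha [b _ ->]] /=]; last first.
  by rewrite conj_commg; apply: mem_commutator => //; exact: nH.
split=> [|s t /= hs ht]; first by rewrite /= conj1g; exact: (proj1 (generated_subgroup _)).
by rewrite conjMg conjVg; apply: (proj2 (generated_subgroup _)).
Qed.

Local Notation L := (lower_central_series (G := G)).

Lemma normal_lower n : normal_subgroup (L n).
Proof. by elim: n => [//|n IH]; exact: normal_commutatorT. Qed.

Lemma lower_sub n : L n.+1 `<=` L n.
Proof.
apply: generated_min; first by case: (normal_lower n).
move=> x [a La [b _ ->]]; have [sL nL] := normal_lower n.
by rewrite commgEl; apply: subgroupM => //; [exact: subgroupV|exact: nL].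
Qed.

Lemma eqmod_lower_comm n x y : L n x -> eqmod (L n.+1) (x * y) (y * x).
Proof.
move=> Lx; rewrite /eqmod invgM.
have -> : y^-1 * x^-1 * (y * x) = [~ x, y]^-1 ^ 1.
  by rewrite conjg1 /commg /conjg !invgM !invgK !mulgA.
have [sL nL] := normal_lower n.+1; apply: nL; apply: (subgroupV sL).
exact: mem_commutator.
Qed.

(** From the identity [a,xy] = [a,y] [a,x] [[a,x],y]: the double commutator lies in [L n.+2], modulo
    which the other two factors commute. *)
Lemma eqmod_commgM n a x y : L n a ->
  eqmod (L n.+2) [~ a, x * y] ([~ a, x] * [~ a, y]).
Proof.
move=> La; have [sL nL] := normal_lower n.+2.
have -> : [~ a, x * y] = [~ a, y] * ([~ a, x] * [~ [~ a, x], y]).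
  by rewrite (commgEl [~ a, x] y) mulVKg /commg /conjg !invgM !mulgA !mulgK.
have h : eqmod (L n.+2) 1 [~ [~ a, x], y].
  by rewrite /eqmod invg1 mul1g; apply: mem_commutator => //; exact: mem_commutator.
have h2 := eqmodM (conj sL nL) (eqmod_refl ([~ a, y] * [~ a, x]) sL) (eqmod_sym sL h).
rewrite mulg1 -mulgA in h2; apply: (eqmod_trans sL h2).
by apply: eqmod_lower_comm; exact: mem_commutator.
Qed.

(** Modulo [L n.+2], commutation with [a] is a homomorphism into the abelian group L_(n+1)/L_(n+2),
    hence kills commutators. *)
Lemma commg_derived n a d : L n a -> L 1 d -> L n.+2 [~ a, d].
Proof.
move=> La; have nL := normal_lower n.+2; have [sL _] := nL.
have phiV x : eqmod (L n.+2) [~ a, x]^-1 [~ a, x^-1].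
  have := eqmod_commgM x x^-1 La; rewrite mulgV commg1 => h.
  have := eqmodM nL (eqmod_refl [~ a, x]^-1 sL) h.
  by rewrite mulg1 mulKg.
have one x : L n.+2 x <-> eqmod (L n.+2) 1 x by rewrite /eqmod invg1 mul1g.
suff sub : L 1 `<=` [set t | L n.+2 [~ a, t]] by move/sub.
apply: generated_min => [|t [x _ [y _ ->]] /=].
  split=> [|x y /= /one hx /one hy]; first by rewrite /= commg1; exact: subgroup1.
  apply/one; apply: (eqmod_trans sL _ (eqmod_sym sL (eqmod_commgM _ _ La))).
  have := eqmodM nL hx (eqmod_trans sL (eqmodV nL hy) (phiV y)).
  by rewrite invg1 mulg1.
apply/one.
have E : [~ x, y] = (x^-1 * y^-1) * (x * y) by rewrite /commg /conjg !mulgA.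
rewrite E; apply: (eqmod_trans sL _ (eqmod_sym sL (eqmod_commgM _ _ La))).
have h1 := eqmod_trans sL (eqmod_commgM x^-1 y^-1 La)
  (eqmodM nL (eqmod_sym sL (phiV x)) (eqmod_sym sL (phiV y))).
have h2 := eqmodM nL h1 (eqmod_commgM x y La).
apply: (eqmod_trans sL _ (eqmod_sym sL h2)).
have h3 : eqmod (L n.+2) ([~ a, x]^-1 * [~ a, y]^-1 * ([~ a, y] * [~ a, x]))
    ([~ a, x]^-1 * [~ a, y]^-1 * ([~ a, x] * [~ a, y])).
  by apply: (eqmodM nL); [exact: eqmod_refl|apply: eqmod_lower_comm; exact: mem_commutator].
by rewrite [X in eqmod _ X _]mulgA mulgVK mulVg in h3.
Qed.

End LowerCentralSeries.

Section Nilpotent.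
Variables (R : realType) (X : metricType R) (G : groupType).
Hypothesis dimX : covering_dim_le X 2.
Local Open Scope group_scope.
Local Notation L := (lower_central_series (G := G)).
Local Notation E V N := (extends_cocycle X V N).

Hypothesis Eab : forall g : G, E [set: G] (L 1) g.

(** Monodromy [a,b] is the image of [b] under commutation with [a]; the generated subgroup is
    reached by products, and by inversion, which is a homomorphism modulo [L n.+2]. Values are kept
    in [L n.+1] because multiplying cocycles requires them to commute. *)
Lemma extends_cocycle_layer n z : L n.+1 z -> E (L n.+1) (L n.+2) z.
Proof.
have nL1 := normal_lower G n.+1; have nL2 := normal_lower G n.+2.
have [[sL1 _] [sL2 _]] := (nL1, nL2).
have comm x y : L n.+1 x -> L n.+1 y -> eqmod (L n.+2) (x * y) (y * x).
  by move=> Lx _; exact: eqmod_lower_comm.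
suff sub : L n.+1 `<=` [set z | L n.+1 z /\ E (L n.+1) (L n.+2) z] by move/sub => [].
apply: generated_min => [|t [a La [b _ ->]] /=]; last first.
  split; first exact: mem_commutator.
  apply: (extends_cocycle_mor (phi := fun x => [~ a, x]) (full_subgroup G) nL2 _ _ _ _ (Eab b)) => //.
  - by move=> x _; exact: mem_commutator.
  - by move=> x y _ _; exact: eqmod_commgM.
  - move=> x y _ _ xy; rewrite -[y](mulVKg x).
    apply: (eqmod_trans sL2 _ (eqmod_sym sL2 (eqmod_commgM _ _ La))).
    rewrite -{1}[[~ a, x]]mulg1; apply: (eqmodM nL2); first exact: eqmod_refl.
    by rewrite /eqmod invg1 mul1g; exact: commg_derived.
split=> [|x y [Lx Ex] [Ly Ey]].
  split; first exact: (subgroup1 sL1).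
  apply: (extends_cocycle_mor (phi := fun=> 1) (full_subgroup G) nL2 _ _ _ _ (Eab 1)) => //.
  - by move=> _ _; exact: (subgroup1 sL1).
  - by move=> _ _ _ _; rewrite mulg1; exact: eqmod_refl.
  - by move=> _ _ _ _ _; exact: eqmod_refl.
have LyV := subgroupV sL1 Ly; split; first exact: (subgroupM sL1).
apply: extends_cocycleM => //.
apply: (extends_cocycle_mor (phi := fun x => x^-1) sL1 nL2 _ _ _ _ Ey) => //.
- by move=> t; exact: (subgroupV sL1).
- move=> s t Ls Lt; rewrite invgM; apply: comm; exact: (subgroupV sL1).
- by move=> s t _ _; exact: eqmodV.
Qed.

Lemma extends_cocycle_lower n g : E [set: G] (L n.+1) g.
Proof.
elim: n g => [//|n IH] g.
have nL1 := normal_lower G n.+1; have nL2 := normal_lower G n.+2.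
apply: (extends_cocycle_step dimX nL1 nL2 (IH g)) => z Lz.
have [sL1 _] := nL1; have [sL2 _] := nL2.
apply: (extends_cocycle_mor (phi := id) sL1 nL2 _ _ _ Lz (extends_cocycle_layer Lz)) => //.
by move=> x y _ _; exact: eqmod_refl.
Qed.

Lemma extends_cocycle_nilpotent g : nilpotent_group G -> E [set: G] [set 1] g.
Proof.
(* One step beyond the given [n], because [n] may be 0 while the induction starts at [L 1]. *)
move=> [n Ln]; have L1 : L n.+1 = [set 1].
  apply/seteqP; split=> [x /lower_sub|_ ->]; first by rewrite Ln.
  by case: (normal_lower G n.+1) => -[].
by rewrite -L1; exact: extends_cocycle_lower.
Qed.

End Nilpotent.

(** * Paths and holonomy *)

Section Paths.
Variables (R : realType) (K : topologicalType).
Implicit Types (f g h : R -> K) (a b c d : K).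

Definition is_path f a b := [/\ cts itv01 f, f 0 = a & f 1 = b].

Definition square : set (R * R) := [set st | itv01 st.1 /\ itv01 st.2].

Definition homotopy (H : R * R -> K) f g := [/\ cts square H,
  forall t, itv01 t -> H (0, t) = f t, forall t, itv01 t -> H (1, t) = g t,
  forall s, itv01 s -> H (s, 0) = f 0 & forall s, itv01 s -> H (s, 1) = f 1].

Definition hpath f g := exists H, homotopy H f g.

Lemma itv01_0 : @itv01 R 0. Proof. by rewrite /itv01 /= lexx ler01. Qed.
Lemma itv01_1 : @itv01 R 1. Proof. by rewrite /itv01 /= lexx ler01. Qed.
Hint Resolve itv01_0 itv01_1 : core.

Lemma closed_itv01 : closed (@itv01 R).
Proof.
rewrite (_ : itv01 = [set t : R | 0 <= t] `&` [set t | t <= 1]).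
  by apply: closedI; [exact: closed_ge|exact: closed_le].
by apply/seteqP; split=> t /=; [move=> /andP[]|move=> [? ?]; apply/andP].
Qed.

Lemma cts_fst (A : set (R * R)) : cts A fst.
Proof. by apply: continuous_cts => x; exact: cvg_fst. Qed.

Lemma cts_snd (A : set (R * R)) : cts A snd.
Proof. by apply: continuous_cts => x; exact: cvg_snd. Qed.

Lemma closed_square : closed square.
Proof.
rewrite (_ : square = (setT `&` fst @^-1` itv01) `&` (setT `&` snd @^-1` itv01)).
  apply: closedI; apply: closed_preimage_cts; first exact: closedT.
  - exact: cts_fst.
  - exact: closed_itv01.
  - exact: closedT.
  - exact: cts_snd.
  - exact: closed_itv01.
by apply/seteqP; split=> -[s t] /=; [move=> []|move=> [[_ ?] [_ ?]]].
Qed.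

Lemma hpath_ends f g : hpath f g -> f 0 = g 0 /\ f 1 = g 1.
Proof.
by move=> [H [_ _ H1 e0 e1]]; rewrite -(H1 0 itv01_0) -(H1 1 itv01_1) e0 ?e1.
Qed.

Lemma eq_hpath f g : cts itv01 f -> (forall t, itv01 t -> f t = g t) -> hpath f g.
Proof.
move=> cf fg; exists (fun st : R * R => f st.2); split=> //=.
apply: (cts_comp (g := f) (f := snd) (B := itv01)) => //; first by move=> x [].
exact: cts_snd.
Qed.

Lemma hpath_sym f g : hpath f g -> hpath g f.
Proof.
move=> fg; have [f0 f1] := hpath_ends fg; have [H [cH h0 h1 e0 e1]] := fg.
exists (fun st : R * R => H (1 - st.1, st.2)); split=> /=.
- apply: (cts_comp (g := H) (f := fun st : R * R => (1 - st.1, st.2)) (B := square)) => //.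
    by move=> [s t] [/= s01 t01]; split=> //=; move: s01; rewrite /itv01 /=; lra.
  by apply: cts_pair; [apply: ctsB; [exact: cts_cst|exact: cts_fst]|exact: cts_snd].
- by move=> t t01; rewrite subr0 h1.
- by move=> t t01; rewrite subrr h0.
- by move=> s s01; rewrite e0// /itv01 /=; move: s01; rewrite /itv01 /=; lra.
- by move=> s s01; rewrite e1// /itv01 /=; move: s01; rewrite /itv01 /=; lra.
Qed.

Lemma hpath_trans g f h : hpath f g -> hpath g h -> hpath f h.
Proof.
move=> fg; have [f0 f1] := hpath_ends fg; move: fg.
move=> [H [cH h0 h1 e0 e1]] [H' [cH' h0' h1' e0' e1']].
exists (fun st : R * R => if st.1 <= 2^-1 then H (2 * st.1, st.2) else H' (2 * st.1 - 1, st.2)).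
split=> /=.
- apply: (cts_if (f := fst) (F := fun st : R * R => H (2 * st.1, st.2))
    (G := fun st : R * R => H' (2 * st.1 - 1, st.2))); first exact: closed_square.
  + exact: cts_fst.
  + apply: (cts_comp (g := H) (f := fun st : R * R => (2 * st.1, st.2)) (B := square)) => //.
      by move=> [s t] [[/= /andP[? ?] t01] /= ?]; split=> //=; rewrite /itv01 /=; lra.
    apply: cts_pair; last exact: cts_snd.
    by apply: ctsM; [exact: cts_cst|exact: cts_fst].
  + apply: (cts_comp (g := H') (f := fun st : R * R => (2 * st.1 - 1, st.2)) (B := square)) => //.
      by move=> [s t] [[/= /andP[? ?] t01] /= ?]; split=> //=; rewrite /itv01 /=; lra.
    apply: cts_pair; last exact: cts_snd.
    apply: ctsB; last exact: cts_cst.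
    by apply: ctsM; [exact: cts_cst|exact: cts_fst].
  + move=> [s t] [/= _ t01] ->.
    by rewrite divff ?pnatr_eq0// subrr h1// h0'.
- by move=> t t01; rewrite ifT ?mulr0 ?h0//; lra.
- move=> t t01; rewrite ifF; last by apply/negbTE; rewrite -ltNge; lra.
  by rewrite (_ : 2 * 1 - 1 = 1) ?h1'//; lra.
- move=> s /andP[? ?]; case: ifPn => [?|]; first by rewrite e0// /itv01 /=; lra.
  by rewrite -ltNge f0 => ?; rewrite e0'// /itv01 /=; lra.
- move=> s /andP[? ?]; case: ifPn => [?|]; first by rewrite e1// /itv01 /=; lra.
  by rewrite -ltNge f1 => ?; rewrite e1'// /itv01 /=; lra.
Qed.

Lemma cts_hpathr f g : hpath f g -> cts itv01 g.
Proof.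
move=> [H [cH _ h1 _ _]].
have c : cts itv01 (fun t => H (1, t)).
  apply: (cts_comp (g := H) (f := fun t : R => (1, t)) (B := square)) => //.
  by apply: cts_pair; [exact: cts_cst|exact: cts_id].
by apply: eq_cts c => t /h1.
Qed.

(** The parameters are joined linearly. Associativity, units and inverses of paths are all
    instances, each comparing two reparametrizations of one path. *)
Lemma hpath_reparam (Phi : R -> K) (u v : R -> R) (lo hi : R) :
  cts [set t | lo <= t <= hi] Phi -> cts itv01 u -> cts itv01 v ->
  (forall t, itv01 t -> lo <= u t <= hi) -> (forall t, itv01 t -> lo <= v t <= hi) ->
  u 0 = v 0 -> u 1 = v 1 -> hpath (Phi \o u) (Phi \o v).
Proof.
move=> cP cu cv u01 v01 e0 e1.
exists (fun st : R * R => Phi ((1 - st.1) * u st.2 + st.1 * v st.2)); split=> /=.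
- apply: (cts_comp (g := Phi) (f := fun st : R * R => (1 - st.1) * u st.2 + st.1 * v st.2)
    (B := [set t | lo <= t <= hi])) => //.
    move=> [s t] [/= /andP[? ?] /[dup] /u01/andP[? ?] /v01/andP[? ?]].
    by apply/andP; split; nra.
  have c w : cts itv01 w -> cts square (fun st : R * R => w st.2).
    move=> cw; apply: (cts_comp (g := w) (f := snd) (B := itv01)) => //; last exact: cts_snd.
    by move=> x [].
  apply: ctsD; apply: ctsM; [|exact: c|exact: cts_fst|exact: c].
  by apply: ctsB; [exact: cts_cst|exact: cts_fst].
- by move=> t _; rewrite subr0 mul1r mul0r addr0.
- by move=> t _; rewrite subrr mul1r mul0r add0r.
- by move=> s _; rewrite -e0 -mulrDl subrK mul1r.
- by move=> s _; rewrite -e1 -mulrDl subrK mul1r.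
Qed.

Definition pcat f g t := if t <= 2^-1 then f (2 * t) else g (2 * t - 1).

Definition pback f (t : R) := f (1 - t).

Lemma path_cst a : is_path (fun=> a) a a.
Proof. by split=> //; exact: cts_cst. Qed.

Lemma path_rev f a b : is_path f a b -> is_path (pback f) b a.
Proof.
move=> [cf f0 f1]; split; rewrite /pback ?subr0 ?subrr//.
apply: (cts_comp (g := f) (f := fun t : R => 1 - t) (B := itv01)) => //.
  by move=> t; rewrite /itv01 /=; lra.
by apply: ctsB; [exact: cts_cst|exact: cts_id].
Qed.

Lemma path_cat f g a b c : is_path f a b -> is_path g b c -> is_path (pcat f g) a c.
Proof.
move=> [cf f0 f1] [cg g0 g1]; split; rewrite /pcat; last 2 first.
- by rewrite ifT ?mulr0//; lra.
- rewrite ifF; last by apply/negbTE; rewrite -ltNge; lra.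
  by rewrite (_ : 2 * 1 - 1 = 1)//; lra.
apply: (cts_if (f := id) (F := fun t => f (2 * t)) (G := fun t => g (2 * t - 1))).
- exact: closed_itv01.
- exact: cts_id.
- apply: (cts_comp (g := f) (f := fun t : R => 2 * t) (B := itv01)) => //.
    by move=> t [/andP[? ?] /= ?]; rewrite /itv01 /=; lra.
  by apply: ctsM; [exact: cts_cst|exact: cts_id].
- apply: (cts_comp (g := g) (f := fun t : R => 2 * t - 1) (B := itv01)) => //.
    by move=> t [/andP[? ?] /= ?]; rewrite /itv01 /=; lra.
  by apply: ctsB; [apply: ctsM; [exact: cts_cst|exact: cts_id]|exact: cts_cst].
- by move=> t _ ->; rewrite divff ?pnatr_eq0// subrr f1 g0.
Qed.

Lemma hpath_refl f a b : is_path f a b -> hpath f f.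
Proof. by case=> cf _ _; exact: eq_hpath. Qed.

Lemma path_hpath f g a b : is_path f a b -> hpath f g -> is_path g a b.
Proof.
move=> [cf f0 f1] fg; have [e0 e1] := hpath_ends fg.
by split; [exact: cts_hpathr fg|rewrite -e0|rewrite -e1].
Qed.

Lemma hpath_cat f f' g g' b : f 1 = b -> g 0 = b -> hpath f f' -> hpath g g' ->
  hpath (pcat f g) (pcat f' g').
Proof.
move=> f1 g0 [H [cH h0 h1 e0 e1]] [H' [cH' h0' h1' e0' e1']].
exists (fun st : R * R => if st.2 <= 2^-1 then H (st.1, 2 * st.2) else H' (st.1, 2 * st.2 - 1)).
split=> /=.
- apply: (cts_if (f := snd) (F := fun st : R * R => H (st.1, 2 * st.2))
    (G := fun st : R * R => H' (st.1, 2 * st.2 - 1))); first exact: closed_square.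
  + exact: cts_snd.
  + apply: (cts_comp (g := H) (f := fun st : R * R => (st.1, 2 * st.2)) (B := square)) => //.
      by move=> [s t] [[/= s01 /andP[? ?]] /= ?]; split=> //=; rewrite /itv01 /=; lra.
    apply: cts_pair; first exact: cts_fst.
    by apply: ctsM; [exact: cts_cst|exact: cts_snd].
  + apply: (cts_comp (g := H') (f := fun st : R * R => (st.1, 2 * st.2 - 1)) (B := square)) => //.
      by move=> [s t] [[/= s01 /andP[? ?]] /= ?]; split=> //=; rewrite /itv01 /=; lra.
    apply: cts_pair; first exact: cts_fst.
    apply: ctsB; last exact: cts_cst.
    by apply: ctsM; [exact: cts_cst|exact: cts_snd].
  + move=> [s t] [/= s01 _] ->.
    by rewrite divff ?pnatr_eq0// subrr e1// e0'// f1.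
- move=> t /andP[? ?]; rewrite /pcat; case: ifPn => [?|].
    by rewrite h0// /itv01 /=; lra.
  by rewrite -ltNge => ?; rewrite h0'// /itv01 /=; lra.
- move=> t /andP[? ?]; rewrite /pcat; case: ifPn => [?|].
    by rewrite h1// /itv01 /=; lra.
  by rewrite -ltNge => ?; rewrite h1'// /itv01 /=; lra.
- by move=> s s01; rewrite ifT /pcat ?ifT ?mulr0 ?e0//; lra.
- move=> s s01; rewrite /pcat !ifF; do ?[apply/negbTE; rewrite -ltNge; lra].
  by rewrite (_ : 2 * 1 - 1 = 1) ?e1'//; lra.
Qed.

Local Ltac split_ifs :=
  repeat match goal with |- context [if ?b then _ else _] =>
    lazymatch b with
    | context [if _ then _ else _] => fail
    | _ => let H := fresh in case: (boolP b); rewrite -?ltNge /= => H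
    end
  end.

Let ctsl (p q : R) : cts itv01 (fun t => p * t + q).
Proof. by apply: ctsD; [apply: ctsM; [exact: cts_cst|exact: cts_id]|exact: cts_cst]. Qed.

Lemma hpath_catA f g h a b c d : is_path f a b -> is_path g b c -> is_path h c d ->
  hpath (pcat f (pcat g h)) (pcat (pcat f g) h).
Proof.
move=> pf pg ph; have p := path_cat pf (path_cat pg ph).
(* The concave piecewise linear map that takes the breaks 1/4, 1/2 of the right-hand side to the
   breaks 1/2, 3/4 of the left-hand side. *)
pose u (t : R) := Num.min (2 * t + 0) (Num.min (1 * t + 4^-1) (2^-1 * t + 2^-1)).
have cu : cts itv01 u by apply: cts_min; [exact: ctsl|apply: cts_min; exact: ctsl].
have [cp _ _] := p.
have E : hpath (pcat f (pcat g h) \o id) (pcat f (pcat g h) \o u).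
  apply: (@hpath_reparam _ _ _ 0 1) => //; first exact: cts_id.
  - by move=> t /andP[? ?]; rewrite /u !minEle; split_ifs; lra.
  - by rewrite /u !minEle; split_ifs; lra.
  - by rewrite /u !minEle; split_ifs; lra.
apply: hpath_trans E _; apply: eq_hpath.
  apply: (cts_comp (B := itv01)) => // t /andP[? ?].
  by rewrite /itv01 /u /= !minEle; split_ifs; lra.
move=> t /andP[? ?]; rewrite /u /= /pcat !minEle.
by split_ifs; first [by exfalso; lra | by congr (_ _); lra].
Qed.

Lemma hpath_cat1 f a b : is_path f a b -> hpath (pcat f (fun=> b)) f.
Proof.
move=> [cf f0 f1]; pose u (t : R) := Num.min (2 * t + 0) 1.
have cu : cts itv01 u by apply: cts_min; [exact: ctsl|exact: cts_cst].
have E : hpath (f \o u) (f \o id).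
  apply: (@hpath_reparam _ _ _ 0 1) => //; first exact: cts_id.
  - by move=> t /andP[? ?]; rewrite /u minEle; split_ifs; lra.
  - by rewrite /u minEle; split_ifs; lra.
  - by rewrite /u minEle; split_ifs; lra.
apply: hpath_trans _ E; apply/hpath_sym/eq_hpath.
  apply: (cts_comp (B := itv01)) => // t /andP[? ?].
  by rewrite /itv01 /u /= minEle; split_ifs; lra.
move=> t /andP[t0 t1]; rewrite /u /= /pcat minEle -f1; clear f0 f1 b; by split_ifs; first [by [] | by exfalso; lra | by congr f; lra].
Qed.

Lemma hpath_1cat f a b : is_path f a b -> hpath (pcat (fun=> a) f) f.
Proof.
move=> [cf f0 f1]; pose u (t : R) := Num.max 0 (2 * t + -1).
have cu : cts itv01 u by apply: cts_max; [exact: cts_cst|exact: ctsl].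
have E : hpath (f \o u) (f \o id).
  apply: (@hpath_reparam _ _ _ 0 1) => //; first exact: cts_id.
  - by move=> t /andP[? ?]; rewrite /u maxEle; split_ifs; lra.
  - by rewrite /u maxEle; split_ifs; lra.
  - by rewrite /u maxEle; split_ifs; lra.
apply: hpath_trans _ E; apply/hpath_sym/eq_hpath.
  apply: (cts_comp (B := itv01)) => // t /andP[? ?].
  by rewrite /itv01 /u /= maxEle; split_ifs; lra.
move=> t /andP[t0 t1]; rewrite /u /= /pcat maxEle -f0.
clear f0 f1; by split_ifs; first [by [] | by exfalso; lra | by congr f; lra].
Qed.

Lemma hpath_catV f a b : is_path f a b -> hpath (pcat f (pback f)) (fun=> a).
Proof.
(* The parameter runs to 1 and back; beginning and ending at 0, it contracts to the constant 0. *)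
move=> [cf f0 f1]; pose u (t : R) := Num.min (2 * t + 0) (-2 * t + 2).
have cu : cts itv01 u by apply: cts_min; exact: ctsl.
have E : hpath (f \o u) (f \o fun=> 0).
  apply: (@hpath_reparam _ _ _ 0 1) => //; first exact: cts_cst.
  - by move=> t /andP[? ?]; rewrite /u minEle; split_ifs; lra.
  - by move=> t _; rewrite lexx ler01.
  - by rewrite /u minEle; split_ifs; lra.
  - by rewrite /u minEle; split_ifs; lra.
apply: (@hpath_trans (f \o u)).
  apply/hpath_sym/eq_hpath.
    apply: (cts_comp (B := itv01)) => // t /andP[? ?].
    by rewrite /itv01 /u /= minEle; split_ifs; lra.
  move=> t /andP[t0 t1]; rewrite /u /= /pcat /pback minEle.
  clear f0 f1; by split_ifs; first [by [] | by exfalso; lra | by congr f; lra].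
apply: hpath_trans E _; apply: eq_hpath; last by move=> t _ /=.
exact: cts_cst.
Qed.

Lemma revK f : pback (pback f) = f.
Proof. by apply/funext => t; rewrite /pback opprB addrCA subrr addr0. Qed.

Lemma hpath_Vcat f a b : is_path f a b -> hpath (pcat (pback f) f) (fun=> b).
Proof. by move=> /path_rev/hpath_catV; rewrite revK. Qed.

Lemma hpath_catl f g g' a b c : is_path f a b -> is_path g b c -> is_path g' b c ->
  hpath (pcat f g) (pcat f g') -> hpath g g'.
Proof.
move=> pf pg pg' fg.
have red h : is_path h b c -> hpath (pcat (pback f) (pcat f h)) h.
  move=> ph; apply: hpath_trans (hpath_catA (path_rev pf) pf ph) _.
  apply: (@hpath_trans (pcat (fun=> b) h)); last exact: hpath_1cat ph.
  by apply: (hpath_cat (b := b)); [case: (path_cat (path_rev pf) pf)|case: ph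
    |exact: hpath_Vcat pf|exact: hpath_refl ph].
apply: hpath_trans (hpath_sym (red _ pg)) _; apply: hpath_trans _ (red _ pg').
apply: (hpath_cat (b := a)) => //; last exact: hpath_refl (path_rev pf).
  by case: (path_rev pf).
by case: (path_cat pf pg).
Qed.

Lemma hpath_catr f f' g a b c : is_path f a b -> is_path f' a b -> is_path g b c ->
  hpath (pcat f g) (pcat f' g) -> hpath f f'.
Proof.
move=> pf pf' pg fg.
have red h : is_path h a b -> hpath (pcat (pcat h g) (pback g)) h.
  move=> ph; apply: hpath_trans (hpath_sym (hpath_catA ph pg (path_rev pg))) _.
  apply: (@hpath_trans (pcat h (fun=> b))); last exact: hpath_cat1 ph.
  by apply: (hpath_cat (b := b)); [case: ph|case: (path_cat pg (path_rev pg))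
    |exact: hpath_refl ph|exact: hpath_catV pg].
apply: hpath_trans (hpath_sym (red _ pf)) _; apply: hpath_trans _ (red _ pf').
apply: (hpath_cat (b := c)) => //; last exact: hpath_refl (path_rev pg).
  by case: (path_cat pf pg).
by case: (path_rev pg).
Qed.

End Paths.

Section Holonomy.
Variables (R : realType) (G : groupType) (K : topologicalType).
Local Open Scope group_scope.
Implicit Types (e : R -> K) (a b c : K).

(* an equivalence from the fundamental groupoid of K to the group G *)
Definition holonomy (hol : (R -> K) -> G) := [/\
  forall e e' a b c, is_path e a b -> is_path e' b c -> hol (pcat e e') = hol e * hol e',
  forall e e' a b, is_path e a b -> is_path e' a b -> (hol e = hol e' <-> hpath e e') &
  forall a b g, exists2 e, is_path e a b & hol e = g].

(** The 0-cube is one point with empty boundary: a 0-loop is a point of [K], and a homotopy of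
    0-loops is a path. *)
Lemma path_connected_pi0 (x0 : K) : (forall u v : homotopy_group R 0 x0, u = v) ->
  forall a b, exists e, is_path e a b.
Proof.
move=> triv a b.
have mk (y : K) : exists l : loop R 0 x0, forall x, l x = y.
  have c : {within @cube R 0, continuous (fun=> y)}.
    by apply: continuous_subspaceT; exact: cst_continuous.
  have bd (x : 'rV[R]_0) : cube_boundary x -> (fun=> y) x = x0 by move=> [_ [[]]].
  by exists (Loop c bd).
have [la laE] := mk a; have [lb lbE] := mk b.
have /homotopy_classP[H [cH H0 H1 _]] := triv (homotopy_class la) (homotopy_class lb).
have cube0' : cube (0 : 'rV[R]_0)%R by move=> [].
exists (fun t => H (t, 0)%R); split; last 2 first.
- by rewrite H0// laE.
- by rewrite H1// lbE.
apply: (cts_comp (g := H) (f := fun t : R => (t, 0)%R) (B := @cylinder R 0)).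
- by move=> t t01; split.
- by apply: cts_pair; [exact: cts_id|exact: cts_cst].
- exact: within_cts.
Qed.

Section Fundamental.
Variable x0 : K.
Hypothesis connected : forall a b, exists e, is_path (R := R) e a b.

Let cubeE (x : 'rV[R]_1) : cube x <-> itv01 (x ord0 ord0).
Proof. by split=> [/(_ ord0)//|h i]; rewrite (ord1 i). Qed.

Let rowE (x : 'rV[R]_1) : x = const_mx (x ord0 ord0).
Proof. by apply/rowP => i; rewrite mxE (ord1 i). Qed.

Let cts_coord (A : set 'rV[R]_1) : cts A (fun x => x ord0 ord0).
Proof. by apply: continuous_cts => x; exact: coord_continuous. Qed.

Let cts_const_mx (A : set R) : cts A (fun t => const_mx t : 'rV[R]_1).
Proof.
apply: continuous_cts => t P [B hB sB].
have h : nbhs t (B ord0 ord0) by have := hB ord0 ord0; rewrite mxE.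
by apply: filterS h => s Bs; apply: sB => i j; rewrite !ord1 mxE.
Qed.

Let loop_of e : is_path e x0 x0 -> exists l : loop R 1 x0, forall x, l x = e (x ord0 ord0).
Proof.
move=> [ce e0 e1].
have c : {within @cube R 1, continuous (fun x : 'rV[R]_1 => e (x ord0 ord0))}.
  apply: cts_within; apply: (cts_comp (g := e) (f := fun x : 'rV[R]_1 => x ord0 ord0)
    (B := itv01)) => //.
  by move=> x /cubeE.
have bd (x : 'rV[R]_1) : cube_boundary x -> e (x ord0 ord0) = x0.
  by move=> [_ [i]]; rewrite (ord1 i) => -[->|->].
by exists (Loop c bd).
Qed.

Let cl e : homotopy_group R 1 x0 :=
  if pselect (is_path e x0 x0) is left h then homotopy_class (projT1 (cid (loop_of h))) else 1.

Let clE e (l : loop R 1 x0) : is_path e x0 x0 -> (forall x, cube x -> l x = e (x ord0 ord0)) ->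
  cl e = homotopy_class l.
Proof.
move=> pe le; rewrite /cl; case: pselect => // h; case: cid => l' l'E /=.
by apply/homotopy_classP/eq_homotopic => x cx; rewrite l'E le.
Qed.

Let cl_eq e e' : is_path e x0 x0 -> is_path e' x0 x0 -> (cl e = cl e' <-> hpath e e').
Proof.
move=> pe pe'; have [l lE] := loop_of pe; have [l' l'E] := loop_of pe'.
rewrite (clE pe (fun x _ => lE x)) (clE pe' (fun x _ => l'E x)).
have c01 t : itv01 t -> cube (const_mx t : 'rV[R]_1) by move=> h; apply/cubeE; rewrite mxE.
have bd t : t = 0%R \/ t = 1%R -> cube_boundary (const_mx t : 'rV[R]_1).
  move=> t01; split; last by exists ord0; rewrite mxE.
  by apply: c01; case: t01 => ->; [exact: itv01_0|exact: itv01_1].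
have [ce e0 e1] := pe; have [ce' e0' e1'] := pe'.
rewrite homotopy_classP; split=> -[H].
  move=> [cH H0 H1 Hb]; exists (fun st => H (st.1, const_mx st.2)); split=> /=.
  - apply: (cts_comp (g := H) (f := fun st : R * R => (st.1, const_mx st.2))
      (B := @cylinder R 1)).
    + by move=> [s t] [/= s01 t01]; split=> //=; exact: c01.
    + apply: cts_pair; first exact: cts_fst.
      apply: (cts_comp (g := fun t : R => const_mx t : 'rV[R]_1) (f := snd) (B := setT)) => //.
      exact: cts_snd.
    + exact: within_cts.
  - by move=> t t01; rewrite H0 ?lE ?mxE//; exact: c01.
  - by move=> t t01; rewrite H1 ?l'E ?mxE//; exact: c01.
  - by move=> s s01; rewrite e0 Hb//; apply: bd; left.
  - by move=> s s01; rewrite e1 Hb//; apply: bd; right.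
move=> [cH H0 H1 He0 He1]; exists (fun tx : R * 'rV[R]_1 => H (tx.1, tx.2 ord0 ord0)); split=> /=.
- apply: cts_within; apply: (cts_comp (g := H) (f := fun tx : R * 'rV[R]_1 =>
    (tx.1, tx.2 ord0 ord0)) (B := @square R)) => //.
    by move=> [t x] [/= t01 /cubeE cx].
  apply: cts_pair; first by apply: continuous_cts => x; exact: cvg_fst.
  apply: (cts_comp (g := fun x : 'rV[R]_1 => x ord0 ord0) (f := snd) (B := setT)) => //.
  by apply: continuous_cts => x; exact: cvg_snd.
- by move=> x /cubeE cx; rewrite H0// lE.
- by move=> x /cubeE cx; rewrite H1// l'E.
- move=> t x t01 [_ [i]]; rewrite (ord1 i) => -[->|->]; first by rewrite He0.
  by rewrite He1.
Qed.

Let cl_cat e e' : is_path e x0 x0 -> is_path e' x0 x0 -> cl (pcat e e') = (cl e * cl e').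
Proof.
move=> pe pe'; have [l lE] := loop_of pe; have [l' l'E] := loop_of pe'.
rewrite (clE pe (fun x _ => lE x)) (clE pe' (fun x _ => l'E x)).
rewrite [RHS]pi_mulE; apply: clE; first exact: path_cat pe pe'.
move=> x cx; rewrite /= /concat_fun /pcat lE l'E !update0E addr0.
by [].
Qed.

Let cl_surj (z : homotopy_group R 1 x0) : exists2 e, is_path e x0 x0 & cl e = z.
Proof.
have [l <-] := homotopy_class_surj z.
have bd (t : R) : t = 0%R \/ t = 1%R -> l (const_mx t) = x0.
  move=> t01; apply: loop_boundary; split; last by exists ord0; rewrite mxE.
  by apply/cubeE; rewrite mxE; case: t01 => ->; [exact: itv01_0|exact: itv01_1].
have p : is_path (fun t : R => l (const_mx t)) x0 x0.
  split; [|by apply: bd; left|by apply: bd; right].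
  apply: (cts_comp (g := l) (f := fun t : R => const_mx t : 'rV[R]_1) (B := @cube R 1)).
  - by move=> t t01; apply/cubeE; rewrite mxE.
  - exact: cts_const_mx.
  - exact/within_cts/loop_continuous.
by exists (fun t : R => l (const_mx t)) => //; apply: clE => // x _; rewrite -rowE.
Qed.

(** A path [eta y] from [x0] to each point [y] closes any path up to a loop at [x0], whose class is
    read in [G]. In a concatenation the two inserted copies of [eta] cancel. *)
Lemma holonomy_exists (phi : {multiplicative G -> homotopy_group R 1 x0}) :
  bijective phi -> exists hol, holonomy hol.
Proof.
move=> [psi phiK psiK].
have /choice[eta etaP] : forall y, exists e, is_path (R := R) e x0 y by move=> y.
pose hat e := pcat (pcat (eta (e 0%R)) e) (pback (eta (e 1%R))).
have hatP e a b : is_path e a b -> hat e = pcat (pcat (eta a) e) (pback (eta b)).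
  by move=> [_ e0 e1]; rewrite /hat e0 e1.
have path_hat e a b : is_path e a b -> is_path (hat e) x0 x0.
  move=> pe; rewrite (hatP _ _ _ pe).
  exact: path_cat (path_cat (etaP a) pe) (path_rev (etaP b)).
have psiM : {morph psi : u v / u * v}.
  by move=> u v; rewrite -[u]psiK -[v]psiK -gmulfM !phiK.
exists (fun e => psi (cl (hat e))); split.
- move=> e e' a b c pe pe'; rewrite -psiM; congr psi.
  rewrite -cl_cat; [|exact: path_hat pe|exact: path_hat pe'].
  have pee := path_cat pe pe'.
  apply/cl_eq; [exact: path_hat pee|exact: path_cat (path_hat _ _ _ pe) (path_hat _ _ _ pe')|].
  rewrite (hatP _ _ _ pe) (hatP _ _ _ pe') (hatP _ _ _ pee); apply: hpath_sym.
  have pA := path_cat (etaP a) pe; have pB := path_rev (etaP b).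
  have pC := path_cat (etaP b) pe'; have pD := path_rev (etaP c).
  apply: hpath_trans (hpath_sym (hpath_catA pA pB (path_cat pC pD))) _.
  have pBC := path_cat pB pC.
  have h1 : hpath (pcat (pback (eta b)) (pcat (eta b) e')) e'.
    apply: hpath_trans (hpath_catA pB (etaP b) pe') _.
    apply: hpath_trans (hpath_1cat pe').
    apply: (hpath_cat (b := b)); [by case: (path_cat pB (etaP b))|by case: pe'|
      exact: hpath_Vcat (etaP b)|exact: hpath_refl pe'].
  apply: (hpath_trans (g := pcat (pcat (eta a) e) (pcat e' (pback (eta c))))).
    apply: (hpath_cat (b := b)); [by case: pA|by case: (path_cat pB (path_cat pC pD))|
      exact: hpath_refl pA|].
    apply: hpath_trans (hpath_catA pB pC pD) _.
    by apply: (hpath_cat (b := c)); [case: pBC|case: pD| |exact: hpath_refl pD].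
  apply: hpath_trans (hpath_catA pA pe' pD) _.
  apply: (hpath_cat (b := c)); [by case: (path_cat pA pe')|by case: pD| |exact: hpath_refl pD].
  exact/hpath_sym/(hpath_catA (etaP a) pe pe').
- move=> e e' a b pe pe'; split=> [/(can_inj psiK)|ee'].
    move=> /cl_eq -/(_ (path_hat _ _ _ pe) (path_hat _ _ _ pe')).
    rewrite (hatP _ _ _ pe) (hatP _ _ _ pe') => /hpath_catr h.
    have := h _ _ _ (path_cat (etaP a) pe) (path_cat (etaP a) pe') (path_rev (etaP b)).
    by move=> /hpath_catl; apply; [exact: etaP|exact: pe|exact: pe'].
  congr psi; apply/cl_eq; [exact: path_hat pe|exact: path_hat pe'|].
  rewrite (hatP _ _ _ pe) (hatP _ _ _ pe').
  apply: (hpath_cat (b := b)); [by case: (path_cat (etaP a) pe)|by case: (path_rev (etaP b))|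
    |exact: hpath_refl (path_rev (etaP b))].
  by apply: (hpath_cat (b := a)); [case: (etaP a)|case: pe|exact: hpath_refl (etaP a)|].
move=> a b g; have [f pf fE] := cl_surj (phi g).
have pe := path_cat (path_rev (etaP a)) (path_cat pf (etaP b)).
exists (pcat (pback (eta a)) (pcat f (eta b))) => //.
rewrite -[RHS]phiK -fE; congr psi; apply/cl_eq => //; first exact: path_hat pe.
rewrite (hatP _ _ _ pe).
have p1 := path_cat pf (etaP b).
apply: (hpath_trans (g := pcat (pcat f (eta b)) (pback (eta b)))).
  apply: (hpath_cat (b := b)); [by case: (path_cat (etaP a) pe)|by case: (path_rev (etaP b))|
    |exact: hpath_refl (path_rev (etaP b))].
  apply: hpath_trans (hpath_catA (etaP a) (path_rev (etaP a)) p1) _.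
  apply: hpath_trans (hpath_1cat p1).
  by apply: (hpath_cat (b := x0)); [case: (path_cat (etaP a) (path_rev (etaP a)))|case: p1
    |exact: hpath_catV (etaP a)|exact: hpath_refl p1].
apply: hpath_trans (hpath_sym (hpath_catA pf (etaP b) (path_rev (etaP b)))) _.
apply: hpath_trans (hpath_cat1 pf).
by apply: (hpath_cat (b := x0)); [case: pf|case: (path_cat (etaP b) (path_rev (etaP b)))
  |exact: hpath_refl pf|exact: hpath_catV (etaP b)].
Qed.

End Fundamental.

Section HolonomyTheory.
Variable hol : (R -> K) -> G.
Hypothesis hhol : holonomy hol.

Lemma holM e e' a b c : is_path e a b -> is_path e' b c -> hol (pcat e e') = hol e * hol e'.
Proof. by case: hhol => h _ _; exact: h. Qed.

Lemma hol_eq e e' a b : is_path e a b -> is_path e' a b -> (hol e = hol e' <-> hpath e e').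
Proof. by case: hhol => _ h _; exact: h. Qed.

Lemma hol_surj a b g : exists2 e, is_path e a b & hol e = g.
Proof. by case: hhol => _ _; apply. Qed.

Lemma hol_cst a : hol (fun=> a) = 1.
Proof.
have pa := path_cst R a.
have : hol (fun=> a) * hol (fun=> a) = hol (fun=> a).
  rewrite -(holM pa pa); apply/(hol_eq (path_cat pa pa) pa).
  exact: hpath_cat1 pa.
by move=> h; rewrite -[LHS](mulKg (hol (fun=> a))) h mulVg.
Qed.

Lemma holV e a b : is_path e a b -> hol (pback e) = (hol e)^-1.
Proof.
move=> pe; have pr := path_rev pe.
have : hol e * hol (pback e) = 1.
  rewrite -(holM pe pr) -(hol_cst a); apply/(hol_eq (path_cat pe pr) (path_cst R a)).
  exact: hpath_catV pe.
by move=> h; rewrite -[LHS](mulKg (hol e)) h mulg1.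
Qed.

Lemma hol_ext e e' a b : is_path e a b -> (forall t, itv01 t -> e t = e' t) -> hol e' = hol e.
Proof.
move=> pe ee'; have [ce _ _] := pe; have h := eq_hpath ce ee'.
by apply/esym/(hol_eq pe (path_hpath pe h)).
Qed.

End HolonomyTheory.

End Holonomy.

(** * Filling a triangle from a homotopy on a square *)

Section TriangleFilling.
Variables (R : realType) (K : topologicalType).

(** The tube lemma for a side of the square that [H] collapses to a point. *)
Lemma tube (H : R * R -> K) (t0 : R) (y : K) (P : set K) :
  cts (@square R) H -> itv01 t0 -> (forall s, itv01 s -> H (s, t0) = y) -> nbhs y P ->
  \forall t \near t0, itv01 t -> forall s, itv01 s -> P (H (s, t)).
Proof.
move=> cH t01 Hy yP.
have /compact_near_coveringP nc := @segment_compact R 0 1.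
have h (s : R) : `[0, 1]%classic s ->
    \forall s' \near s & t \near t0, itv01 t -> itv01 s' -> P (H (s', t)).
  rewrite /= in_itv /= => s01.
  have sq : square (s, t0) by split.
  have HP : nbhs (H (s, t0)) P by rewrite Hy.
  have := cts_near cH sq HP; apply: filterS => -[s' t] /= h t1 s1.
  by apply: h; split.
have := nc _ (nbhs t0) (fun t s => itv01 t -> itv01 s -> P (H (s, t))) (nbhs_filter t0) h.
apply: filterS => t ht t1 s s01; apply: ht => //.
Qed.

Definition cone2 : set (R * R * R) := [set z | [/\ 0 <= z.1.1, 0 <= z.1.2, 0 <= z.2 &
  0 < z.1.1 + z.1.2 + z.2]].

(** The square is collapsed onto the triangle by shrinking two opposite sides to the vertices 0 and
    2, where the homotopy is constant. The last clause keeps all values among those of [H], so that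
    a small homotopy yields a small triangle. *)
Lemma triangle_fill (e01 e12 e02 : R -> K) y0 y1 y2 H :
  is_path e01 y0 y1 -> is_path e12 y1 y2 -> is_path e02 y0 y2 ->
  homotopy H (pcat e01 e12) e02 ->
  exists D : R * R * R -> K, [/\ cts cone2 D,
    forall a b, 0 <= a -> 0 <= b -> 0 < a + b -> D (a, b, 0) = e01 (b / (a + b)),
    forall b c, 0 <= b -> 0 <= c -> 0 < b + c -> D (0, b, c) = e12 (c / (b + c)),
    forall a c, 0 <= a -> 0 <= c -> 0 < a + c -> D (a, 0, c) = e02 (c / (a + c)) &
    forall z, cone2 z -> exists2 st, square st & D z = H st].
Proof.
move=> [c01 e010 e011] [c12 e120 e121] [c02 e020 e021] [cH H0 H1 Hl Hr].
(* [tt] is the affine position with values 0, 1/2, 1 at the three vertices, and [mn] is the largest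
   middle coordinate on the line of the same [tt] and total. So [ss] is 0 on the two edges through
   vertex 1 and 1 on the opposite edge. *)
pose mn (z : R * R * R) : R := Num.min (z.1.2 + 2 * z.2) (2 * z.1.1 + z.1.2).
pose tt (z : R * R * R) : R := (z.1.2 / 2 + z.2) / (z.1.1 + z.1.2 + z.2).
pose ss (z : R * R * R) : R := 1 - z.1.2 / mn z.
have Hy0 s : itv01 s -> H (s, 0) = y0.
  by move=> s01; rewrite Hl// /pcat ifT ?mulr0//; lra.
have Hy2 s : itv01 s -> H (s, 1) = y2.
  move=> s01; rewrite Hr// /pcat ifF; last by apply/negbTE; rewrite -ltNge; lra.
  by rewrite (_ : 2 * 1 - 1 = 1)//; lra.
have mn_ge z : cone2 z -> z.1.2 <= mn z.
  by move=> [a0 b0 c0 _]; rewrite /mn le_min; apply/andP; split; lra.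
have ss01 z : cone2 z -> itv01 (ss z).
  move=> hz; have [a0 b0 c0 _] := hz; have h := mn_ge z hz.
  rewrite /itv01 /ss /=; have [m0|m0] := eqVneq (mn z) 0.
    by rewrite m0 invr0 mulr0 subr0 ler01 lexx.
  have mp : 0 < mn z by rewrite lt_neqAle eq_sym m0 (le_trans b0).
  have : 0 <= z.1.2 / mn z by rewrite divr_ge0// ltW.
  have : z.1.2 / mn z <= 1 by rewrite ler_pdivrMr// mul1r.
  by move=> ? ?; apply/andP; split; lra.
have tt01 z : cone2 z -> itv01 (tt z).
  move=> [a0 b0 c0 s0]; apply/andP; split; last by rewrite ler_pdivrMr// mul1r; lra.
  by apply: divr_ge0; [lra|exact: ltW].
have c1 : cts cone2 (fun z => z.1.1).
  by apply: continuous_cts => z; apply: continuous_comp; exact: cvg_fst.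
have c2 : cts cone2 (fun z => z.1.2).
  by apply: continuous_cts => z; apply: (@continuous_comp _ _ _ fst snd); [exact: cvg_fst|exact: cvg_snd].
have c3 : cts cone2 (fun z => z.2) by apply: continuous_cts => z; exact: cvg_snd.
have ctt : cts cone2 tt.
  apply: cts_div => [z [_ _ _ s0]||]; first by rewrite gt_eqF.
    by apply: ctsD => //; apply: ctsM => //; exact: cts_cst.
  by apply: ctsD => //; exact: ctsD.
have cmn : cts cone2 mn.
  by apply: cts_min; apply: ctsD => //; apply: ctsM => //; exact: cts_cst.
have edge0 z : cone2 z -> tt z = 0 -> H (ss z, tt z) = y0.
  by move=> hz ->; rewrite Hy0//; exact: ss01.
exists (fun z => H (ss z, tt z)); split.
- apply/ctsP => z P hz HP.
  (* [mn] vanishes at the vertices 0 and 2 only. There [ss] has no limit, but [H] does not depend on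
     it, and the tube lemma gives continuity. *)
  have [m0|m0] := eqVneq (mn z) 0; last first.
    have := hz; have [a0 b0 c0 s0] := hz.
    have mp : 0 < mn z by rewrite lt_neqAle eq_sym m0 (le_trans b0)// mn_ge.
    pose B := cone2 `&` [set z | 0 < mn z].
    have cB : cts B (fun z => H (ss z, tt z)).
      apply: (cts_comp (g := H) (f := fun z => (ss z, tt z)) (B := @square R)) => //.
        by move=> w [hw _]; split; [exact: ss01|exact: tt01].
      apply: cts_pair; last by apply: sub_cts ctt => w [].
      apply: ctsB; first exact: cts_cst.
      apply: cts_div => [w [_ /= h]||]; first by rewrite gt_eqF.
        by apply: sub_cts c2 => w [].
      by apply: sub_cts cmn => w [].
    move=> _; have Bz : B z by [].
    have n1 := cts_near cB Bz HP.
    have n2 : \forall w \near z, cone2 w -> 0 < mn w.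
      have mo : nbhs (mn z) [set t | 0 < t].
        by apply: open_nbhs_nbhs; split=> //; exact: open_gt.
      exact: cts_near cmn hz mo.
    apply: filterS2 n1 n2 => w h1 h2 hw; apply: h1; split=> //; exact: h2.
  have key (t0 : R) y : itv01 t0 -> tt z = t0 -> (forall s, itv01 s -> H (s, t0) = y) ->
      \forall w \near z, cone2 w -> P (H (ss w, tt w)).
    move=> t0I tz Hy.
    have yP : nbhs y P by move: HP; rewrite tz Hy//; exact: ss01.
    have := tube cH t0I Hy yP; rewrite -tz => tP.
    have := cts_near ctt hz tP; apply: filterS => w h hw.
    by apply: h => //; [exact: tt01|exact: ss01].
  have [a0 b0 c0 s0] := hz.
  have bz : z.1.2 = 0 by apply/eqP; rewrite eq_le b0 andbT -m0 mn_ge.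
  have : z.2 = 0 \/ z.1.1 = 0.
    move: m0; rewrite /mn bz addr0 add0r minEle; case: ifP => _ h; [left|right]; lra.
  move=> [cz|az].
    apply: (key 0 y0) => //; first exact: itv01_0.
    by rewrite /tt bz cz mul0r addr0 mul0r.
  apply: (key 1 y2) => //; first exact: itv01_1.
  rewrite /tt bz az mul0r !add0r divff//.
  by move: s0; rewrite az bz !add0r => /gt_eqF ->.
- move=> a b a0 b0 ab0; have hz : cone2 (a, b, 0) by split=> //=; rewrite addr0.
  have [bz|bn] := eqVneq b 0.
    have tz : tt (a, b, 0) = 0 by rewrite /tt /= bz !mul0r addr0 mul0r.
    by rewrite edge0// bz mul0r e010.
  have sz : ss (a, b, 0) = 0.
    rewrite /ss /mn /= mulr0 addr0 minEle ifT; last by lra.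
    by rewrite divff// subrr.
  have tz : tt (a, b, 0) = b / (a + b) / 2.
    by rewrite /tt /= !addr0 mulrAC.
  rewrite sz H0; last exact: tt01.
  rewrite tz /pcat ifT; last first.
    have : b / (a + b) <= 1 by rewrite ler_pdivrMr// mul1r; lra.
    by lra.
  by congr e01; rewrite mulrC divfK.
- move=> b c b0 c0 bc0; have hz : cone2 (0, b, c) by split=> //=; rewrite add0r.
  have [bz|bn] := eqVneq b 0.
    have tz : tt (0, b, c) = 1.
      rewrite /tt /= bz mul0r !add0r divff//; move: bc0; rewrite bz add0r => /gt_eqF ->.
      by [].
    rewrite tz Hy2; last exact: ss01.
    by rewrite bz add0r divff ?e121//; move: bc0; rewrite bz add0r => /gt_eqF ->.
  have sz : ss (0, b, c) = 0.
    rewrite /ss /mn /= mulr0 add0r minEle; case: ifPn => [h|_]; last by rewrite divff// subrr.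
    have cz : c = 0 by lra.
    by rewrite cz mulr0 addr0 divff// subrr.
  have tz : 2 * tt (0, b, c) - 1 = c / (b + c).
    rewrite /tt /= add0r; have bcn : b + c != 0 by rewrite gt_eqF.
    by field.
  rewrite sz H0; last exact: tt01.
  have t0 : 0 <= c / (b + c) by rewrite divr_ge0// ltW.
  rewrite /pcat; case: ifPn => [h|_]; last by rewrite tz.
  have t1 : c / (b + c) = 0 by lra.
  by rewrite t1 (_ : 2 * _ = 1) ?e011 ?e120//; lra.
- move=> a c a0 c0 ac0; have hz : cone2 (a, 0, c) by split=> //=; rewrite addr0.
  have sz : ss (a, 0, c) = 1 by rewrite /ss /= mul0r subr0.
  have tz : tt (a, 0, c) = c / (a + c) by rewrite /tt /= mul0r add0r addr0.
  by rewrite sz H1 ?tz//; have := tt01 _ hz; rewrite tz.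
- by move=> z hz; exists (ss z, tt z) => //; split; [exact: ss01|exact: tt01].
Qed.

End TriangleFilling.

(** * Local structure of CW complexes *)

Section Euclidean.
Variables (R : realType) (n : nat).
Implicit Types x : 'rV[R]_n.

Definition nrm x : R := Num.sqrt (sqnorm x).

Lemma nrm_ge0 x : 0 <= nrm x. Proof. exact: sqrtr_ge0. Qed.

Lemma nrmZ a x : nrm (a *: x) = `|a| * nrm x.
Proof.
rewrite /nrm (_ : sqnorm (a *: x) = a ^+ 2 * sqnorm x); last first.
  by rewrite /sqnorm mulr_sumr; apply: eq_bigr => i _; rewrite mxE exprMn.
by rewrite sqrtrM ?sqr_ge0// sqrtr_sqr.
Qed.

Lemma sqnorm_ge0 x : 0 <= sqnorm x.
Proof. by apply: sumr_ge0 => i _; exact: sqr_ge0. Qed.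

Lemma closed_diskE x : closed_disk x <-> nrm x <= 1.
Proof. by rewrite /closed_disk /= /nrm -(ler_sqrt (sqnorm x) (@ler01 R)) sqrtr1. Qed.

Lemma open_diskE x : open_disk x <-> nrm x < 1.
Proof. by rewrite /open_disk /= /nrm -(ltr_sqrt (sqnorm x) (@ltr01 R)) sqrtr1. Qed.

Lemma sphereE x : sphere x <-> nrm x = 1.
Proof.
rewrite /sphere /= /nrm; split=> [->|h]; first by rewrite sqrtr1.
by rewrite -(sqr_sqrtr (sqnorm_ge0 x)) h expr1n.
Qed.

Lemma continuous_sqnorm : continuous (@sqnorm R n).
Proof.
apply: cts_continuous; rewrite /sqnorm; apply: cts_sum => i _.
apply: (eq_cts (f := fun x : 'rV[R]_n => x ord0 i * x ord0 i)).
  by move=> x _; rewrite expr2.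
by apply: ctsM; apply: continuous_cts => x; exact: coord_continuous.
Qed.

Lemma continuous_nrm : continuous nrm.
Proof.
move=> x; apply: continuous_comp; first exact: continuous_sqnorm.
exact: sqrt_continuous.
Qed.

Lemma closed_closed_disk : closed (@closed_disk R n).
Proof.
have := @closed_preimage_cts _ _ setT (@sqnorm R n) [set t | t <= 1] (@closedT _)
  (continuous_cts continuous_sqnorm) (@closed_le _ 1).
by rewrite setTI.
Qed.

Lemma compact_closed_disk : compact (@closed_disk R n).
Proof.
apply: bounded_closed_compact; last exact: closed_closed_disk.
exists 1; split; first exact: num_real.
move=> M M1 x /closed_diskE hx /=.
apply: (@le_trans _ _ 1); last exact: ltW.
rewrite [leLHS]mx_normrE; apply: (big_ind (fun t => t <= 1)) => //.
- by move=> a b a1 b1; rewrite ge_max a1.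
- move=> [i j] _ /=; rewrite (ord1 i); apply: le_trans hx.
  rewrite -sqrtr_sqr /nrm ler_sqrt ?sqnorm_ge0// /sqnorm (bigD1 j)//= lerDl.
  by apply: sumr_ge0 => k _; exact: sqr_ge0.
Qed.

End Euclidean.

(** * Neighborhood retracts of normed spaces *)

Section Retracts.
Variables (R : realType) (M : topologicalType).
Hypothesis hM : hausdorff_space M.

(** A continuous map from a compact set onto its image in a Hausdorff space is closed, hence a
    quotient map. *)
Lemma cts_compact_image (T Z : topologicalType) (D : set T) (chi : T -> M) (g : M -> Z) :
  closed D -> compact D -> cts D chi -> cts D (g \o chi) -> cts (chi @` D) g.
Proof.
move=> clD cD cchi cg; apply/within_cts/continuous_closedP => C clC.
apply/closed_subspaceP; exists (chi @` (D `&` (g \o chi) @^-1` C)).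
  apply: compact_closed => //; apply: continuous_compact.
    by apply: cts_within; apply: sub_cts cchi => x [].
  have clDC := closed_preimage_cts clD cg clC.
  by apply: (subclosed_compact clDC cD) => x [].
apply/seteqP; split=> y [].
  by move=> [x [Dx gx] <-] [x' Dx' xx']; split=> //; exists x'.
by move=> gy [x Dx xy]; split; [exists x => //; split=> //=; rewrite xy|exists x].
Qed.

Definition retraction_data (Y : set M) (E : normedModType R) (iota : M -> E)
    (O : set E) (r : E -> M) :=
  [/\ cts Y iota, open O /\ forall y, Y y -> O (iota y), cts O r,
      forall z, O z -> Y (r z) & forall y, Y y -> r (iota y) = y].

Definition neighborhood_retract (Y : set M) :=
  exists (E : normedModType R) (iota : M -> E) (O : set E) (r : E -> M),
    retraction_data Y iota O r.

(** The open set is the interior of the locus where [r] is continuous with values in [Y]. It then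
    suffices to examine [r] near each point of the embedded [Y]. *)
Lemma neighborhood_retract_interior (Y : set M) (E : normedModType R)
    (iota : M -> E) (r : E -> M) : cts Y iota ->
  (forall y, Y y -> r (iota y) = y) ->
  (forall y, Y y -> exists2 A : set E, nbhs (iota y) A &
     cts A r /\ forall z, A z -> Y (r z)) ->
  neighborhood_retract Y.
Proof.
move=> ci ri loc; pose Q := [set z | Y (r z) /\ r @ z --> r z].
exists E, iota, Q°, r; split=> //.
- split; first exact: open_interior.
  move=> y Yy; have [A yA [cA AY]] := loc y Yy.
  have : nbhs (iota y) A° by exact: nbhs_interior.
  apply: filterS => z Az; split; first by apply: AY; exact: interior_subset.
  exact: cts_nbhs Az cA.
- apply/ctsP => z P /interior_subset[_ rz] rP.
  have h : nbhs z (r @^-1` P) := rz P rP.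
  by apply: filterS h => t Pt _.
- by move=> z /interior_subset[].
Qed.

Section AttachCell.
Variables (n : nat) (chi : 'rV[R]_n -> M) (Y : set M).
Local Notation disk := (@closed_disk R n).
Hypothesis clY : closed Y.
Hypothesis chi_cts : cts disk chi.
Hypothesis chi_sphere : chi @` @sphere R n `<=` Y.
Hypothesis chi_inj : {in @open_disk R n &, injective chi}.
Hypothesis chi_out : forall x, open_disk x -> ~ Y (chi x).

(** An explicit form of the fact that attaching a cell to a neighborhood retract gives a
    neighborhood retract. The normed space is enlarged by a copy of the disk's space and by a depth
    coordinate; [Y] sits at depth 0 and the open cell at positive depth. *)
Lemma attach_cell_retract :
  neighborhood_retract Y -> neighborhood_retract (Y `|` chi @` disk).
Proof.
move=> [E [i0 [O0 [r0 [ci0 [oO0 iO0] cr0 rY0 ri0]]]]].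
have Y1 x : nrm x = 1 -> Y (chi x).
  by move=> /sphereE sx; apply: chi_sphere; exists x.
have dE x : nrm x <= 1 -> disk x by move=> h; apply/closed_diskE.
(* [U] extends the embedded attaching map constantly along rays. Being bounded, it has a cone
   extension [Psi] that is continuous at the center. *)
pose U (x : 'rV[R]_n) : E := i0 (chi ((nrm x)^-1 *: x)).
pose Psi (x : 'rV[R]_n) : E := nrm x *: U x.
have nrm1 (x : 'rV[R]_n) : 0 < nrm x -> nrm ((nrm x)^-1 *: x) = 1.
  by move=> x0; rewrite nrmZ ger0_norm ?invr_ge0 ?ltW// mulVf ?gt_eqF.
have cS : cts (@sphere R n) (i0 \o chi).
  apply: (cts_comp (B := Y)) => //; first by move=> x sx; apply: chi_sphere; exists x.
  by apply: sub_cts chi_cts => x /sphereE h; apply: dE; rewrite h.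
have [C C0 UC] : exists2 C, 0 < C & forall x, 0 < nrm x -> `|U x| <= C.
  have clS : closed (@sphere R n).
    have := @closed_preimage_cts _ _ setT (@sqnorm R n) [set 1] (@closedT _)
      (continuous_cts (@continuous_sqnorm R n)) (@closed_eq _ 1).
    by rewrite setTI.
  have cpS : compact (@sphere R n).
    apply: (subclosed_compact clS (@compact_closed_disk R n)) => x /sphereE h.
    by apply: dE; rewrite h.
  have := compact_bounded (continuous_compact (cts_within cS) cpS).
  move=> [B [_ hB]]; exists (Num.max (B + 1) 1); first by rewrite lt_max ltr01 orbT.
  move=> x x0; rewrite le_max; apply/orP; left; apply: (hB (B + 1)); first by rewrite ltrDl.
  by exists ((nrm x)^-1 *: x) => //; apply/sphereE/nrm1.
have cnrm A : cts A (@nrm R n) by exact/continuous_cts/continuous_nrm.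
pose P0 := [set x : 'rV[R]_n | 0 < nrm x].
have cU : cts P0 U.
  apply: (cts_comp (g := i0 \o chi) (f := fun x : 'rV[R]_n => (nrm x)^-1 *: x)
    (B := @sphere R n)) => //; first by move=> x x0; apply/sphereE/nrm1.
  apply: ctsZ; last exact: cts_id.
  by apply: ctsV => // x x0; rewrite gt_eqF.
have cPsi : continuous Psi.
  apply/cts_continuous/cts_distP => x e _ e0.
  have := nrm_ge0 x; rewrite le_eqVlt => /predU1P[x0|x0]; last first.
    have P0x : nbhs x P0.
      have o : nbhs (nrm x) [set t | 0 < t].
        by apply: open_nbhs_nbhs; split=> //; exact: open_gt.
      exact: (continuous_nrm o).
    have /cts_distP cP : cts P0 Psi by exact: ctsZ.
    by apply: filterS2 P0x (cP x e x0 e0) => y Py h _; exact: h.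
  have Psi0 : Psi x = 0 by rewrite /Psi -x0 scale0r.
  have eC : 0 < e / C by rewrite divr_gt0.
  have /cts_distP/(_ x _ I eC) := cnrm setT.
  apply: filterS => y /(_ I) + _; rewrite Psi0 -x0 !sub0r !normrN.
  rewrite ger0_norm ?nrm_ge0// ltr_pdivlMr// => h.
  rewrite /Psi normrZ ger0_norm ?nrm_ge0//.
  have := nrm_ge0 y; rewrite le_eqVlt => /predU1P[<-|y0]; first by rewrite mul0r.
  by apply: le_lt_trans h; rewrite ler_wpM2l ?nrm_ge0// UC.
(* On the sphere [j x] is [(i0 (chi x), 0, 0)], matching the embedding of [Y]. At positive depth [x]
   is recovered as the quotient [xx] of the last two components. *)
pose j (x : 'rV[R]_n) : (E * 'rV[R]_n * R^o)%type := (Psi x, (1 - nrm x) *: x, 1 - nrm x).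
have /choice[inv invP] : forall y, exists x, (chi @` @open_disk R n) y ->
    open_disk x /\ chi x = y.
  move=> y; have [[x ox xy]|ny] := pselect ((chi @` @open_disk R n) y); last by exists 0.
  by exists x.
pose iota y : (E * 'rV[R]_n * R^o)%type := if pselect (Y y) then (i0 y, 0, 0) else j (inv y).
have iotaY y : Y y -> iota y = (i0 y, 0, 0) by rewrite /iota; case: pselect.
have iotaD x : disk x -> iota (chi x) = j x.
  move=> /closed_diskE; rewrite le_eqVlt => /predU1P[x1|x1].
    have Yx := Y1 x x1; rewrite iotaY// /j /Psi /U x1 invr1 !scale1r subrr scale0r.
    by [].
  have ox : open_disk x by apply/open_diskE.
  rewrite /iota; case: pselect => [Yx|nYx]; first by case: (chi_out ox Yx).
  have [|oi ci] := invP (chi x); first by exists x.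
  by rewrite (chi_inj _ _ ci)// inE.
have cD : closed (chi @` disk).
  apply: compact_closed => //; apply: continuous_compact; first exact: cts_within.
  exact: compact_closed_disk.
have ciota : cts (Y `|` chi @` disk) iota.
  apply: ctsU => //.
    apply: (eq_cts (f := fun y => (i0 y, 0, 0) : (E * 'rV[R]_n * R^o)%type)) => [y /iotaY//|].
    apply: cts_pair; last exact: cts_cst.
    by apply: cts_pair => //; exact: cts_cst.
  apply: cts_compact_image => //; [exact: closed_closed_disk|exact: compact_closed_disk|].
  apply: (eq_cts (f := j)) => [x dx|]; first by rewrite /= iotaD.
  have c1 : cts disk (fun x => 1 - nrm x) by apply: ctsB => //; exact: cts_cst.
  apply: cts_pair => //; apply: cts_pair; first exact: continuous_cts.
  by apply: ctsZ => //; exact: cts_id.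
pose Z := (E * 'rV[R]_n * R^o)%type.
pose xx (z : Z) : 'rV[R]_n := (z.2)^-1 *: z.1.2.
(* At positive depth [dl] vanishes exactly on the points [j x]. Dividing it by the depth makes the
   collar [D <= 1] shrink toward [Y], which turns all errors into multiples of the depth. *)
pose dl (z : Z) : R := `|z.1.1 - Psi (xx z)| + `|nrm (xx z) + z.2 - 1|.
pose D (z : Z) : R := dl z / z.2.
pose clip (w : 'rV[R]_n) := (Num.max 1 (nrm w))^-1 *: w.
pose blend (z : Z) : E := (2 - 2 * D z) *: U (xx z) + (2 * D z - 1) *: z.1.1.
(* Near [Y] the norm of [xx z] exceeds 1/2; at [D = 1/2] the factor is 4, so [clip] lands on the
   sphere, where the next branch takes over. *)
pose ww (z : Z) := clip ((1 + 6 * D z) *: xx z).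
(* The cell lies along the cone z = j x, where D vanishes. For small D the point
   is pushed back to the cell along its direction xx, reaching the boundary
   sphere when D = 1/2; from D = 1/2 to D = 1 the retraction of the boundary is
   followed, moving linearly from the image of the sphere to the E-coordinate. *)
pose r (z : Z) : M := if z.2 <= 0 then r0 z.1.1 else
  if D z <= 2^-1 then chi (ww z) else if D z <= 1 then r0 (blend z) else r0 z.1.1.
have nrm_clip w : nrm (clip w) = nrm w / Num.max 1 (nrm w).
  by rewrite /clip nrmZ ger0_norm 1?mulrC// invr_ge0 le_max ler01.
have clipD w : nrm (clip w) <= 1.
  rewrite nrm_clip ler_pdivrMr ?mul1r ?le_max ?lexx ?orbT// lt_max ltr01.
  by [].
have cclip : continuous clip.
  apply: cts_continuous; apply: ctsZ; last exact: cts_id.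
  apply: ctsV => [w _|]; first by rewrite gt_eqF// lt_max ltr01.
  by apply: cts_max => //; exact: cts_cst.
pose Pz := [set z : Z | 0 < z.2].
have cz2 A : cts A (fun z : Z => z.2 : R) by apply: continuous_cts => z; exact: cvg_snd.
have cz11 A : cts A (fun z : Z => z.1.1).
  by apply: continuous_cts => z; apply: (@continuous_comp _ _ _ fst fst); exact: cvg_fst.
have cz12 A : cts A (fun z : Z => z.1.2).
  by apply: continuous_cts => z; apply: (@continuous_comp _ _ _ fst snd); [exact: cvg_fst|exact: cvg_snd].
have cxx : cts Pz xx.
  apply: ctsZ; last exact: cz12.
  by apply: ctsV => [z z0|]; [rewrite gt_eqF|exact: cz2].
have cnx : cts Pz (fun z => nrm (xx z)).
  exact: (continuous_comp_cts (@continuous_nrm R n) cxx).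
have cdl : cts Pz dl.
  apply: ctsD; apply: cts_normv.
    apply: ctsBv; first exact: cz11.
    exact: (continuous_comp_cts (g := Psi) cPsi cxx).
  apply: ctsB; last exact: cts_cst.
  by apply: ctsD; [exact: cnx|exact: cz2].
have cD' : cts Pz D.
  by apply: cts_div => // z z0; rewrite gt_eqF.
have cww : cts Pz ww.
  have carg : cts Pz (fun z => (1 + 6 * D z) *: xx z).
    apply: ctsZ; last exact: cxx.
    by apply: ctsD; [exact: cts_cst|apply: ctsM; [exact: cts_cst|exact: cD']].
  exact: (continuous_comp_cts cclip carg).
have cchi : cts Pz (chi \o ww).
  by apply: (cts_comp (B := disk)) => // z _; exact/dE/clipD.
have UZ a x : 0 < a -> U (a *: x) = U x.
  move=> a0; rewrite /U nrmZ gtr0_norm// scalerA invfM mulrAC mulVf ?mul1r//.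
  by rewrite gt_eqF.
have near_sphere z : 0 < z.2 -> z.2 < 4^-1 -> D z <= 1 ->
    [/\ 2^-1 < nrm (xx z), `|1 - nrm (xx z)| <= 2 * z.2 &
        `|U (xx z) - z.1.1| <= (2 * C + 1) * z.2].
  move=> z0 z4; rewrite /D ler_pdivrMr// mul1r /dl => hd.
  have h1 := normr_ge0 (z.1.1 - Psi (xx z)).
  have h2 := normr_ge0 (nrm (xx z) + z.2 - 1).
  have h3 : `|nrm (xx z) + z.2 - 1| <= z.2 by lra.
  have h4 : `|1 - nrm (xx z)| <= 2 * z.2.
    by move: h3; rewrite !ler_norml => /andP[? ?]; apply/andP; split; lra.
  have h5 : 2^-1 < nrm (xx z) by move: h3; rewrite !ler_norml => /andP[? ?]; lra.
  split=> //.
  have -> : U (xx z) - z.1.1 = (1 - nrm (xx z)) *: U (xx z) - (z.1.1 - Psi (xx z)).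
    by rewrite scalerBl scale1r /Psi opprB addrA subrK.
  apply: le_trans (ler_normB _ _) _; rewrite normrZ mulrDl mul1r; apply: lerD; last lra.
  have := UC (xx z); have -> : 0 < nrm (xx z) by lra.
  move=> /(_ isT) hU; rewrite (mulrC 2) -mulrA mulrC.
  by apply: ler_pM => //; exact: normr_ge0.
have blend_near z : 0 < z.2 -> z.2 < 4^-1 -> 2^-1 <= D z -> D z <= 1 ->
    `|blend z - z.1.1| <= (2 * C + 1) * z.2.
  move=> z0 z4 h1 h2; have [_ _] := near_sphere z z0 z4 h2.
  have -> : blend z - z.1.1 = (2 - 2 * D z) *: (U (xx z) - z.1.1).
    rewrite /blend scalerBr -addrA; congr (_ + _).
    by rewrite -[X in _ - X]scale1r -scalerBl -scaleNr; congr (_ *: _); ring.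
  apply: le_trans; rewrite normrZ ler_piMl// ger0_norm; lra.
have blend_half z : D z = 2^-1 -> blend z = U (xx z).
  move=> Dz; rewrite /blend Dz divff ?pnatr_eq0// subrr scale0r addr0.
  by rewrite -[RHS]scale1r; congr (_ *: _); ring.
have blend_one z : D z = 1 -> blend z = z.1.1.
  by move=> Dz; rewrite /blend Dz mulr1 subrr scale0r add0r addrK scale1r.
have r0U x : 0 < nrm x -> r0 (U x) = chi ((nrm x)^-1 *: x).
  by move=> x0; rewrite /U ri0//; apply/Y1/nrm1.
have ww_half z : D z = 2^-1 -> 2^-1 < nrm (xx z) -> ww z = (nrm (xx z))^-1 *: xx z.
  move=> Dz nz; rewrite /ww /clip nrmZ Dz ger0_norm; last lra.
  rewrite max_r; last lra.
  by rewrite scalerA; congr (_ *: _); field; rewrite gt_eqF//; lra.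
have ww_near z : 0 < z.2 -> z.2 < 4^-1 -> 0 <= D z -> D z <= 1 ->
    `|nrm (ww z) - 1| + `|Psi (ww z) - z.1.1| <= (4 * C + 3) * z.2.
  move=> z0 z4 Dz0 Dz; have [h1 h2 h3] := near_sphere z z0 z4 Dz.
  set a := (Num.max 1 (nrm ((1 + 6 * D z) *: xx z)))^-1 * (1 + 6 * D z).
  have m0 : 0 < Num.max 1 (nrm ((1 + 6 * D z) *: xx z)) by rewrite lt_max ltr01.
  have a0 : 0 < a by rewrite mulr_gt0 ?invr_gt0//; lra.
  have wE : ww z = a *: xx z by rewrite /ww /clip scalerA.
  have hn : `|nrm (ww z) - 1| <= 2 * z.2.
    have := clipD ((1 + 6 * D z) *: xx z); rewrite -/(ww z) => w1.
    have : 1 - 2 * z.2 <= nrm (ww z).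
      rewrite /ww nrm_clip ler_pdivlMr//.
      have nD : nrm (xx z) <= nrm ((1 + 6 * D z) *: xx z).
        by rewrite nrmZ ger0_norm; [rewrite ler_peMl ?nrm_ge0//; lra|lra].
      move: h2; rewrite ler_norml => /andP[? ?].
      rewrite maxEle; case: ifP => _; first by rewrite ler_piMl ?nrm_ge0//; lra.
      by rewrite mulr1; apply: le_trans nD; lra.
    by rewrite ler_norml => ?; apply/andP; split; lra.
  have : `|Psi (ww z) - z.1.1| <= C * (2 * z.2) + (2 * C + 1) * z.2.
    have -> : Psi (ww z) - z.1.1 = (nrm (ww z) - 1) *: U (xx z) + (U (xx z) - z.1.1).
      by rewrite /Psi wE UZ// scalerBl scale1r addrA subrK.
    apply: le_trans (ler_normD _ _) _; apply: lerD => //; rewrite normrZ mulrC.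
    by apply: ler_pM => //; apply: UC; lra.
  have -> : (4 * C + 3) * z.2 = 2 * z.2 + (C * (2 * z.2) + (2 * C + 1) * z.2) by ring.
  exact: lerD.
have dl_ge0 z : 0 <= dl z by rewrite addr_ge0// normr_ge0.
have D_ge0 z : 0 < z.2 -> 0 <= D z by move=> z0; rewrite divr_ge0// ltW.
have jxx x : nrm x < 1 -> xx (j x) = x.
  by move=> x1; rewrite /xx /= scalerA mulVf ?scale1r// subr_eq0 gt_eqF.
have Dj x : nrm x < 1 -> D (j x) = 0.
  move=> x1; rewrite /D /dl jxx//= subrr normr0 add0r.
  by rewrite addrCA subrr addr0 subrr normr0 mul0r.
have rY y : Y y -> r (iota y) = y.
  by move=> Yy; rewrite iotaY// /r /= lexx ri0.
have rD x : nrm x < 1 -> r (iota (chi x)) = chi x.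
  move=> x1; rewrite iotaD; last exact/dE/ltW.
  rewrite /r ifF; last by apply/negP => /=; rewrite subr_le0 leNgt x1.
  rewrite Dj// invr_ge0 ler0n /ww jxx// Dj// mulr0 addr0 scale1r /clip max_l ?ltW//.
  by rewrite invr1 scale1r.
have r_pos z : Pz z -> r z = if D z <= 2^-1 then chi (ww z) else
    if D z <= 1 then r0 (blend z) else r0 z.1.1.
  by move=> Pz'; rewrite /r ifF//; apply/negP => h; have := lt_le_trans Pz' h; rewrite ltxx.
have Pz_nbhs z : Pz z -> nbhs z Pz.
  move=> z0; have := cts_near (cz2 setT) I (open_nbhs_nbhs (conj (@open_gt _ 0) z0)).
  by apply: filterS => t; apply.
apply: (neighborhood_retract_interior (iota := iota : M -> Z) (r := r)) => //.
  move=> y [/rY//|[x /closed_diskE]]; rewrite le_eqVlt => /predU1P[x1|x1] <-.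
    by rewrite rY//; exact: Y1.
  exact: rD.
move=> y Yy; have [{}Yy|nYy] := pselect (Y y); last first.
  case: Yy => [//|[x /closed_diskE]]; rewrite le_eqVlt => /predU1P[x1|x1] xy.
    by case: nYy; rewrite -xy; exact: Y1.
  exists [set z | Pz z /\ D z < 2^-1].
    rewrite -xy iotaD; last exact/dE/ltW.
    have Pj : Pz (j x) by rewrite /Pz /= subr_gt0.
    have o : nbhs (D (j x)) [set t | t < 2^-1].
      by apply: open_nbhs_nbhs; split; [exact: open_lt|rewrite /= Dj].
    by apply: filterS2 (Pz_nbhs _ Pj) (cts_near cD' Pj o) => z Pz' h; split=> //; exact: h.
  have rE z : Pz z /\ D z < 2^-1 -> r z = chi (ww z).
    by move=> [Pz' Dz]; rewrite r_pos// ltW.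
  split; first by apply: (eq_cts (f := chi \o ww)) => [z /rE//|]; apply: sub_cts cchi => z [].
  by move=> z /rE ->; right; exists (ww z) => //; exact/dE/clipD.
have [e e0 eO] : exists2 e, 0 < e & forall v, `|i0 y - v| < 2 * e -> O0 v.
  have := open_nbhs_nbhs (conj oO0 (iO0 y Yy)); move=> /nbhs_ballP[e /= e0 h].
  exists (e / 2); first by rewrite divr_gt0.
  by move=> v hv; apply: h; rewrite -ball_normE /=; lra.
have C21 : 0 < 2 * C + 1 by lra.
pose eta := Num.min 4^-1 (e / (2 * C + 1)).
have eta0 : 0 < eta by rewrite lt_min invr_gt0 ltr0n divr_gt0.
have etaP s : s < eta -> s < 4^-1 /\ (2 * C + 1) * s < e.
  by rewrite lt_min ltr_pdivlMr// => /andP[-> ?]; split=> //; rewrite mulrC.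
pose W := [set z : Z | `|i0 y - z.1.1| < e /\ z.2 < eta].
have ng1 z v : W z -> `|v - z.1.1| < e -> O0 v.
  move=> [h1 _] h2; apply: eO; apply: le_lt_trans (ler_distD z.1.1 _ _) _.
  by rewrite (distrC z.1.1); lra.
have WO z : W z -> O0 z.1.1 by move=> Wz; apply: ng1 (Wz) _; rewrite subrr normr0.
have blO z : W z -> Pz z -> 2^-1 <= D z -> D z <= 1 -> O0 (blend z).
  move=> Wz Pz' h1 h2; have [h3 h4] := etaP _ Wz.2.
  by apply: ng1 (Wz) _; apply: le_lt_trans h4; exact: blend_near.
exists W.
  rewrite iotaY//.
  have /cts_distP/(_ (i0 y, 0, 0) e I e0) o1 := cz11 setT.
  have o2 := cts_near (cz2 setT) (I : setT ((i0 y, 0, 0) : Z))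
    (open_nbhs_nbhs (conj (@open_lt _ eta) eta0)).
  by apply: filterS2 o1 o2 => z h1 h2; split; [exact: h1|exact: h2].
split; last first.
  move=> z Wz; rewrite /r; case: leP => z0; first by left; exact/rY0/WO.
  case: leP => D1; first by right; exists (ww z) => //; exact/dE/clipD.
  by case: leP => D2; left; apply: rY0; [apply: blO => //; exact: ltW|exact: WO].
have cWP : cts (W `&` Pz) r.
  apply: (eq_cts (f := fun z => if D z <= 2^-1 then chi (ww z) else
      if D z <= 1 then r0 (blend z) else r0 z.1.1)) => [z [_ Pz']|].
    by rewrite r_pos.
  apply: cts_paste.
  - by apply: sub_cts cD' => z [].
  - by apply: sub_cts cchi => z [[]].
  - apply: cts_paste.
    + by apply: sub_cts cD' => z [[]].
    + apply: (cts_comp (f := blend) (g := r0) (B := O0)) => //.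
        by move=> z [[[Wz Pz'] /= h1] /= h2]; exact: blO.
      have cDQ : cts (W `&` Pz `&` [set z | 2^-1 <= D z] `&` [set z | D z <= 1]) D.
        by apply: sub_cts cD' => z [[[]]].
      apply: ctsDv; apply: ctsZ.
      * by apply: ctsB; [exact: cts_cst|apply: ctsM => //; exact: cts_cst].
      * apply: (cts_comp (f := xx) (g := U) (B := P0)) => //; last first.
          by apply: sub_cts cxx => z [[[]]].
        move=> z [[[Wz Pz'] _] /= h2]; have [h3 _] := etaP _ Wz.2.
        by have [h _ _] := near_sphere z Pz' h3 h2; rewrite /P0 /=; lra.
      * by apply: ctsB; [apply: ctsM => //; exact: cts_cst|exact: cts_cst].
      * exact: cz11.
    + apply: (cts_comp (f := fun z : Z => z.1.1) (g := r0) (B := O0)) => //.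
      by move=> z [[[Wz _] _] _]; exact: WO.
    + by move=> z _ /blend_one ->.
  - move=> z [Wz Pz'] Dz; have [h3 _] := etaP _ Wz.2.
    have D1 : D z <= 1 by rewrite Dz; lra.
    have [h _ _] := near_sphere z Pz' h3 D1.
    rewrite D1 blend_half// r0U; last lra.
    by rewrite ww_half.
apply/ctsP => z P Wz; have [z0|z0] := ltP 0 z.2.
  move=> rP; apply: filterS2 (Pz_nbhs _ z0) (cts_near cWP (conj Wz z0) rP) => t h1 h2 h3.
  exact: h2.
rewrite {1}/r z0 => rP.
have [d d0 hd] : exists2 d, 0 < d & forall v, `|z.1.1 - v| < d -> P (r0 v).
  have oz : nbhs z.1.1 O0 by apply: open_nbhs_nbhs; split => //; exact: WO.
  have : nbhs z.1.1 (fun v => P (r0 v)).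
    by apply: filterS2 oz (cts_near cr0 (WO _ Wz) rP) => v h1 h2; exact: h2.
  move=> /nbhs_ballP[d /= d0 h]; exists d => // v hv; apply: h.
  by rewrite -ball_normE.
pose h w := `|nrm w - 1| + `|Psi w - z.1.1|.
have ch : continuous h.
  apply: cts_continuous; apply: ctsD; apply: cts_normv.
    by apply: ctsB => //; exact: cts_cst.
  by apply: ctsBv; [exact: continuous_cts|exact: cts_cst].
have h_ge0 w : 0 <= h w by rewrite addr_ge0// normr_ge0.
(* [h w = 0] means that [w] is on the sphere with [Psi w = z.1.1], so [chi w] equals [r0 z.1.1] and
   lies in [P]. By compactness of the disk, a small [h w] already forces [chi w] into [P]. *)
have [d2 d20 hd2] : exists2 d2, 0 < d2 & forall w, nrm w <= 1 -> h w < d2 -> P (chi w).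
  have : \forall i \near 0^'+, disk `<=` (fun w => disk w -> h w < i -> P (chi w)).
    apply: (compact_near_coveringP disk).1 => [|w dw]; first exact: compact_closed_disk.
    have := h_ge0 w; rewrite le_eqVlt => /predU1P[hw|hw].
      have Pw : nbhs (chi w) P.
        have hw1 := normr_ge0 (nrm w - 1); have hw2 := normr_ge0 (Psi w - z.1.1).
        have /normr0_eq0/eqP : `|nrm w - 1| = 0 by move: hw; rewrite /h; lra.
        rewrite subr_eq0 => /eqP w1.
        have /normr0_eq0/eqP : `|Psi w - z.1.1| = 0 by move: hw; rewrite /h; lra.
        rewrite subr_eq0 /Psi w1 scale1r => /eqP Uw.
        by move: rP; rewrite -Uw r0U ?w1// ?w1 invr1 scale1r.
      exists ((fun w => disk w -> P (chi w)), setT); first by split; [exact: cts_near Pw|exact: filterT].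
      by move=> [v i] [/= Pv _] dv _; exact: Pv.
    exists ([set v | h w / 2 < h v], [set i | i < h w / 2]).
      split=> /=; last by apply: nbhs_right_lt; rewrite divr_gt0.
      have o : nbhs (h w) [set t | h w / 2 < t].
        by apply: open_nbhs_nbhs; split; [exact: open_gt|rewrite /=; lra].
      exact: ch o.
    by move=> [v i] [/= h1 h2] _ h3; lra.
  move=> near0; have /filter_ex[i [/= i0' hi]] : \forall i \near 0^'+,
      0 < i /\ disk `<=` (fun w => disk w -> h w < i -> P (chi w)).
    by apply: filterS2 near0 (nbhs_right_gt 0).
  by exists i => // w /dE dw; exact: hi.
have C43 : 0 < 4 * C + 3 by lra.
pose mu := Num.min (d / 2 / (2 * C + 1)) (d2 / 2 / (4 * C + 3)).
have muP s : s < mu -> (2 * C + 1) * s < d / 2 /\ (4 * C + 3) * s < d2 / 2.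
  rewrite lt_min (ltr_pdivlMr _ _ C21) (ltr_pdivlMr _ _ C43) => /andP[? ?].
  by split; rewrite mulrC.
have mu0 : 0 < mu by rewrite lt_min !divr_gt0.
have dd0 : 0 < Num.min (d / 2) (d2 / 2) by rewrite lt_min !divr_gt0.
have /cts_distP/(_ z _ I dd0) o1 := cz11 setT.
have o2 := cts_near (cz2 setT) (I : setT z)
  (open_nbhs_nbhs (conj (@open_lt _ mu) (le_lt_trans z0 mu0))).
apply: filterS2 o1 o2 => t /(_ I) + /(_ I) /= /muP[s1 s2] Wt.
rewrite lt_min => /andP[t1 t2]; have [t4 _] := etaP _ Wt.2.
rewrite /r; case: leP => t0; first by apply: hd; lra.
have Dt0 := D_ge0 t t0.
case: leP => D1.
  apply: hd2; first exact: clipD.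
  have Dt1 : D t <= 1 by lra.
  have hww := ww_near t t0 t4 Dt0 Dt1.
  have : h (ww t) <= `|nrm (ww t) - 1| + `|Psi (ww t) - t.1.1| + `|z.1.1 - t.1.1|.
    by rewrite /h -addrA lerD2l (distrC z.1.1) ler_distD.
  by lra.
case: leP => D2; last by apply: hd; lra.
apply: hd; apply: le_lt_trans (ler_distD t.1.1 _ _) _.
by have := blend_near t t0 t4 (ltW D1) D2; rewrite (distrC t.1.1); lra.
Qed.

End AttachCell.

End Retracts.

(** * Finite subcomplexes *)

Section Towers.
Variables (R : realType) (M : topologicalType) (cw : cw_structure R M) (x0 : M).
Local Notation chi e := (@char_map R M cw e).
Local Notation cells := (set (cell cw)).
Implicit Types (T S : cells) (e : cell cw).

Definition carrier T : set M := \bigcup_(e in T) open_cell e.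

(* the finite subcomplexes, built one cell at a time *)
Inductive tower : cells -> Prop :=
| tower0 : tower set0
| towerS T e : tower T -> ~ T e -> chi e @` @sphere R (dim_cell e) `<=` carrier T ->
    tower (e |` T).

Definition covered S := exists2 T, tower T & S `<=` T.

Lemma sub_carrier T S : T `<=` S -> carrier T `<=` carrier S.
Proof. by move=> TS y [e Te h]; exists e => //; exact: TS. Qed.

Lemma carrierU T S : carrier (T `|` S) = carrier T `|` carrier S.
Proof. exact: bigcup_setU. Qed.

Lemma carrier1 e : carrier [set e] = open_cell e.
Proof. exact: bigcup_set1. Qed.

Lemma diskE e : @closed_disk R (dim_cell e) = @open_disk R _ `|` @sphere R _.
Proof.
apply/seteqP; split=> x; rewrite /closed_disk /open_disk /sphere /=.
  by rewrite le_eqVlt => /predU1P[->|]; [right|left].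
by move=> [/ltW//|->].
Qed.

Lemma carrierS T e : chi e @` @sphere R (dim_cell e) `<=` carrier T ->
  carrier (e |` T) = carrier T `|` chi e @` @closed_disk R (dim_cell e).
Proof.
move=> sT; rewrite carrierU carrier1 diskE image_setU /open_cell; apply/seteqP; split=> y.
  by move=> [?|?]; [right; left|left].
by move=> [?|[?|/sT ?]]; [right|left|right].
Qed.

Lemma tower_disk T e : tower T -> T e ->
  chi e @` @closed_disk R (dim_cell e) `<=` carrier T.
Proof.
elim=> [//|S e' tS IH nS sS] [->|Se].
  by rewrite carrierS// => y h; right.
by move=> y /(IH Se); rewrite carrierU; right.
Qed.

Lemma covered_cells T (P : cells) : covered T ->
  (forall e S, P e -> covered S -> covered (e |` S)) -> finite_set P -> covered (P `|` T).
Proof.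
move=> cT add /(@finite_seqP {classic (cell cw)})[s Ps].
have {Ps} : P `<=` [set e | (e : {classic (cell cw)}) \in s] by rewrite Ps.
elim: s P add => [|e s IH] P add Ps.
  rewrite (_ : P = set0) ?set0U//.
  by rewrite -subset0 => e /Ps; rewrite /= in_nil.
have [Pe|nPe] := pselect (P e); last first.
  apply: IH => // e' Pe'; have := Ps e' Pe'; rewrite /= inE => /predU1P[ee|//].
  by case: nPe; rewrite -ee.
have -> : P `|` T = e |` ((P `&` [set e | (e : {classic (cell cw)}) \in s]) `|` T).
  apply/seteqP; split=> e'.
    move=> [Pe'|?]; last by right; right.
    have := Ps e' Pe'; rewrite /= inE => /predU1P[->|?]; [by left|by right; left].
  by move=> [->|[[? _]|?]]; [left|left|right].
by apply: (add e) => //; apply: IH => [e' S [Pe' _]|e' [] //]; exact: add.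
Qed.

(** Induction on the dimension of the cell: its boundary lies in finitely many lower cells, which
    are added first. The hypothesis must allow any [S], since each added cell enlarges it. *)
Lemma coveredS S e : covered S -> covered (e |` S).
Proof.
suff h n e' S' : (dim_cell e' < n)%N -> covered S' -> covered (e' |` S') by exact: h (leqnn _).
elim: n e' S' => [//|n IH] {}e {}S; rewrite ltnS => en cS.
have [D [fD dD sD]] := closure_finite e.
have [T tT DST] : covered (D `|` S).
  apply: covered_cells => // e' S' De'; apply: IH; exact: leq_trans (dD _ De') en.
have [Te|nTe] := pselect (T e).
  by exists T => // e' [->//|Se']; apply: DST; right.
exists (e |` T).
  apply: towerS => // y /sD; apply: sub_carrier => e' De'; apply: DST; by left.
by move=> e' [->|Se']; [left|right; apply: DST; right].
Qed.

Lemma covered_tower T : tower T -> covered T. Proof. by exists T. Qed.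

Lemma covered0 : covered set0. Proof. exact/covered_tower/tower0. Qed.

Lemma covered1 e : covered [set e].
Proof. by rewrite -[X in covered X]setU0; exact/coveredS/covered0. Qed.

Lemma sub_covered S S' : S `<=` S' -> covered S' -> covered S.
Proof. by move=> SS' [T tT S'T]; exists T => // e /SS'/S'T. Qed.

Lemma coveredU S S' : covered S -> covered S' -> covered (S `|` S').
Proof.
move=> [T tT ST] cS'; apply: (@sub_covered _ (T `|` S')).
  by move=> e [/ST ?|?]; [left|right].
elim: tT => [|T' e tT' IH _ _]; first by rewrite set0U.
by rewrite -setUA; exact: coveredS.
Qed.

Lemma covered_bigcup T (P : cell cw -> cells) : covered T ->
  (forall e, covered (P e)) -> covered (\bigcup_(e in T) P e).
Proof.
move=> [T' tT' TT'] cP; apply: (@sub_covered _ (\bigcup_(e in T') P e)).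
  by move=> e [e' /TT' Te' h]; exists e'.
elim: tT' => [|T'' e tT'' IH _ _]; first by rewrite bigcup_set0; exact: covered0.
by rewrite bigcup_setU1; exact: coveredU.
Qed.

(** A tower has finitely many cells, so one neighborhood per cell can be intersected. *)
Lemma near_tower T (Y : topologicalType) (y : Y) (P : cell cw -> set Y) : tower T ->
  (forall e, nbhs y (P e)) -> \forall z \near y, forall e, T e -> P e z.
Proof.
move=> tT yP; elim: tT => [|T' e tT' IH _ _]; first exact: filterE.
by apply: filterS2 (yP e) IH => z Pz h e' [->//|]; exact: h.
Qed.

Lemma closed_carrier T : tower T -> closed (carrier T).
Proof.
elim=> [|S e tS IH _ sS]; first by rewrite /carrier bigcup_set0; exact: closed0.
rewrite carrierS//; apply: closedU => //.
apply: compact_closed; first exact: (cw_hausdorff cw).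
exact: (continuous_compact (@char_map_continuous _ _ cw e) (@compact_closed_disk R _)).
Qed.

Lemma carrier_retract T : tower T -> neighborhood_retract R (carrier T).
Proof.
elim=> [|S e tS IH nSe sS].
  (* The empty carrier is a retract of the empty open set; [x0] is a default value. *)
  exists (R^o : normedModType R), (fun=> 0), set0, (fun=> x0); rewrite /carrier bigcup_set0.
  by split=> //; split=> //; exact: open0.
rewrite carrierS//; apply: attach_cell_retract => //.
- exact: (cw_hausdorff cw).
- exact: closed_carrier.
- exact/within_cts/char_map_continuous.
- exact: char_map_inj.
- move=> x ox [e' Se' h]; have ee' : e' = e.
    by apply: (open_cells_disjoint (c := cw)) => //; exists (chi e x); split => //; exists x.
  by apply: nSe; rewrite -ee'.
Qed.

Lemma point_cell_exists y : exists e : cell cw, open_cell e y.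
Proof.
have : [set: M] y by []; rewrite -(open_cells_cover cw) => -[e _ h]; by exists e.
Qed.

Definition point_cell y : cell cw := sval (cid (point_cell_exists y)).

Lemma point_cellP y : open_cell (point_cell y) y.
Proof. exact: svalP (cid (point_cell_exists y)). Qed.

Lemma carrierP T y : carrier T y <-> T (point_cell y).
Proof.
split=> [[e Te ey]|Ty]; last by exists (point_cell y) => //; exact: point_cellP.
have <- // : e = point_cell y.
by apply: (open_cells_disjoint (c := cw)) => //; exists y; split=> //; exact: point_cellP.
Qed.

End Towers.

Section LocallyFinite.
Variables (R : realType) (M : topologicalType) (cw : cw_structure R M).
Variables (Y : metricType R) (A : set Y) (F : Y -> M) (x : Y).
Hypothesis cF : cts A F.
Hypothesis Ax : A x.
Local Notation cells := (set (cell cw)).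
Local Notation pcell := (point_cell cw).

(* Otherwise there are points converging to x whose values lie in pairwise
   distinct cells; such a set of values is closed in the weak topology. *)
Lemma locally_in_tower : exists2 T : cells, tower T &
  \forall y \near x, A y -> carrier T (F y).
Proof.
apply: contrapT => none.
(* One step of the construction: from a tower and n, a point within 1/(n+1) of [x] whose value
   leaves the tower, and a larger tower that contains its cell. *)
have : forall Tn : cells * nat, exists yT : Y * cells, tower Tn.1 ->
    [/\ A yT.1 /\ ball x Tn.2.+1%:R^-1 yT.1, ~ carrier Tn.1 (F yT.1), tower yT.2,
        Tn.1 `<=` yT.2 & yT.2 (pcell (F yT.1))].
  move=> [T n]; have [tT|nT] := pselect (tower T); last by exists (x, set0).
  have [y [Ay xy Ty]] : exists y, [/\ A y, ball x n.+1%:R^-1 y & ~ carrier T (F y)].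
    apply: contrapT => none'; apply: none; exists T => //.
    have xb : nbhs x (ball x n.+1%:R^-1) by apply: nbhsx_ballx; rewrite invr_gt0 ltr0n.
    apply: filterS xb => y xy Ay; apply: contrapT => nTy; apply: none'; exists y.
    by split.
  have [T' tT' h] := coveredS (pcell (F y)) (covered_tower tT).
  exists (y, T') => _; split=> //; [by move=> e Te; apply: h; right|by apply: h; left].
move=> /choice[s sP].
have [T0 tT0 T0x] := covered1 (pcell (F x)).
pose tw := fix tw n := if n is n'.+1 then (s (tw n', n')).2 else T0.
pose pt n := (s (tw n, n)).1.
have t_tw n : tower (tw n) by elim: n => [//|n IH]; have [_ _ t _ _] := sP (tw n, n) IH.
have twS n : tw n `<=` tw n.+1 by have [_ _ _ h _] := sP (tw n, n) (t_tw n).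
have tw_le m n : (m <= n)%N -> tw m `<=` tw n.
  by move=> /subnK <-; elim: (n - m)%N => [//|k IH] e /IH; exact: twS.
have pt_new n : ~ tw n (pcell (F (pt n))).
  by have [_ h _ _ _] := sP (tw n, n) (t_tw n) => /carrierP.
have pt_old n : tw n.+1 (pcell (F (pt n))) by have [_ _ _ _ h] := sP (tw n, n) (t_tw n).
have bound (T : cells) : tower T -> exists m, forall n, (m <= n)%N -> ~ carrier T (F (pt n)).
  elim=> [|S e _ [m mP] _ _]; first by exists 0%N => n _ [].
  have [[n mn en]|nn] := pselect (exists2 n, (m <= n)%N & pcell (F (pt n)) = e).
    exists n.+1 => k nk; rewrite carrierU => -[/carrierP ek|]; last first.
      by apply: mP; exact: leq_trans (ltnW nk).
    apply: (pt_new k); apply: (tw_le _ _ nk).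
    by rewrite [pcell _]ek -en; exact: pt_old.
  exists m => k mk; rewrite carrierU => -[/carrierP ek|]; last exact: mP.
  by apply: nn; exists k.
pose V := range (F \o pt).
have clV : closed V.
  (* The image of a closed cell lies in a tower, and by [bound] only finitely many of the chosen
     values do. *)
  apply: (cw_weak_topology (c := cw)) => e.
  have [T tT Te] := covered1 e; have [m mP] := bound T tT.
  have -> : closed_disk (n := dim_cell e) `&` char_map (e := e) @^-1` V =
      closed_disk (n := dim_cell e) `&` char_map (e := e) @^-1` [set F (pt n) | n in `I_m].
    apply/seteqP; split=> z [dz] /= [n nm nz]; split=> //; last by exists n.
    exists n => //=; rewrite ltnNge; apply/negP => mn; apply: (mP _ mn).
    have -> : F (pt n) = char_map z := nz.
    by apply: (tower_disk tT (Te e erefl)); exists z.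
  apply: closed_preimage_cts; first exact: closed_closed_disk.
    exact/within_cts/char_map_continuous.
  have /hausdorff_accessible/accessible_finite_set_closed := cw_hausdorff cw; apply.
  by apply: finite_image; exact: finite_II.
have Vx : ~ V (F x).
  move=> [n _ /= nx]; apply: (pt_new n); rewrite nx; apply: (tw_le 0%N) => //; exact: T0x.
have oV : nbhs (F x) (~` V) by apply: open_nbhs_nbhs; split=> //; exact: closed_openC.
have := cts_near cF Ax oV => /nbhs_ballP[d /= d0 dV].
pose n := Num.bound d^-1.
have nd : n.+1%:R^-1 <= d.
  rewrite invf_ple ?posrE//; apply: ltW.
  have : d^-1 < n%:R by apply: archi_boundP; rewrite invr_ge0 ltW.
  by move=> h; apply: lt_trans h _; rewrite ltr_nat.
have [[Apt xpt] _ _ _ _] := sP (tw n, n) (t_tw n).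
by case: (dV (pt n) (le_ball nd xpt) Apt); exists n.
Qed.

End LocallyFinite.

Section Simple.
Variables (R : realType) (M : topologicalType).

Definition simple (S : set M) := forall (p q : R -> M) a b, is_path p a b -> is_path q a b ->
  (forall t, itv01 t -> S (p t) /\ S (q t)) -> hpath p q.

(* A substitute for a locally equiconnected structure: short paths lam between
   nearby points, and short homotopies filling filling nearby triangles. The pieces
   replace compact subsets, the carriers of finite subcomplexes. *)
Record local_structure := LocalStructure {
  piece : set (set M);
  lam : M -> M -> R -> M;
  good : M -> M -> M -> Prop;
  filling : M -> M -> M -> R * R -> M;
  lam_path : forall y y', is_path (lam y y') y y';
  lam_sym : forall y y' t, lam y y' t = lam y' y (1 - t);
  good_homotopy : forall y0 y1 y2, good y0 y1 y2 ->
    homotopy (filling y0 y1 y2) (pcat (lam y0 y1) (lam y1 y2)) (lam y0 y2);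
  piece_directed : forall T T', piece T -> piece T' ->
    exists2 T'', piece T'' & T `|` T' `<=` T'';
  piece_near : forall (Y : metricType R) (A : set Y) (F : Y -> M) x, cts A F -> A x ->
    exists2 T, piece T & \forall y \near x, A y -> T (F y);
  small_triangle : forall T y W, piece T -> T y -> nbhs y W -> exists2 W' : set M, nbhs y W' &
    forall y0 y1 y2, W' y0 -> W' y1 -> W' y2 -> T y0 -> T y1 -> T y2 ->
    [/\ good y0 y1 y2, forall st, square st -> W (filling y0 y1 y2 st) &
        forall t, itv01 t -> W (lam y0 y1 t)];
  small_simple : forall T y, piece T -> T y -> exists2 S, simple S & exists2 W' : set M, nbhs y W' &
    forall y1 y2, W' y1 -> W' y2 -> T y1 -> T y2 ->
    S y1 /\ forall t, itv01 t -> S (lam y1 y2 t) }.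

End Simple.

Section Straight.
Variables (R : realType) (M : topologicalType) (Y : set M).

Record retraction := Retraction {
  re : normedModType R; ri : M -> re; ro : set re; rr : re -> M;
  rP : retraction_data Y ri ro rr }.

Lemma retraction_exists : neighborhood_retract R Y -> exists D : retraction, True.
Proof. by move=> [E [i [O [r h]]]]; exists (Retraction h). Qed.

Variable D : retraction.

Definition seg u v t : re D := (1 - t) *: ri D u + t *: ri D v.

Definition segok u v := forall t, itv01 t -> ro (seg u v t).

Lemma segC u v t : seg u v t = seg v u (1 - t).
Proof. by rewrite /seg subKr addrC. Qed.

Lemma segxx u t : seg u u t = ri D u.
Proof. by rewrite /seg -scalerDl subrK scale1r. Qed.

Lemma seg0 u v : seg u v 0 = ri D u.
Proof. by rewrite /seg subr0 scale1r scale0r addr0. Qed.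

Lemma seg1 u v : seg u v 1 = ri D v.
Proof. by rewrite segC subrr seg0. Qed.

Lemma segokC u v : segok u v -> segok v u.
Proof. by move=> h t /andP[t0 t1]; rewrite segC; apply: h; apply/andP; split; lra. Qed.

Lemma retract_in u v t : segok u v -> itv01 t -> Y (rr (seg u v t)).
Proof. by have [_ _ _ h _] := rP D => ok t01; apply: h; exact: ok. Qed.

Lemma cts_seg (S : topologicalType) (B : set S) (f g : S -> M) (s : S -> R) :
  (forall z, B z -> Y (f z) /\ Y (g z)) -> cts B f -> cts B g -> cts B s ->
  (forall z, B z -> ro (seg (f z) (g z) (s z))) ->
  cts B (fun z => rr (seg (f z) (g z) (s z))).
Proof.
move=> BY cf cg cs ok; have [ci _ cr _ _] := rP D.
apply: (cts_comp (B := ro (r := D)) (g := rr (r := D))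
  (f := fun z => seg (f z) (g z) (s z))) => //.
apply: ctsDv; apply: ctsZ => //.
- by apply: ctsB => //; exact: cts_cst.
- by apply: (cts_comp (B := Y) (f := f) (g := ri D)) => // z /BY[].
- by apply: (cts_comp (B := Y) (f := g) (g := ri D)) => // z /BY[].
Qed.

Lemma segok_path u v : Y u -> Y v -> segok u v -> is_path (fun t => rr (seg u v t)) u v.
Proof.
move=> Yu Yv ok; have [_ _ _ _ rK] := rP D; split; last 2 first.
- by rewrite seg0 rK.
- by rewrite seg1 rK.
apply: (cts_seg (f := fun=> u) (g := fun=> v) (s := id)) => //.
- exact: cts_cst.
- exact: cts_cst.
- exact: cts_id.
Qed.

Lemma segok_homotopy p q a b : is_path p a b -> is_path q a b ->
  (forall t, itv01 t -> [/\ Y (p t), Y (q t) & segok (p t) (q t)]) ->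
  homotopy (fun st => rr (seg (p st.2) (q st.2) st.1)) p q.
Proof.
move=> [cp p0 p1] [cq q0 q1] ok; have [_ _ _ _ rK] := rP D; split=> /=.
- apply: (cts_seg (f := fun st => p st.2) (g := fun st => q st.2) (s := fst)).
  + by move=> [s t] [_ /= /ok[]].
  + by apply: (cts_comp (B := itv01) (g := p)) => // [[s t] []//|]; exact: cts_snd.
  + by apply: (cts_comp (B := itv01) (g := q)) => // [[s t] []//|]; exact: cts_snd.
  + exact: cts_fst.
  + by move=> [s t] [/= s01 /ok[_ _]]; apply.
- by move=> t /ok[Yp _ _]; rewrite seg0 rK.
- by move=> t /ok[_ Yq _]; rewrite seg1 rK.
- by move=> s _; have [Yp _ _] := ok 0 (itv01_0 R); rewrite q0 -p0 segxx rK.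
- by move=> s _; have [Yp _ _] := ok 1 (itv01_1 R); rewrite q1 -p1 segxx rK.
Qed.

(** Balls in the normed space are convex: the segment between two points near [y] stays in the
    domain of the retraction and is retracted into [W]. *)
Lemma near_seg (y : M) (W : set M) : closed Y -> nbhs y W -> exists2 W' : set M, nbhs y W' &
  forall u v, W' u -> W' v -> Y u -> Y v ->
  segok u v /\ forall t, itv01 t -> W (rr (seg u v t)).
Proof.
move=> clY yW; have [Yy|nYy] := pselect (Y y); last first.
  exists (~` Y); first by apply: open_nbhs_nbhs; split=> //; exact: closed_openC.
  by move=> u v nYu _ /nYu.
have [ci [oO iO] cr rY rK] := rP D.
have rW : nbhs (rr (ri D y)) W by rewrite rK.
have oy : nbhs (ri D y) (ro (r := D)) by apply: open_nbhs_nbhs; split=> //; exact: iO.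
have : nbhs (ri D y) (fun z : re D => ro (r := D) z /\ W (rr z)).
  by apply: filterS2 oy (cts_near cr (iO y Yy) rW) => z h1 h2; split=> //; exact: h2.
move=> /nbhs_ballP[e /= e0 he].
exists (fun u => Y u -> `|ri D y - ri D u| < e); first by move/cts_distP: ci; apply.
move=> u v hu hv Yu Yv; have {}hu := hu Yu; have {}hv := hv Yv.
suff h t : itv01 t -> ro (seg u v t) /\ W (rr (seg u v t)).
  by split=> t /h[].
move=> /andP[t0 t1]; apply: he; rewrite -ball_normE /=.
have -> : ri D y - seg u v t = (1 - t) *: (ri D y - ri D u) + t *: (ri D y - ri D v).
  by rewrite /seg !scalerBr addrACA -scalerDl subrK scale1r opprD.
apply: le_lt_trans (ler_normD _ _) _; rewrite !normrZ !ger0_norm//; last by lra.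
have [->|tn] := eqVneq t 0; first by rewrite mul0r subr0 mul1r addr0.
have tp : 0 < t by rewrite lt_neqAle eq_sym tn.
have : t * `|ri D y - ri D v| < t * e by rewrite ltr_pM2l.
have : (1 - t) * `|ri D y - ri D u| <= (1 - t) * e by rewrite ler_wpM2l ?subr_ge0// ltW.
by rewrite !mulrBl !mul1r; lra.
Qed.

End Straight.

Section CWLocalStructure.
Variables (R : realType) (M : topologicalType) (cw : cw_structure R M).
Hypothesis connected : forall a b : M, exists e, is_path (R := R) e a b.
Local Notation cells := (set (cell cw)).
Local Notation pcell := (point_cell cw).
Implicit Types (S T : cells) (y u v : M) (W : set M).

(** Retractions exist for finite subcomplexes, so each pair of points uses the one of a subcomplex
    chosen from their two cells. Short paths may thus depend discontinuously on their ends. That is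
    harmless: inside a finite subcomplex only finitely many pairs and triples of cells occur, and
    the neighborhoods they require can be intersected. *)
Lemma cw_local_structure : M -> exists ls : local_structure R M, True.
Proof.
move=> x0.
have /choice[Fin FinP] : forall S, exists T : cells, tower T /\ (covered S -> S `<=` T).
  move=> S; have [[T tT ST]|nS] := pselect (covered S); first by exists T.
  by exists set0; split; [exact: tower0|move=> /nS].
have clF S : closed (carrier (Fin S)) by apply: closed_carrier; case: (FinP S).
have [dat _] : exists dat : forall S, retraction R (carrier (Fin S)), True.
  by exists (fun S => sval (cid (retraction_exists (carrier_retract x0 (FinP S).1)))).
have [lt [lt_total _]] := well_founded_total {classic M}.
have /choice[pth pthP] : forall ab : M * M, exists e, is_path (R := R) e ab.1 ab.2.
  by move=> ab; exact: connected.
(* A fallback for points too far apart to be joined by a retracted segment; the order makes it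
   symmetric under reversal. *)
pose base u v : R -> M := if (u : {classic M}) == v then fun=> u else
  if lt u v then pth (u, v) else pback (pth (v, u)).
have base_path u v : is_path (base u v) u v.
  rewrite /base; case: eqVneq => [->|_]; first exact: path_cst.
  by case: ifP => _; [exact: pthP|exact/path_rev/pthP].
have base_sym u v t : base u v t = base v u (1 - t).
  rewrite /base (eq_sym (v : {classic M})); case: eqVneq => [->//|uv].
  rewrite (lt_total _ _ uv); case: (lt v u) => //=.
  by rewrite /pback subKr.
pose lamS S u v t := if `[< segok (dat S) u v >] then rr (seg (dat S) u v t) else base u v t.
have lamS_sym S u v t : lamS S u v t = lamS S v u (1 - t).
  rewrite /lamS; case: asboolP => h.
    by rewrite (asboolT (segokC h)) segC.
  have nh : ~ segok (dat S) v u by move=> /segokC.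
  by rewrite (asboolF nh); exact: base_sym.
have lamS_path S u v : carrier (Fin S) u -> carrier (Fin S) v -> is_path (lamS S u v) u v.
  move=> Su Sv; have [ok|nok] := pselect (segok (dat S) u v).
    have -> : lamS S u v = fun t => rr (seg (dat S) u v t).
      by apply/funext => t; rewrite /lamS asboolT.
    exact: segok_path.
  have -> // : lamS S u v = base u v by apply/funext => t; rewrite /lamS asboolF.
pose P2 a b : cells := [set a] `|` [set b].
have cov2 a b : covered (P2 a b) by apply: coveredU; exact: covered1.
have Fin2 a b u v : pcell u = a -> pcell v = b ->
    carrier (Fin (P2 a b)) u /\ carrier (Fin (P2 a b)) v.
  move=> ua vb; have h := (FinP (P2 a b)).2 (cov2 a b).
  by split; apply/carrierP; [rewrite ua|rewrite vb]; apply: h; [left|right].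
pose lm u v := lamS (P2 (pcell u) (pcell v)) u v.
have lm_path u v : is_path (lm u v) u v.
  by have [h1 h2] := Fin2 _ _ u v erefl erefl; exact: lamS_path.
have lm_sym u v t : lm u v t = lm v u (1 - t) by rewrite /lm lamS_sym /P2 setUC.
pose P3 a b c := Fin (P2 a b) `|` Fin (P2 b c) `|` Fin (P2 a c).
have cov3 a b c : covered (P3 a b c).
  by apply: coveredU; [apply: coveredU|]; exact: covered_tower (FinP _).1.
have Fin3 a b c := (FinP (P3 a b c)).2 (cov3 a b c).
pose dat3 y0 y1 y2 := dat (P3 (pcell y0) (pcell y1) (pcell y2)).
pose gd y0 y1 y2 := forall t, itv01 t ->
  let Y := carrier (Fin (P3 (pcell y0) (pcell y1) (pcell y2))) in
  let p := pcat (lm y0 y1) (lm y1 y2) in let q := lm y0 y2 in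
  [/\ Y (p t), Y (q t) & segok (dat3 y0 y1 y2) (p t) (q t)].
pose hm y0 y1 y2 (st : R * R) := rr (seg (dat3 y0 y1 y2)
  (pcat (lm y0 y1) (lm y1 y2) st.2) (lm y0 y2 st.2) st.1).
have /choice[N NP] : forall ySW : M * cells * set M, exists W' : set M,
    nbhs ySW.1.1 ySW.2 -> nbhs ySW.1.1 W' /\
    forall u v, W' u -> W' v -> carrier (Fin ySW.1.2) u -> carrier (Fin ySW.1.2) v ->
    segok (dat ySW.1.2) u v /\
    forall t, itv01 t -> ySW.2 (rr (seg (dat ySW.1.2) u v t)).
  move=> [[y S] W] /=; have [yW|nyW] := pselect (nbhs y W); last by exists setT => /nyW.
  by have [W' yW' h] := near_seg (dat S) (clF S) yW; exists W'.
have NP' y S W : nbhs y W -> nbhs y (N (y, S, W)) /\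
    forall u v, N (y, S, W) u -> N (y, S, W) v -> carrier (Fin S) u -> carrier (Fin S) v ->
    segok (dat S) u v /\ forall t, itv01 t -> W (rr (seg (dat S) u v t)).
  exact: NP (y, S, W).
have lm_near y W a b u v : nbhs y W -> pcell u = a -> pcell v = b ->
    N (y, P2 a b, W) u -> N (y, P2 a b, W) v ->
    forall t, itv01 t -> W (lm u v t) /\ carrier (Fin (P2 a b)) (lm u v t).
  move=> yW ua vb Nu Nv t t01; have [h1 h2] := Fin2 _ _ _ _ ua vb.
  have [ok h] := (NP' y (P2 a b) W yW).2 u v Nu Nv h1 h2.
  rewrite /lm ua vb /lamS asboolT//; split; first exact: h.
  exact: retract_in.
pose pc (C : set M) := exists2 T : cells, tower T & C = carrier T.
have f_hom y0 y1 y2 : gd y0 y1 y2 ->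
    homotopy (hm y0 y1 y2) (pcat (lm y0 y1) (lm y1 y2)) (lm y0 y2).
  move=> gd3; have p01 := lm_path y0 y1; have p12 := lm_path y1 y2.
  exact: (segok_homotopy (path_cat p01 p12) (lm_path y0 y2) gd3).
have f_dir C C' : pc C -> pc C' -> exists2 C'', pc C'' & C `|` C' `<=` C''.
  move=> [T tT ->] [T' tT' ->].
  have [T'' tT'' h] := coveredU (covered_tower tT) (covered_tower tT').
  by exists (carrier T''); [exists T''|rewrite -carrierU; exact: sub_carrier].
have f_near (Y : metricType R) (A : set Y) (F : Y -> M) x : cts A F -> A x ->
    exists2 C, pc C & \forall y \near x, A y -> C (F y).
  move=> cF Ax; have [T tT h] := locally_in_tower cw cF Ax.
  by exists (carrier T) => //; exists T.
have f_tri C y W : pc C -> C y -> nbhs y W -> exists2 W' : set M, nbhs y W' &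
    forall y0 y1 y2, W' y0 -> W' y1 -> W' y2 -> C y0 -> C y1 -> C y2 ->
    [/\ gd y0 y1 y2, forall st, square st -> W (hm y0 y1 y2 st) &
        forall t, itv01 t -> W (lm y0 y1 t)].
  move=> [T tT ->] _ yW.
  (* Two scales of smallness: segments between points of [V] are retracted into [W], and the points
     in [Q] are so close that the short paths between them stay in [V]. *)
  pose V a b c := W `&` N (y, P3 a b c, W).
  have yV a b c : nbhs y (V a b c) by apply: filterI => //; exact: (NP' _ _ _ yW).1.
  pose Q a b c z := [/\ N (y, P2 a b, V a b c) z, N (y, P2 b c, V a b c) z &
    N (y, P2 a c, V a b c) z].
  exists (fun z => forall a, T a -> forall b, T b -> forall c, T c -> Q a b c z).
    apply: (near_tower (P := fun a z => forall b, T b -> forall c, T c -> Q a b c z) tT) => a.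
    apply: (near_tower (P := fun b z => forall c, T c -> Q a b c z) tT) => b.
    apply: (near_tower (P := fun c z => Q a b c z) tT) => c.
    apply: filterS3 (NP' _ (P2 a b) _ (yV a b c)).1 (NP' _ (P2 b c) _ (yV a b c)).1
      (NP' _ (P2 a c) _ (yV a b c)).1 => z h1 h2 h3.
    by split.
  move=> y0 y1 y2 h0 h1 h2 /carrierP Ta /carrierP Tb /carrierP Tc.
  have {h0}[h01 h02 h03] := h0 _ Ta _ Tb _ Tc.
  have {h1}[h11 h12 h13] := h1 _ Ta _ Tb _ Tc.
  have {h2}[h21 h22 h23] := h2 _ Ta _ Tb _ Tc.
  move: h01 h02 h03 h11 h12 h13 h21 h22 h23.
  set a := pcell y0; set b := pcell y1; set c := pcell y2.
  move=> h01 h02 h03 h11 h12 h13 h21 h22 h23.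
  have l01 t := lm_near y _ a b y0 y1 (yV a b c) erefl erefl h01 h11 t.
  have l12 t := lm_near y _ b c y1 y2 (yV a b c) erefl erefl h12 h22 t.
  have l02 t := lm_near y _ a c y0 y2 (yV a b c) erefl erefl h03 h23 t.
  have sub e e' : Fin (P2 e e') `<=` P3 a b c ->
      carrier (Fin (P2 e e')) `<=` carrier (Fin (P3 a b c)).
    by move=> h; apply: sub_carrier => x /h; exact: Fin3.
  have lp t : itv01 t -> V a b c (pcat (lm y0 y1) (lm y1 y2) t) /\
      carrier (Fin (P3 a b c)) (pcat (lm y0 y1) (lm y1 y2) t).
    move=> /andP[t0 t1]; rewrite /pcat; case: ifPn => [t2|]; last rewrite -ltNge => t2.
      have [|v1 v2] := l01 (2 * t); first by apply/andP; split; lra.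
      by split => //; apply: (sub _ _ _ _ v2) => e; left; left.
    have [|v1 v2] := l12 (2 * t - 1); first by apply/andP; split; lra.
    by split => //; apply: (sub _ _ _ _ v2) => e; left; right.
  have lq t : itv01 t -> V a b c (lm y0 y2 t) /\ carrier (Fin (P3 a b c)) (lm y0 y2 t).
    by move=> /l02[v1 v2]; split => //; apply: (sub _ _ _ _ v2) => e; right.
  have sg t : itv01 t -> segok (dat3 y0 y1 y2) (pcat (lm y0 y1) (lm y1 y2) t) (lm y0 y2 t) /\
      forall s, itv01 s -> W (hm y0 y1 y2 (s, t)).
    move=> t01; have [[_ n1] c1] := lp t t01; have [[_ n2] c2] := lq t t01.
    by have [ok h] := (NP' y (P3 a b c) W yW).2 _ _ n1 n2 c1 c2.
  split.
  - by move=> t t01; split; [case: (lp t t01)|case: (lq t t01)|case: (sg t t01)].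
  - by move=> [s t] [/= s01 t01]; have [_] := sg t t01; apply.
  - by move=> t /l01[[]].
have f_simple C y : pc C -> C y -> exists2 S, simple R S & exists2 W' : set M, nbhs y W' &
    forall y1 y2, W' y1 -> W' y2 -> C y1 -> C y2 ->
    S y1 /\ forall t, itv01 t -> S (lm y1 y2 t).
  move=> [T tT ->] _.
  (* All short paths between nearby points of [carrier T] run in the single subcomplex [Fin U]. Near
     [y], two paths in it with the same ends are homotopic through retracted segments. *)
  pose U := \bigcup_(a in T) \bigcup_(b in T) Fin (P2 a b).
  have cU : covered U.
    apply: covered_bigcup => [|a]; first exact: covered_tower.
    by apply: covered_bigcup => [|b]; [exact: covered_tower|exact: covered_tower (FinP _).1].
  have FinU := (FinP U).2 cU.
  have yT : nbhs y setT by exact: filterT.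
  have [yB BP] := NP' y U setT yT; set B := N (y, U, setT) in yB BP.
  exists (B `&` carrier (Fin U)).
    move=> p q a b pp pq pqS; exists (fun st => rr (seg (dat U) (p st.2) (q st.2) st.1)).
    apply: (segok_homotopy pp pq) => t /pqS[[Bp cp] [Bq cq]]; split=> //.
    by have [] := BP _ _ Bp Bq cp cq.
  pose Q a b z := N (y, P2 a b, B) z.
  exists (fun z => B z /\ forall a, T a -> forall b, T b -> Q a b z).
    apply: filterI => //.
    apply: (near_tower (P := fun a z => forall b, T b -> Q a b z) tT) => a.
    apply: (near_tower (P := fun b z => Q a b z) tT) => b.
    exact: (NP' y (P2 a b) B yB).1.
  move=> y1 y2 [B1 N1] [B2 N2] /carrierP Ta /carrierP Tb.
  have sub : carrier (Fin (P2 (pcell y1) (pcell y2))) `<=` carrier (Fin U).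
    by apply: sub_carrier => e h; apply: FinU; exists (pcell y1) => //; exists (pcell y2).
  have l12 := lm_near y _ _ _ y1 y2 yB erefl erefl (N1 _ Ta _ Tb) (N2 _ Ta _ Tb).
  split; last by move=> t /l12[? ?]; split=> //; exact: sub.
  by split=> //; apply: sub; case: (Fin2 _ _ y1 y2 erefl erefl).
by exists (LocalStructure lm_path lm_sym f_hom f_dir f_near f_tri f_simple).
Qed.

End CWLocalStructure.

(** * Extension of maps and of cocycles *)

Section Extension.
Variables (X M : topologicalType).

Lemma extension_cts (A : set X) (f : X -> M) : extension_property X M ->
  closed A -> cts A f -> exists2 g : X -> M, continuous g & forall x, A x -> g x = f x.
Proof.
move=> ext clA cf; have [|g cg gf] := ext A (f \o set_val) clA.
  move=> a P fP; have Aa : A (set_val a) by apply: set_valP.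
  have /(@initial_continuous A X set_val a) := cts_near cf Aa fP.
  by rewrite !nbhs_simpl /=; apply: filterS => b; apply; exact: set_valP.
by exists g => // x Ax; have := gf (exist _ x (mem_set Ax)).
Qed.

Lemma cts_extension (m0 : M) : (forall (A : set X) (f : X -> M), closed A -> cts A f ->
    exists2 g : X -> M, continuous g & forall x, A x -> g x = f x) ->
  extension_property X M.
Proof.
move=> ext A f clA cf.
pose f' x := if pselect (A x) is left Ax then f (exist _ x (mem_set Ax)) else m0.
have f'E (a : A) : f' (set_val a) = f a.
  rewrite /f'; case: pselect => [h|]; last by case; exact: set_valP.
  by congr f; exact/val_inj.
have [|g cg gf] := ext A f' clA.
  apply/ctsP => x P Ax; pose a : A := exist _ x (mem_set Ax).
  rewrite -[x in f' x]/(set_val a) f'E => /(cf a)/= [_ [[B oB <-] Ba] BP].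
  have Bx : nbhs x B by apply: open_nbhs_nbhs.
  apply: filterS Bx => y By Ay; pose b : A := exist _ y (mem_set Ay).
  by rewrite -[y]/(set_val b) f'E; exact: (BP b).
by exists g => // a; rewrite gf ?f'E//; exact: set_valP.
Qed.

End Extension.

Section Subpath.
Variables (R : realType) (G : groupType) (K : topologicalType).
Variables (l : R -> K) (hol : (R -> K) -> G).
Hypothesis hhol : holonomy hol.
Hypothesis cl : cts itv01 l.
Implicit Types a b c : R.

Definition subpath a b t := l (a + t * (b - a)).

Lemma subpathP a b : itv01 a -> itv01 b -> is_path (subpath a b) (l a) (l b).
Proof.
move=> /andP[a0 a1] /andP[b0 b1]; split.
- rewrite /subpath; apply: (cts_comp (f := fun t : R => a + t * (b - a)) (g := l) (B := itv01)) => //.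
    by move=> t /andP[t0 t1]; apply/andP; split; nra.
  apply: ctsD; first exact: cts_cst.
  by apply: ctsM; [exact: cts_id|exact: cts_cst].
- by rewrite /subpath mul0r addr0.
- by rewrite /subpath mul1r addrC subrK.
Qed.

(** The parameters come in any order: both sides are reparametrizations of [l] with the same
    ends. *)
Lemma hol_subpath a b c : itv01 a -> itv01 b -> itv01 c ->
  (hol (subpath a b) * hol (subpath b c))%g = hol (subpath a c).
Proof.
move=> a01 b01 c01; have pab := subpathP a01 b01; have pbc := subpathP b01 c01.
rewrite -(holM hhol pab pbc); apply/(hol_eq hhol (path_cat pab pbc) (subpathP a01 c01)).
pose u t := if t <= 2^-1 then a + 2 * t * (b - a) else b + (2 * t - 1) * (c - b).
have -> : pcat (subpath a b) (subpath b c) = l \o u.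
  by apply/funext => t; rewrite /pcat /u /=; case: ifP.
move: a01 b01 c01 => /andP[a0 a1] /andP[b0 b1] /andP[c0 c1].
apply: (hpath_reparam (v := fun t => a + t * (c - a)) (lo := 0) (hi := 1)) => //.
- apply: (cts_paste (f := id)); first exact: cts_id.
  + apply: ctsD; first exact: cts_cst.
    by apply: ctsM; [apply: ctsM; [exact: cts_cst|exact: cts_id]|exact: cts_cst].
  + apply: ctsD; first exact: cts_cst.
    apply: ctsM; last exact: cts_cst.
    by apply: ctsB; [apply: ctsM; [exact: cts_cst|exact: cts_id]|exact: cts_cst].
  + by move=> t _ /= ->; field.
- apply: ctsD; first exact: cts_cst.
  by apply: ctsM; [exact: cts_id|exact: cts_cst].
- move=> t /andP[t0 t1]; rewrite /u; case: ifPn => [h|]; last rewrite -ltNge => h.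
    by apply/andP; split; nra.
  by apply/andP; split; nra.
- by move=> t /andP[t0 t1]; apply/andP; split; nra.
- by rewrite /u ifT ?mulr0 ?mul0r// invr_ge0.
- rewrite /u ifF; last by apply/negbTE; rewrite -ltNge; lra.
  by ring.
Qed.

Lemma hol_subpath_id a : itv01 a -> hol (subpath a a) = 1%g.
Proof.
move=> a01; apply: (mulgI (hol (subpath a a))).
by rewrite hol_subpath// mulg1.
Qed.

Lemma hol_subpath01 : hol (subpath 0 1) = hol l.
Proof.
apply: (hol_ext hhol (a := l 0) (b := l 1)) => // t _.
by rewrite /subpath add0r subr0 mulr1.
Qed.

End Subpath.

Section ExtensionToCocycle.
Variables (R : realType) (X : metricType R) (G : groupType) (K : topologicalType).
Variables (ls : local_structure R K) (hol : (R -> K) -> G) (y0 : K).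
Hypothesis hhol : holonomy hol.
Hypothesis ext : extension_property X K.
Local Notation sp := (lam ls).
Local Notation o0 := (@Ordinal 3 0 isT).
Local Notation o1 := (@Ordinal 3 1 isT).
Local Notation o2 := (@Ordinal 3 2 isT).

Lemma hol_simple (S : set K) (p q : R -> K) a b : simple R S -> is_path p a b -> is_path q a b ->
  (forall t, itv01 t -> S (p t) /\ S (q t)) -> hol p = hol q.
Proof. by move=> sS pp pq h; apply/(hol_eq hhol pp pq); exact: sS pp pq h. Qed.

Lemma ord3P (P : 'I_3 -> Prop) : P o0 -> P o1 -> P o2 -> forall k, P k.
Proof.
move=> P0 P1 P2 [[|[|[|//]]] ik].
- by rewrite (_ : Ordinal ik = o0)//; exact: val_inj.
- by rewrite (_ : Ordinal ik = o1)//; exact: val_inj.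
- by rewrite (_ : Ordinal ik = o2)//; exact: val_inj.
Qed.

(** Near [x] the three short paths lie in one simple set, where the path around through [F b] is
    homotopic to the direct one. *)
Lemma near_cocycle (F : X -> K) (x : X) : continuous F -> exists2 N : set X, nbhs x N &
  forall a b c, N a -> N b -> N c ->
    (hol (sp (F a) (F b)) * hol (sp (F b) (F c)))%g = hol (sp (F a) (F c)).
Proof.
move=> cF; have [T pT nT] := piece_near ls (continuous_cts cF) (I : setT x).
have Tx : T (F x) by exact: (nbhs_singleton nT).
have [S sS [W' W'x h]] := small_simple pT Tx.
exists (fun z => T (F z) /\ W' (F z)).
  have Wn : nbhs x (fun z : X => W' (F z)) by exact: cF W'x.
  by apply: filterS2 nT Wn => z Tz Wz; split=> //; exact: Tz.
move=> a b c [Ta Wa] [Tb Wb] [Tc Wc].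
have pab := lam_path ls (F a) (F b); have pbc := lam_path ls (F b) (F c).
rewrite -(holM hhol pab pbc).
apply: (hol_simple sS (path_cat pab pbc) (lam_path ls (F a) (F c))) => t t01.
have [_ ab] := h _ _ Wa Wb Ta Tb; have [_ bc] := h _ _ Wb Wc Tb Tc.
have [_ ac] := h _ _ Wa Wc Ta Tc; split; last exact: ac.
move: t01 => /andP[t0 t1]; rewrite /pcat; case: ifPn => [t2|]; last rewrite -ltNge => t2.
  by apply: ab; apply/andP; split; lra.
by apply: bc; apply/andP; split; lra.
Qed.

Lemma near_subpath (l : R -> K) (t0 : R) : cts itv01 l -> itv01 t0 -> exists2 e, 0 < e &
  forall s t, itv01 s -> itv01 t -> `|s - t0| < e -> `|t - t0| < e ->
    hol (sp (l s) (l t)) = hol (subpath l s t).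
Proof.
move=> cl t01.
have [T pT nT] : exists2 T, piece ls T & \forall s \near t0, itv01 s -> T (l s).
  exact: (@piece_near R K ls R^o itv01 l t0 cl t01).
have Tt : T (l t0) by exact: (nbhs_singleton nT).
have [S sS [W' W'x h]] := small_simple pT Tt.
have /nbhs_ballP[e /= e0 he] : \forall s \near t0, itv01 s -> T (l s) /\ W' (l s).
  by apply: filterS2 nT (cts_near cl t01 W'x) => s h1 h2 s01; split; [exact: h1|exact: h2].
exists e => // s t s01 t01' st tt.
have TW r : itv01 r -> `|r - t0| < e -> T (l r) /\ W' (l r).
  by move=> r01 rt; apply: he => //; rewrite -ball_normE /= distrC.
have [[Ts Ws] [Tt' Wt]] := (TW s s01 st, TW t t01' tt).
apply: (hol_simple sS (lam_path ls (l s) (l t)) (subpathP cl s01 t01')) => r r01.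
split; first by have [_] := h _ _ Ws Wt Ts Tt'; apply.
have [||Tr Wr] := TW (s + r * (t - s)).
- move: s01 t01' r01 => /andP[? ?] /andP[? ?] /andP[? ?]; apply/andP; split; nra.
- move: r01 st tt => /andP[r0 r1]; rewrite !ltr_norml => /andP[? ?] /andP[? ?].
  have cvx a b : 0 < a -> 0 < b -> 0 < (1 - r) * a + r * b.
    move=> a0 b0; have [r2|r2] := ltP r 1.
      by rewrite ltr_wpDr ?mulr_ge0 ?mulr_gt0 ?subr_gt0// ltW.
    by rewrite (_ : r = 1) ?subrr ?mul0r ?add0r ?mul1r//; apply/eqP; rewrite eq_le r1.
  have := cvx (s - t0 + e) (t - t0 + e); have := cvx (t0 + e - s) (t0 + e - t).
  by move=> h1 h2; apply/andP; split; nra.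
by have [] := h _ _ Wr Wr Tr Tr.
Qed.

(** To each index belongs a base point: a vertex of the triangle, or the center of a small set of a
    refinement. [hk m x] is the holonomy from that base point to [F x], and the ratio of two such
    values is the transition element. The circle map is thickened first, so that the vertex
    coordinates can be cut off away from [A]. *)
Lemma extension_extends_cocycle g : extends_cocycle X [set: G] [set 1%g] g.
Proof.
move=> A u clA cu.
have [A' [u' [mu [[clA' AA'] [cu' u'01 u'pos u'0] u'u [cmu mu01 mu1 muA']]]]] := thicken clA cu.
have /choice[w wP] : forall k, exists f, [/\ continuous f,
    forall x, A' x -> f x = u' k x & forall x, 0 <= f x <= 1].
  by move=> k; apply: tietze01 => // x Ax; exact: u'01.
have cw k : continuous (w k) by case: (wP k).
have wu k x : A' x -> w k x = u' k x by case: (wP k) => _ h _; exact: h.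
have w01 k x : 0 <= w k x <= 1 by case: (wP k).
have w0 k x : 0 <= w k x by case/andP: (w01 k x).
have w_zero x : A' x -> w o0 x = 0 \/ w o1 x = 0 \/ w o2 x = 0.
  move=> Ax; have [k] := u'0 x Ax; rewrite -wu//.
  by move: k; apply: ord3P => h; [left|right; left|right; right].
have w_pos x : A' x -> 0 < w o0 x \/ 0 < w o1 x \/ 0 < w o2 x.
  move=> Ax; have [k] := u'pos x Ax; rewrite -wu//.
  by move: k; apply: ord3P => h; [left|right; left|right; right].
have [l [cl l0 l1] hl] := hol_surj hhol y0 y0 g.
have i0 : @itv01 R 0 by exact: itv01_0.
have i1 : @itv01 R 1 by exact: itv01_1.
(* tau is the parameter on the edge from vertex 2 to vertex 0, which carries
   the loop l; the other two edges are sent to y0 *)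
pose tau x := w o0 x / (w o0 x + w o2 x).
pose P := [set x | 0 < w o0 x + w o2 x].
have ctau : cts P tau.
  apply: cts_div => [x xP||]; first by rewrite gt_eqF.
    exact: continuous_cts.
  by apply: ctsD; exact: continuous_cts.
have tau01 x : P x -> itv01 (tau x).
  rewrite /P /tau /= => h; have := w0 o0 x; have := w0 o2 x => ? ?; apply/andP; split.
    by rewrite divr_ge0// ltW.
  by rewrite ler_pdivrMr//; lra.
pose F0 x := if w o1 x == 0 then l (tau x) else y0.
have cF0 : cts A' F0.
  pose B1 := A' `&` (w o1) @^-1` [set 0].
  pose B2 := A' `&` (fun x => Num.min (w o0 x) (w o2 x)) @^-1` [set 0].
  have min0 x : Num.min (w o0 x) (w o2 x) = 0 <-> w o0 x = 0 \/ w o2 x = 0.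
    rewrite minEle; have := w0 o0 x; have := w0 o2 x; case: ifPn => [|]; last rewrite -ltNge.
      by move=> ? ? ?; split=> [|[]]; [left|lra|lra].
    by move=> ? ? ?; split=> [|[]]; [right|lra|lra].
  have AB : A' `<=` B1 `|` B2.
    move=> x Ax; have [h|[h|h]] := w_zero x Ax; [right|by left|right]; split=> //.
      by apply/min0; left.
    by apply/min0; right.
  apply: (sub_cts AB); apply: ctsU.
  - exact: (closed_preimage_cts clA' (continuous_cts (cw o1)) (@closed_eq _ 0)).
  - have cm := cts_min (continuous_cts (cw o0)) (continuous_cts (A := A') (cw o2)).
    exact: (closed_preimage_cts clA' cm (@closed_eq _ 0)).
  - apply: (eq_cts (f := l \o tau)); first by move=> x [_ /= h]; rewrite /F0 h eqxx.
    have BP : B1 `<=` P.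
      move=> x [Ax /= h]; rewrite /P /=; have := w0 o0 x; have := w0 o2 x.
      by have [?|[?|?]] := w_pos x Ax; lra.
    by apply: (cts_comp (B := itv01)) cl; [move=> x /BP; exact: tau01|exact: sub_cts ctau].
  - apply: (eq_cts (f := fun=> y0)); last exact: cts_cst.
    move=> x [Ax /= /min0 h]; rewrite /F0; case: eqP => // h1; rewrite /tau.
    have : w o0 x = 0 \/ (w o2 x = 0 /\ 0 < w o0 x).
      have := w0 o0 x; have := w0 o2 x.
      by case: h => h; [left|have [?|[?|?]] := w_pos x Ax; [right|lra|lra]].
    by move=> [->|[-> h2]]; rewrite ?mul0r// addr0 divff ?gt_eqF.
have [F cF FF0] := extension_cts ext clA' cF0.
pose tk (k : 'I_3) x : R := if k == o1 then 0 else tau x.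
pose bk (k : 'I_3) : R := if k == o0 then 1 else 0.
have bk01 k : itv01 (bk k) by rewrite /bk; case: ifP.
have lbk k : l (bk k) = y0 by rewrite /bk; case: ifP.
have star x k : A' x -> 0 < w k x -> F x = l (tk k x) /\ itv01 (tk k x).
  move=> Ax; rewrite FF0// /F0 /tk; have wz := w_zero x Ax.
  have h0 := w0 o0 x; have h1 := w0 o1 x; have h2 := w0 o2 x.
  move: k; apply: ord3P => /= wk.
  - have Px : P x by rewrite /P /=; lra.
    split; last exact: tau01.
    case: eqP => // w1; have w2 : w o2 x = 0 by case: wz => [?|[?|?]]; lra.
    by rewrite /tau w2 addr0 divff ?l1// gt_eqF.
  - by split=> //; rewrite ifF ?l0// gt_eqF.
  - have Px : P x by rewrite /P /=; lra.
    split; last exact: tau01.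
    case: eqP => // w1; have w2 : w o0 x = 0 by case: wz => [?|[?|?]]; lra.
    by rewrite /tau w2 mul0r.
(* on the star of the vertex k, the holonomy of l from that vertex to F x *)
pose h k x := hol (subpath l (bk k) (tk k x)).
have h1 x : h o1 x = 1%g by rewrite /h /bk /tk /= (hol_subpath_id hhol cl).
have h2 x : itv01 (tau x) -> h o2 x = (g * h o0 x)%g.
  by move=> t01; rewrite -hl /h /bk /tk /= -(hol_subpath01 hhol cl) hol_subpath.
have tauP x : A' x -> 0 < w o0 x \/ 0 < w o2 x -> itv01 (tau x).
  by move=> Ax hp; apply: tau01; rewrite /P /=; have := w0 o0 x; have := w0 o2 x; case: hp; lra.
have tau_1 x : A' x -> 0 < w o0 x -> 0 < w o1 x -> tau x = 1.
  move=> Ax p0 p1; have z2 : w o2 x = 0 by case: (w_zero x Ax) => [?|[?|?]]; lra.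
  by rewrite /tau z2 addr0 divff// gt_eqF.
have tau_0 x : A' x -> 0 < w o2 x -> 0 < w o1 x -> tau x = 0.
  move=> Ax p0 p1; have z0 : w o0 x = 0 by case: (w_zero x Ax) => [?|[?|?]]; lra.
  by rewrite /tau z0 mul0r.
have h_std x k k' : A' x -> 0 < w k x -> 0 < w k' x -> (h k x * (h k' x)^-1)%g = std g k k'.
  move=> Ax.
  have h01 : 0 < w o0 x -> 0 < w o1 x -> h o0 x = 1%g.
    by move=> p0 p1; rewrite /h /bk /tk /= tau_1// (hol_subpath_id hhol cl).
  have h21 : 0 < w o2 x -> 0 < w o1 x -> h o2 x = 1%g.
    by move=> p0 p1; rewrite /h /bk /tk /= tau_0// (hol_subpath_id hhol cl).
  have h20 : 0 < w o2 x -> h o2 x = (g * h o0 x)%g by move=> p2; apply/h2/tauP => //; right.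
  move: k k'; apply: ord3P; apply: ord3P => p p'; rewrite /std /= ?mulgV//.
  - by rewrite h01// h1 invg1 mulg1.
  - by rewrite h20// invgM mulgA mulgV mul1g.
  - by rewrite h01// h1 invg1 mulg1.
  - by rewrite h21// h1 invg1 mulg1.
  - by rewrite h20// -mulgA mulgV mulg1.
  - by rewrite h21// h1 invg1 mulg1.
(* Where [tau] is undefined, [x] lies over vertex 1. Points near [x] on the star of [k] then have
   [tau] equal to [bk k], so a limit of the parameter still exists. *)
have tk_near (x : X) k : exists2 t, itv01 t & forall e, 0 < e ->
    \forall z \near x, A' z -> 0 < w k z -> `|tk k z - t| < e.
  have [Ax|nAx] := pselect (A' x); last first.
    exists 0 => // e _; have : nbhs x (~` A') by apply: open_nbhs_nbhs; split=> //; exact: closed_openC.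
    by apply: filterS => z nAz /nAz.
  have [->|k1] := eqVneq k o1.
    by exists 0 => // e e0; apply: filterE => z _ _; rewrite /tk eqxx subrr normr0.
  have tkE z : tk k z = tau z by rewrite /tk (negbTE k1).
  have [Px|nPx] := pselect (P x).
    exists (tau x); first exact: tau01.
    move=> e e0; have /cts_distP/(_ x e Px e0) := ctau.
    apply: filterS => z hz Az wk; rewrite tkE distrC; apply: hz.
    rewrite /P /=; move: k1 wk; have := w0 o0 z; have := w0 o2 z.
    by move: k {tkE}; apply: ord3P => /= ? ? // _ ?; lra.
  have x02 : w o0 x = 0 /\ w o2 x = 0.
    by move: nPx; rewrite /P /=; have := w0 o0 x; have := w0 o2 x => ? ? /negP;
      rewrite -leNgt => ?; split; lra.
  have x1 : 0 < w o1 x by case: (w_pos x Ax) => [?|[?|?]] //; lra.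
  have n1 : \forall z \near x, 0 < w o1 z.
    have o : nbhs (w o1 x) [set t | 0 < t].
      by apply: open_nbhs_nbhs; split=> //; exact: open_gt.
    exact: cw o.
  exists (bk k) => // e e0; apply: filterS n1 => z z1 Az; rewrite tkE.
  move: k1; move: k {tkE}; apply: ord3P => // _ wk.
    by rewrite tau_1// subrr normr0.
  by rewrite tau_0// subrr normr0.
have near_h (x : X) k : exists2 N : set X, nbhs x N & forall z z', N z -> N z' -> A' z -> A' z' ->
    0 < w k z -> 0 < w k z' -> (h k z * hol (sp (F z) (F z')))%g = h k z'.
  have [t t01 tP] := tk_near x k; have [e e0 eP] := near_subpath cl t01.
  exists (fun z => A' z -> 0 < w k z -> `|tk k z - t| < e); first exact: tP.
  move=> z z' Nz Nz' Az Az' wz wz'; have [Fz tz] := star z k Az wz.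
  have [Fz' tz'] := star z' k Az' wz'; rewrite Fz Fz' eP//; [|exact: Nz|exact: Nz'].
  exact: hol_subpath.
have /choice[N NP] : forall x : X, exists N : set X, [/\ nbhs x N,
    forall a b c, N a -> N b -> N c ->
      (hol (sp (F a) (F b)) * hol (sp (F b) (F c)))%g = hol (sp (F a) (F c)) &
    forall k z z', N z -> N z' -> A' z -> A' z' -> 0 < w k z -> 0 < w k z' ->
      (h k z * hol (sp (F z) (F z')))%g = h k z'].
  move=> x; have [N0 n0 N0P] := near_cocycle x cF.
  have [Na na NaP] := near_h x o0; have [Nb nb NbP] := near_h x o1.
  have [Nc nc NcP] := near_h x o2.
  exists (N0 `&` Na `&` Nb `&` Nc); split.
  - by do 3 (apply: filterI => //).
  - by move=> a b c [[[? _] _] _] [[[? _] _] _] [[[? _] _] _]; exact: N0P.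
  - apply: ord3P => z z' [[[_ ?] ?] ?] [[[_ ?] ?] ?] *; [exact: NaP|exact: NbP|exact: NcP].
pose U x := (N x)°.
have oU x : open (U x) by exact: open_interior.
have UN x : U x `<=` N x by exact: interior_subset.
have Ux x : U x x by case: (NP x) => /nbhs_interior/nbhs_singleton.
have [q [cq q0 qU q_cov q_fin]] := locally_finite_refinement oU.
pose p (m : 'I_3 + (nat * X)%type) x := match m with
  | inl k => mu x * w k x | inr a => (1 - mu x) * Num.min 1 (q a x) end.
pose hk m x := match m with inl k => h k x
  | inr a => hol (sp (F (a : nat * X).2) (F x)) end.
have min_ge0 a x : 0 <= Num.min 1 (q a x) by rewrite le_min ler01 q0.
have pl k x : 0 < p (inl k) x -> A' x /\ 0 < w k x.
  move=> /= h0; have /andP[m0 _] := mu01 x; split; last first.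
    rewrite lt_neqAle eq_sym w0 andbT; apply: contraTneq h0 => ->.
    by rewrite mulr0 ltxx.
  apply: muA'; rewrite lt_neqAle eq_sym m0 andbT; apply: contraTneq h0 => ->.
  by rewrite mul0r ltxx.
have pr a x : 0 < p (inr a) x -> 0 < q a x.
  move=> /= h0; rewrite lt_neqAle eq_sym q0 andbT; apply: contraTneq h0 => ->.
  by rewrite min_r ?ler01// mulr0 ltxx.
have key m a x x' : 0 < p m x -> 0 < p m x' -> 0 < p (inr a) x -> 0 < p (inr a) x' ->
    (hk m x * hol (sp (F x) (F x')))%g = hk m x'.
  move=> pm pm' /pr/qU/UN Nx /pr/qU/UN Nx'; case: m pm pm' => [k|b].
    move=> /pl[Ax wx] /pl[Ax' wx'] /=; case: (NP a.2) => _ _; exact.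
  move=> /pr/qU/UN Mx /pr/qU/UN Mx' /=; case: (NP b.2) => _ h' _; apply: h' => //.
  exact/UN/Ux.
(* The ratio must not depend on [x]. If one index belongs to the refinement, both points lie in one
   small set and [key] applies. For two vertices, whose common star need not be small, [h_std]
   computes the value. Pairs that never meet get [std] on vertices and 1 otherwise. *)
have : forall mn, exists v : G,
    (forall k k', mn = (inl k, inl k') -> v = std g k k') /\
    forall x, 0 < p mn.1 x -> 0 < p mn.2 x -> v = (hk mn.1 x * (hk mn.2 x)^-1)%g.
  move=> [m n] /=.
  have [[x px nx]|none] := pselect (exists2 x, 0 < p m x & 0 < p n x); last first.
    case: m n none => [k|a] [k'|b] none.
    - exists (std g k k'); split; first by move=> ? ? [-> ->].
      by move=> x px nx; case: none; exists x.
    - by exists 1%g; split=> // x px nx; case: none; exists x.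
    - by exists 1%g; split=> // x px nx; case: none; exists x.
    - by exists 1%g; split=> // x px nx; case: none; exists x.
  have indep a x' : m = inr a \/ n = inr a -> 0 < p m x' -> 0 < p n x' ->
      (hk m x * (hk n x)^-1 = hk m x' * (hk n x')^-1)%g.
    move=> mna px' nx'.
    have [pa pa'] : 0 < p (inr a) x /\ 0 < p (inr a) x' by case: mna => <-.
    rewrite -(key m a x x')// -(key n a x x')//.
    by rewrite invgM mulgA mulgK.
  exists (hk m x * (hk n x)^-1)%g; case: m n px nx indep => [k|a] [k'|b] px nx indep.
  - have [Ax wk] := pl _ _ px; have [_ wk'] := pl _ _ nx.
    split; first by move=> ? ? [<- <-]; exact: h_std.
    move=> x' /pl[Ax' wx] /pl[_ wx']; rewrite /= h_std//.
    by rewrite h_std.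
  - by split=> // x' px' nx'; apply: (indep b) => //; right.
  - by split=> // x' px' nx'; apply: (indep a) => //; left.
  - by split=> // x' px' nx'; apply: (indep a) => //; left.
move=> /choice[c cP].
exists (nat * X)%type, p, (fun m n => c (m, n)); split.
- split.
  + move=> [k|a]; apply: ctsM.
    * exact: continuous_cts.
    * exact: continuous_cts.
    * by apply: ctsB; [exact: cts_cst|exact: continuous_cts].
    * by apply: cts_min; [exact: cts_cst|exact: continuous_cts].
  + move=> [k|a] x _ /=; have /andP[m0 m1] := mu01 x; first by rewrite mulr_ge0.
    by rewrite mulr_ge0 ?subr_ge0.
  + move=> [k|a] x _ /=; have /andP[m0 m1] := mu01 x; have /andP[? ?] := w01 o0 x.
      by have /andP[? ?] := w01 k x; rewrite mulr_ile1.
    by rewrite mulr_ile1 ?subr_ge0 ?lerBlDr ?lerDl ?ge_min ?lexx.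
  + move=> x _; have [s sP] := q_fin x x (Ux x).
    exists ([seq inl k | k <- enum 'I_3] ++ [seq inr a | a <- s]).
    apply: filterS sP => y hy _ [k|a] hp; rewrite mem_cat.
      by rewrite map_f// mem_enum.
    by rewrite [X in _ || X]map_f ?orbT//; apply/hy/pr.
  + move=> x _; have /andP[m0 m1] := mu01 x; have [mx|mx] := ltP 0 (mu x).
      have Ax := muA' x mx; have [k uk] := u'pos x Ax.
      by exists (inl k) => /=; rewrite mulr_gt0// wu.
    have [a qa] := q_cov x x (Ux x); exists (inr a) => /=.
    by rewrite mulr_gt0 ?lt_min ?ltr01// subr_gt0; lra.
  + by move=> i t /(_ I).
- by move=> k x Ax /=; rewrite mu1// mul1r wu ?u'u//; exact: AA'.
- by move=> a x Ax /=; rewrite mu1// subrr mul0r.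
- split=> // x m n r pm pn pr'.
  have [_ /(_ x pm pn) ->] := cP (m, n); have [_ /(_ x pn pr') ->] := cP (n, r).
  have [_ /(_ x pm pr') ->] := cP (m, r).
  by rewrite mulgA mulgVK; exact: eqmod_refl (trivial_normal G).1.
- move=> k l'; have [/(_ k l' erefl) -> _] := cP (inl k, inl l').
  exact: eqmod_refl (trivial_normal G).1.
Qed.

End ExtensionToCocycle.

Section Triangles.
Variables (R : realType) (X : metricType R) (I : choiceType) (Z : topologicalType).
Variables (O : set X) (p : I -> X -> R) (e : I -> I -> R -> Z).
Hypothesis hp : psys O p.
Hypothesis e_sym : forall (i j : I) t, i != j -> e i j t = e j i (1 - t).
Implicit Types (i j k : I) (h : X -> Z).

Lemma faceC i j : face O p [:: i; j] = face O p [:: j; i].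
Proof. by apply/seteqP; split=> x [Ox hx]; split=> // k /hx; rewrite !inE orbC. Qed.

Lemma triangle_edges i j k h :
  (forall x, face O p [:: i; j] x -> h x = e i j (edge_ratio p i j x)) ->
  (forall x, face O p [:: j; k] x -> h x = e j k (edge_ratio p j k x)) ->
  (forall x, face O p [:: i; k] x -> h x = e i k (edge_ratio p i k x)) ->
  forall a b x, a \in [:: i; j; k] -> b \in [:: i; j; k] -> a != b ->
    face O p [:: a; b] x -> h x = e a b (edge_ratio p a b x).
Proof.
move=> hij hjk hik.
have sw a b : (forall x, face O p [:: a; b] x -> h x = e a b (edge_ratio p a b x)) ->
    forall x, b != a -> face O p [:: b; a] x -> h x = e b a (edge_ratio p b a x).
  move=> hab x ba; rewrite faceC => fx; rewrite hab// [RHS]e_sym// -ratioC//.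
  by rewrite addrC (pair_pos hp fx).
move=> a b x; rewrite !inE => /or3P[]/eqP-> /or3P[]/eqP-> ab fx; first [by rewrite eqxx in ab
  |exact: hij|exact: hjk|exact: hik|exact: sw hij _ ab fx|exact: sw hjk _ ab fx
  |exact: sw hik _ ab fx].
Qed.

Definition fills_triangle (D : R * R * R -> Z) (e01 e12 e02 : R -> Z) := [/\ cts (@cone2 R) D,
  forall a b, 0 <= a -> 0 <= b -> 0 < a + b -> D (a, b, 0) = e01 (b / (a + b)),
  forall b c, 0 <= b -> 0 <= c -> 0 < b + c -> D (0, b, c) = e12 (c / (b + c)) &
  forall a c, 0 <= a -> 0 <= c -> 0 < a + c -> D (a, 0, c) = e02 (c / (a + c))].

Lemma fill_face D i j k : uniq [:: i; j; k] -> fills_triangle D (e i j) (e j k) (e i k) ->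
  let h x := D (p i x, p j x, p k x) in cts (face O p [:: i; j; k]) h /\
  forall a b x, a \in [:: i; j; k] -> b \in [:: i; j; k] -> a != b ->
    face O p [:: a; b] x -> h x = e a b (edge_ratio p a b x).
Proof.
move=> uT [cD D01 D12 D02] h.
have ge0 m x : O x -> 0 <= p m x by move=> Ox; exact: (psys_ge0 hp).
have out a b m x : face O p [:: a; b] x -> m != a -> m != b -> p m x = 0.
  move=> [Ox hx] ma mb; apply: (psys_eq0 hp Ox); apply/negP => /hx.
  by rewrite !inE (negbTE ma) (negbTE mb).
move: uT; rewrite /= !inE negb_or andbT => /andP[/andP[ij ik] jk]; split; last first.
  apply: triangle_edges => x fx; have := pair_pos hp fx; have [Ox _] := fx; rewrite /h.
  - by move=> s; rewrite (out _ _ k _ fx) ?D01 ?ge0// eq_sym.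
  - by move=> s; rewrite (out _ _ i _ fx) ?D12 ?ge0.
  - by move=> s; rewrite (out _ _ j _ fx) ?D02 ?ge0// eq_sym.
have cp m : cts (face O p [:: i; j; k]) (p m) by apply: sub_cts (psys_cts hp m) => x [].
apply: (cts_comp (f := fun x => (p i x, p j x, p k x)) (B := @cone2 R)) => //.
  move=> x [Ox hx]; split; rewrite /= ?ge0//; have [m pm] := psys_cov hp Ox.
  have := ge0 i x Ox; have := ge0 j x Ox; have := ge0 k x Ox.
  by move: (pm) => /hx; rewrite !inE => /or3P[]/eqP mE; rewrite mE in pm; lra.
by apply: cts_pair => //; apply: cts_pair.
Qed.

End Triangles.

(** * Maps to K from cocycles *)

Section FillBoundary.
Variables (R : realType) (X : metricType R) (G : groupType) (K : topologicalType).
Variables (hol : (R -> K) -> G).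
Hypothesis hhol : holonomy hol.
Hypothesis dimX : covering_dim_le X 2.
Hypothesis ext1 : forall g : G, extends_cocycle X [set: G] [set 1%g] g.
Local Notation o0 := (@Ordinal 3 0 isT).
Local Notation o1 := (@Ordinal 3 1 isT).
Local Notation o2 := (@Ordinal 3 2 isT).
Variables (e01 e12 e02 : R -> K) (y0 y1 y2 : K).
Hypothesis p01 : is_path e01 y0 y1.
Hypothesis p12 : is_path e12 y1 y2.
Hypothesis p02 : is_path e02 y0 y2.

(** The cocycle for the holonomy [g] around the three paths is turned into a map: vertices go to
    points, edges to paths with the prescribed holonomy, and triangles can be filled because of the
    cocycle relation. Order reduction leaves no larger simplices. *)
Lemma fill_boundary (A : set X) (u : 'I_3 -> X -> R) : closed A -> circle_map A u ->
  exists Phi : X -> K, [/\ continuous Phi,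
    forall x, A x -> u o2 x = 0 -> Phi x = e01 (u o1 x / (u o0 x + u o1 x)),
    forall x, A x -> u o0 x = 0 -> Phi x = e12 (u o2 x / (u o1 x + u o2 x)) &
    forall x, A x -> u o1 x = 0 -> Phi x = e02 (u o2 x / (u o0 x + u o2 x))].
Proof.
move=> clA cu; pose g := (hol e01 * hol e12 * (hol e02)^-1)%g.
have [J [p [c [hp pu p0 [_ hc] cstd]]]] := ext1 g clA cu.
have [p' [hp' p'p p'3 p'E]] := order_reduction dimX hp.
have [_ u01 u_pos u_0] := cu.
pose L : choiceType := ('I_3 + J)%type.
have hc1 x (a b d : L) : 0 < p a x -> 0 < p b x -> 0 < p d x -> (c a b * c b d)%g = c a d.
  by move=> pa pb pd; exact: eqmod1 (hc x _ _ _ pa pb pd).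
have cxx x (a : L) : 0 < p a x -> c a a = 1%g.
  by move=> pa; apply: (mulgI (c a a)); rewrite (hc1 x)// mulg1.
have cV x (a b : L) : 0 < p a x -> 0 < p b x -> c b a = (c a b)^-1%g.
  by move=> pa pb; apply: (mulgI (c a b)); rewrite (hc1 x)// mulgV (cxx x).
(* Frames at the vertices that spread the monodromy, which [std] puts on one edge, into the
   holonomies of [e01], [e12] and [e02]. *)
pose fr (m : L) : G := match m with inl k => if k == o0 then 1%g else
  if k == o1 then hol e01 else (hol e01 * hol e12)%g | inr _ => 1%g end.
pose yy (m : L) : K := match m with inl k => if k == o0 then y0 else
  if k == o1 then y1 else y2 | inr _ => y0 end.
pose ed (k l : 'I_3) : R -> K := if k == o0 then (if l == o1 then e01 else e02) else
  if k == o1 then (if l == o2 then e12 else pback e01) else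
  (if l == o0 then pback e02 else pback e12).
have edP k l : k != l -> is_path (ed k l) (yy (inl k)) (yy (inl l)) /\
    hol (ed k l) = ((fr (inl k))^-1 * std g k l * fr (inl l))%g.
  move: k l; apply: ord3P; apply: ord3P => //= _; rewrite /ed /std /=.
  - by split=> //; rewrite invg1 !mul1g.
  - by split=> //; rewrite invg1 mul1g /g (invgM (hol e01 * hol e12)%g) invgK mulgVK.
  - by split; [exact: path_rev|rewrite (holV hhol p01) !mulg1].
  - by split=> //; rewrite mulg1 mulKg.
  - by split; [exact: path_rev|rewrite (holV hhol p02) mulg1 /g mulKg].
  - by split; [exact: path_rev|rewrite (holV hhol p12) mulg1 invgM mulgVK].
have ed_sym k l t : k != l -> ed k l t = ed l k (1 - t).
  by move: k l; apply: ord3P; apply: ord3P => //= _; rewrite /ed /= /pback ?subKr.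
have /choice[E0 E0P] : forall mn : L * L, exists e, [/\ is_path e (yy mn.1) (yy mn.2),
    hol e = ((fr mn.1)^-1 * c mn.1 mn.2 * fr mn.2)%g &
    forall k l, k != l -> mn = (inl k, inl l) -> e = ed k l].
  move=> [m n]; have [[k [l [kl [-> ->]]]]|none] :=
      pselect (exists k l, k != l /\ m = inl k /\ n = inl l).
    have [pe he] := edP k l kl; exists (ed k l); split=> //=; last by move=> ? ? _ [-> ->].
    by rewrite he (eqmod1 (cstd k l)).
  have [e pe he] := hol_surj hhol (yy m) (yy n) ((fr m)^-1 * c m n * fr n)%g.
  by exists e; split=> // k l kl [mk nl]; case: none; exists k, l.
have [lt [lt_total _]] := well_founded_total L.
pose e m n := if lt m n then E0 (m, n) else pback (E0 (n, m)).
have e_path m n : is_path (e m n) (yy m) (yy n).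
  rewrite /e; case: ifP => _; first by case: (E0P (m, n)).
  by apply: path_rev; case: (E0P (n, m)).
have e_sym m n t : m != n -> e m n t = e n m (1 - t).
  move=> mn; rewrite /e (lt_total _ _ mn); case: (lt n m) => //=.
  by rewrite /pback subKr.
have e_ed k l t : k != l -> e (inl k) (inl l) t = ed k l t.
  move=> kl; have lk : l != k by rewrite eq_sym.
  rewrite /e; have [_ _ /(_ k l kl erefl) ->] := E0P (inl k, inl l).
  have [_ _ /(_ l k lk erefl) ->] := E0P (inl l, inl k).
  by case: ifP => // _; rewrite /pback ed_sym// subKr.
have e_hol m n x : 0 < p m x -> 0 < p n x -> hol (e m n) = ((fr m)^-1 * c m n * fr n)%g.
  move=> pm pn; rewrite /e; case: ifP => _; first by case: (E0P (m, n)).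
  have [pe he _] := E0P (n, m).
  by rewrite (holV hhol pe) he /= (cV x m n)// !invgM !invgK mulgA.
(* On indices positive at a common point, the relation says that the holonomies along two edges
   multiply to that of the third, so the paths are homotopic. *)
have /choice[D DP] : forall ijk : L * L * L, exists D,
    (exists x, [/\ 0 < p ijk.1.1 x, 0 < p ijk.1.2 x & 0 < p ijk.2 x]) ->
    fills_triangle D (e ijk.1.1 ijk.1.2) (e ijk.1.2 ijk.2) (e ijk.1.1 ijk.2).
  move=> [[i j] k] /=.
  have [[x [pi pj pk]]|none] := pselect (exists x, [/\ 0 < p i x, 0 < p j x & 0 < p k x]);
    last by exists (fun=> y0).
  have pij := e_path i j; have pjk := e_path j k; have pik := e_path i k.
  have [|H hH] := (hol_eq hhol (path_cat pij pjk) pik).1.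
    rewrite (holM hhol pij pjk) !(e_hol _ _ x)//.
    by rewrite -(hc1 x i j k)// !mulgA mulgK.
  have [D [cD D1 D2 D3 _]] := triangle_fill pij pjk pik hH.
  by exists D => _.
pose H (T : seq L) x := if T is [:: i; j; k] then D (i, j, k) (p' i x, p' j x, p' k x) else y0.
have HP T : simplex [set: X] p' T -> size T = 3%N -> cts (face [set: X] p' T) (H T) /\
    forall a b x, a \in T -> b \in T -> a != b -> face [set: X] p' [:: a; b] x ->
    H T x = e a b (edge_ratio p' a b x).
  move=> [x _ sT]; have uT : uniq T by rewrite -sT supp_uniq.
  have pT i : i \in T -> 0 < p i x.
    by rewrite -sT (mem_supp _ hp' (I : setT x)) => /(p'p _ _ I).
  case: T uT sT pT => [//|i [//|j [//|k [|//]]]] uT sT pT _.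
  apply: (fill_face hp' e_sym uT); apply: (DP (i, j, k)); exists x.
  by split; apply: pT; rewrite !inE eqxx ?orbT.
exists (nerve_map p' yy e H).
have e0 m n : m != n -> e m n 0 = yy m by have [_ h _] := e_path m n.
have cn : cts [set: X] (nerve_map p' yy e H).
  apply: (nerve_map_cts hp') => //.
  - by move=> i j _; case: (e_path i j).
  - by move=> T sT T3; case: (HP T sT T3).
  - by move=> T a b x sT T3; have [_] := HP T sT T3; apply.
have onA k l x : k != l -> A x -> (forall m, m != k -> m != l -> u m x = 0) ->
    nerve_map p' yy e H x = ed k l (u l x / (u k x + u l x)).
  move=> kl Ax uz.
  have pE : forall m, p' m x = p m x.
    apply: p'E => //; apply: (@uniq_leq_size _ _ [:: inl o0; inl o1; inl o2 : L]).
      exact: supp_uniq.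
    move=> [m|j]; rewrite (mem_supp _ hp (I : setT x)).
      by move=> _; rewrite !inE; move: m; apply: ord3P.
    by rewrite p0// ltxx.
  have kl' : inl k != inl l   :> L by [].
  rewrite (nerve_map2 hp' _ e0 e_sym kl').
    by rewrite e_ed// /edge_ratio !pE !pu.
  split=> // m; rewrite pE !inE; case: m => [m|j]; last by rewrite p0// ltxx.
  rewrite pu// => um; apply: contraT; rewrite negb_or => /andP[mk ml].
  by move: um; rewrite uz ?ltxx.
split; first exact: cts_continuous.
- by move=> x Ax u2; rewrite (onA o0 o1)//; apply: ord3P.
- by move=> x Ax u0; rewrite (onA o1 o2)//; apply: ord3P.
- by move=> x Ax u1; rewrite (onA o0 o2)//; apply: ord3P.
Qed.

End FillBoundary.

Section CocycleToExtension.
Variables (R : realType) (X : metricType R) (G : groupType) (K : topologicalType).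
Variables (ls : local_structure R K) (hol : (R -> K) -> G) (k0 : K).
Hypothesis hhol : holonomy hol.
Hypothesis dimX : covering_dim_le X 2.
Hypothesis ext1 : forall g : G, extends_cocycle X [set: G] [set 1%g] g.
Local Notation sp := (lam ls).
Local Notation d := (@mdist R X).

(** A good triangle is filled by the local structure, which controls the values; any other triangle
    is handled over its boundary by [fill_boundary], without control. Both choices agree on the
    edges. *)
Lemma triangle_extension (I : choiceType) (O : set X) (p : I -> X -> R) (y : I -> K)
    (i j k : I) : psys O p -> uniq [:: i; j; k] -> exists h : X -> K,
  [/\ cts (face O p [:: i; j; k]) h,
    forall a b x, a \in [:: i; j; k] -> b \in [:: i; j; k] -> a != b ->
      face O p [:: a; b] x -> h x = sp (y a) (y b) (edge_ratio p a b x) &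
    good ls (y i) (y j) (y k) -> forall x, face O p [:: i; j; k] x ->
      exists2 st, square st & h x = filling ls (y i) (y j) (y k) st].
Proof.
move=> hp uT; pose e a b := sp (y a) (y b).
have e_sym a b t : a != b -> e a b t = e b a (1 - t) by move=> _; exact: lam_sym.
have pij := lam_path ls (y i) (y j); have pjk := lam_path ls (y j) (y k).
have pik := lam_path ls (y i) (y k).
have ge0 m x : O x -> 0 <= p m x by move=> Ox; exact: (psys_ge0 hp).
have pos x : face O p [:: i; j; k] x -> 0 < p i x \/ 0 < p j x \/ 0 < p k x.
  move=> [Ox hx]; have [m pm] := psys_cov hp Ox; have := hx m pm.
  by rewrite !inE => /or3P[]/eqP <-; [left|right; left|right; right].
have [gd|ngd] := pselect (good ls (y i) (y j) (y k)).
  have [D [cD D1 D2 D3 DH]] := triangle_fill pij pjk pik (good_homotopy gd).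
  have [] := @fill_face _ _ _ _ _ _ e hp e_sym D i j k uT (And4 cD D1 D2 D3).
  move=> ch eh; exists (fun x => D (p i x, p j x, p k x)); split=> // _ x fx.
  have [Ox _] := fx; apply: DH; split; rewrite /= ?ge0//.
  by have := ge0 i x Ox; have := ge0 j x Ox; have := ge0 k x Ox; have := pos x fx; lra.
pose u (m : 'I_3) : X -> R := nth (p i) [:: p i; p j; p k] m.
pose A := face O p [:: i; j; k] `&` (fun x => Num.min (p i x) (Num.min (p j x) (p k x))) @^-1` [set 0].
have cp m : cts (face O p [:: i; j; k]) (p m) by apply: sub_cts (psys_cts hp m) => x [].
have clA : closed A.
  have cm := cts_min (cp i) (cts_min (cp j) (cp k)).
  exact: (closed_preimage_cts (closed_face hp) cm (@closed_eq _ 0)).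
have AE x : A x <-> face O p [:: i; j; k] x /\ (p i x = 0 \/ p j x = 0 \/ p k x = 0).
  split=> [[fx /= h]|[fx h]]; split=> //=; have [Ox _] := fx.
    move: h; rewrite !minEle; case: ifP => _; first by left.
    by case: ifP => _; [right; left|right; right].
  have := ge0 i x Ox; have := ge0 j x Ox; have := ge0 k x Ox.
  rewrite !minEle; case: ifPn => [|]; rewrite -?ltNge; case: ifPn => [|]; rewrite -?ltNge;
    by move=> ? ? ? ? ?; case: h => [|[]]; lra.
have sub m : A `<=` face O p [:: i; j; k] by move=> x [].
have cu : circle_map A u.
  split.
  - by apply: ord3P; apply: sub_cts (cp _) => x [].
  - move=> m x [[Ox _] _]; have h q : 0 <= p q x <= 1.
      by rewrite ge0//= (psys_le1 hp).
    by move: m; apply: ord3P; exact: h.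
  - move=> x [fx _]; have [h|[h|h]] := pos x fx;
      [by exists (@Ordinal 3 0 isT)|by exists (@Ordinal 3 1 isT)|by exists (@Ordinal 3 2 isT)].
  - move=> x /AE[_ [h|[h|h]]];
      [by exists (@Ordinal 3 0 isT)|by exists (@Ordinal 3 1 isT)|by exists (@Ordinal 3 2 isT)].
have [Phi [cPhi P01 P12 P02]] := fill_boundary hhol dimX ext1 pij pjk pik clA cu.
have uT' := uT; move: uT'; rewrite /= !inE negb_or andbT => /andP[/andP[ij ik] jk].
have face2 a b m x : m != a -> m != b -> a \in [:: i; j; k] -> b \in [:: i; j; k] ->
    face O p [:: a; b] x -> p m x = 0 /\ face O p [:: i; j; k] x.
  move=> ma mb aT bT [Ox hx]; split.
    apply: (psys_eq0 hp Ox); apply/negP => /hx.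
    by rewrite !inE (negbTE ma) (negbTE mb).
  by split=> // q /hx; rewrite !inE => /orP[]/eqP ->; rewrite ?inE in aT bT *.
exists Phi; split=> //; first exact: continuous_cts.
apply: (@triangle_edges _ _ _ _ _ _ e hp e_sym) => x.
- move=> /(@face2 i j k); rewrite ![k == _]eq_sym ik jk !inE !eqxx ?orbT => /(_ isT isT isT isT)[pk fx].
  by apply: P01 => //; apply/AE; split=> //; right; right.
- move=> /(@face2 j k i); rewrite ij ik !inE !eqxx ?orbT => /(_ isT isT isT isT)[pi fx].
  by apply: P12 => //; apply/AE; split=> //; left.
- move=> /(@face2 i k j); rewrite ![j == i]eq_sym ij jk !inE !eqxx ?orbT => /(_ isT isT isT isT)[pj fx].
  by apply: P02 => //; apply/AE; split=> //; right; left.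
Qed.

(* Kuratowski-Dugundji extension: vertices near A are sent to values of f at
   nearby points of A, and small simplices are filled by the local structure. *)
Lemma cocycle_extension : extension_property X K.
Proof.
apply: (cts_extension k0) => A f clA cf.
have [[aA AaA]|noA] := pselect (exists a, A a); last first.
  by exists (fun=> k0) => [x|x Ax]; [exact: cvg_cst|case: noA; exists x].
pose O := ~` A; pose dl := codist O.
have oO : open O by exact: closed_openC.
have dl_pos x : O x -> 0 < dl x by exact: codist_open_gt0.
have dl_le x z : A z -> dl x <= d x z.
  by move=> Az; rewrite leNgt; apply/negP => /codist_sub; exact.
(* The radius is a small fraction of the distance to [A], so on the support of a coordinate this
   distance varies by a bounded factor and vertices stay close to the points they serve. *)
pose U (x : X) : set X := [set y | d x y < dl x / 8].
have oU x : open (U x).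
  have cd : continuous (d x).
    by apply: lip1_continuous => z z'; rewrite (metric_sym z); exact: metric_triangle.
  rewrite -[U x]/(d x @^-1` [set t | t < dl x / 8]).
  by apply: open_comp => // z _; exact: cd.
have UO x y : U x y -> O y.
  move=> Uy; apply: (@codist_sub R X O x); apply: lt_le_trans Uy _.
  by have := codist_ge0 O x; rewrite -/(dl x); lra.
have [q [cq q0 qU q_cov q_fin]] := locally_finite_refinement oU.
have Ux x : O x -> U x x by move=> /dl_pos h; rewrite /U /= mdistxx divr_gt0.
pose p (i : nat * X) x := Num.min 1 (q i x).
have pq i x : (0 < p i x) = (0 < q i x) by rewrite lt_min ltr01.
have hp : psys O p.
  split.
  - by move=> i; apply: cts_min; [exact: cts_cst|exact: continuous_cts].
  - by move=> i x _; rewrite le_min ler01 q0.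
  - by move=> i x _; rewrite ge_min lexx.
  - move=> x Ox; have [s sP] := q_fin x x (Ux x Ox); exists s.
    by apply: filterS sP => y h _ i; rewrite pq; exact: h.
  - move=> x Ox; have [a qa] := q_cov x x (Ux x Ox).
    by exists a; rewrite pq.
  - move=> i z /contrapT Az; have [Oi|nOi] := pselect (O i.2); last first.
      apply: filterE => y _; apply/eqP; rewrite eq_le le_min ler01 q0 !andbT leNgt pq.
      apply/negP => qi; have := qU _ _ qi.
      by rewrite /U /= /dl codist_eq0// mul0r ltNge mdist_ge0.
    have di := dl_pos _ Oi; have d0 : 0 < dl i.2 / 2 by lra.
    have : nbhs z (ball z (dl i.2 / 2)) by exact: nbhsx_ballx.
    apply: filterS => y; rewrite ballEmdist /= => zy _.
    apply/eqP; rewrite eq_le le_min ler01 q0 !andbT leNgt pq; apply/negP => qi.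
    have iy : d i.2 y < dl i.2 / 8 := qU _ _ qi; have := dl_le i.2 z Az; have := metric_triangle i.2 y z.
    by rewrite (metric_sym y); lra.
have [p' [hp' p'p p'3 _]] := order_reduction dimX hp.
(* The condition [2 * dl x <= 1] is due to the truncation of [codist]; it holds near [A], the only
   place where a close point matters. *)
have /choice[a aP] : forall x, exists a, A a /\ (0 < dl x -> 2 * dl x <= 1 -> d x a < 2 * dl x).
  move=> x; have [[h1 h2]|none] := pselect (0 < dl x /\ 2 * dl x <= 1); last first.
    by exists aA; split=> // h1 h2; case: none.
  have [|b nOb xb] := @codist_out R X O x (2 * dl x).
    by rewrite h2 andbT -/(dl x); lra.
  by exists b; split=> //; exact: contrapT.
pose y (i : nat * X) : K := f (a i.2).
pose e i j := sp (y i) (y j).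
have /choice[H HP] : forall T : seq (nat * X), exists h : X -> K,
    uniq T -> size T = 3%N -> [/\ cts (face O p' T) h,
    forall i j x, i \in T -> j \in T -> i != j ->
      face O p' [:: i; j] x -> h x = e i j (edge_ratio p' i j x) &
    (forall i j k, i \in T -> j \in T -> k \in T -> good ls (y i) (y j) (y k)) ->
      forall x, face O p' T x -> exists i j k st, [/\ i \in T, j \in T, k \in T &
        square st /\ h x = filling ls (y i) (y j) (y k) st]].
  move=> [|i [|j [|k [|]]]]; try by exists (fun=> k0).
  have [uT|nuT] := boolP (uniq [:: i; j; k]); last by exists (fun=> k0).
  have [h [ch eh gh]] := triangle_extension y hp' uT.
  exists h => _ _; split=> // gd x fx.
  have iT : i \in [:: i; j; k] by rewrite !inE eqxx.
  have jT : j \in [:: i; j; k] by rewrite !inE eqxx orbT.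
  have kT : k \in [:: i; j; k] by rewrite !inE eqxx !orbT.
  have [st sq hx] := gh (gd i j k iT jT kT) x fx.
  by exists i, j, k, st.
pose n := nerve_map p' y e H.
have e_sym i j t : i != j -> e i j t = e j i (1 - t) by move=> _; exact: lam_sym.
have e_0 i j : i != j -> e i j 0 = y i by move=> _; case: (lam_path ls (y i) (y j)).
have simplex_uniq T : simplex O p' T -> uniq T by move=> [x _ <-]; exact: supp_uniq.
have cn : cts O n.
  apply: (nerve_map_cts hp') => //.
  - by move=> i j _; case: (lam_path ls (y i) (y j)).
  - by move=> T /simplex_uniq uT T3; case: (HP T uT T3).
  - by move=> T i j x /simplex_uniq uT T3; have [_ h _] := HP T uT T3; exact: h.
exists (fun x => if pselect (A x) then f x else n x); last first.
  by move=> x Ax; case: pselect.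
apply: cts_continuous; apply/ctsP => x P _; case: pselect => Ax /=; last first.
  move=> nP; have Ox : nbhs x O by exact: open_nbhs_nbhs.
  apply: filterS2 Ox (cts_near cn Ax nP) => z Oz h _.
  by case: pselect => // _; exact: h.
move=> fP; have [T pT nT] := piece_near ls cf Ax.
have Tx : T (f x) by exact: (nbhs_singleton nT).
have [W' W'x small] := small_triangle pT Tx fP.
have nW := cts_near cf Ax W'x; have nP := cts_near cf Ax fP.
have : nbhs x (fun z => (A z -> T (f z)) /\ (A z -> W' (f z))) by exact: filterI nT nW.
move=> /nbhs_ballP[r /= r0 hr].
(* For [z] within [r'] of [x] and a vertex [i] active at [z], [dl i.2 <= 8/7 * r']. Hence
   [2 * dl i.2 <= 1], and the chosen point of [A] is within r' + 17/8 dl < 4 r' <= r of [x]. *)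
pose r' := Num.min 4^-1 (r / 4).
have r'0 : 0 < r' by rewrite lt_min invr_gt0 ltr0n divr_gt0.
have [r'4 r'r] : r' <= 4^-1 /\ r' <= r / 4 by rewrite !ge_min !lexx orbT.
have : nbhs x (ball x r') by exact: nbhsx_ballx.
apply: filterS2 nP => z Pz; rewrite ballEmdist /= => xz _.
case: pselect => Az /=; first exact: Pz.
have near_vertex i : 0 < p' i z -> T (y i) /\ W' (y i).
  move=> /(p'p _ _ Az); rewrite pq => qi; have iz : d i.2 z < dl i.2 / 8 := qU _ _ qi.
  have [Aa ha] := aP i.2.
  have h1 := dl_le z x Ax; have h2 := codist_lip O i.2 z; rewrite -/dl in h2.
  have h3 : dl z <= r' by apply: le_trans h1 _; rewrite metric_sym ltW.
  have h4 : 0 < dl i.2.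
    by have := mdist_ge0 i.2 z; lra.
  have h5 : d i.2 (a i.2) < 2 * dl i.2 by apply: ha => //; lra.
  have : ball x r (a i.2).
    rewrite ballEmdist /=; have := metric_triangle x z (a i.2).
    by have := metric_triangle z i.2 (a i.2); rewrite (metric_sym z i.2); lra.
  by move=> /hr[hT hW]; split; [exact: hT|exact: hW].
have pT' i : i \in supp p' z -> T (y i) /\ W' (y i).
  by rewrite (mem_supp _ hp' Az); exact: near_vertex.
have smallT i j k : i \in supp p' z -> j \in supp p' z -> k \in supp p' z ->
    [/\ good ls (y i) (y j) (y k), forall st, square st -> P (filling ls (y i) (y j) (y k) st) &
        forall t, itv01 t -> P (sp (y i) (y j) t)].
  by move=> /pT'[? ?] /pT'[? ?] /pT'[? ?]; exact: small.
have fz := face_supp hp' Az; have uz := supp_uniq p' z; have := p'3 z Az.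
move: smallT fz uz; case sE : (supp p' z) => [|i [|j [|k [|]]]] // smallT fz uz _.
- by have [i] := psys_cov hp' Az; rewrite -(mem_supp _ hp' Az) sE.
- have ii : i \in [:: i] by rewrite inE.
  rewrite /n (nerve_map1 hp' _ _ _ fz); have [_ _ h] := smallT i i i ii ii ii.
  by have := h 0 (itv01_0 R); have [_ -> _] := lam_path ls (y i) (y i).
- have ii : i \in [:: i; j] by rewrite inE eqxx.
  have jj : j \in [:: i; j] by rewrite !inE eqxx orbT.
  have ij : i != j by move: uz; rewrite /= inE andbT.
  rewrite /n (nerve_map2 hp' _ e_0 e_sym ij fz).
  have [_ _ h] := smallT i j j ii jj jj; apply: h.
  exact: (ratio01 hp' Az (pair_pos hp' fz)).
- rewrite /n nerve_map3 sE//.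
  have [_ _ /(_ _ z fz)[]] := HP _ uz erefl.
    by move=> i' j' k' hi hj hk; case: (smallT i' j' k' hi hj hk).
  move=> i' [j' [k' [st [hi hj hk [sq ->]]]]].
  by have [_ h _] := smallT i' j' k' hi hj hk; exact: h.
Qed.

End CocycleToExtension.

Section EilenbergMacLane.
Variables (R : realType) (X : metricType R).
Hypothesis dimX : covering_dim_le X 2.

Lemma extension_property_cocycle (G : groupType) (K : topologicalType) :
  eilenberg_maclane1 R G K ->
  extension_property X K <-> forall g : G, extends_cocycle X [set: G] [set 1%g] g.
Proof.
move=> [[cw] [k0 _] pi1 pin].
have conn : forall a b : K, exists e, is_path (R := R) e a b.
  by apply: (path_connected_pi0 (x0 := k0)); exact: pin.
have [phi phi_bij] := pi1 k0; have [hol hhol] := holonomy_exists conn phi_bij.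
have [ls _] := cw_local_structure cw conn k0.
split=> [ext g|]; first exact: (extension_extends_cocycle ls k0 hhol ext).
exact: (cocycle_extension ls k0 hhol dimX).
Qed.

Lemma extends_cocycle_eqmod (G : groupType) (V N : set G) g g' : normal_subgroup N ->
  eqmod N g g' -> extends_cocycle X V N g -> extends_cocycle X V N g'.
Proof.
move=> nN gg' E A u clA cu; have [J [p [c [hp pu p0 hc cstd]]]] := E A u clA cu.
exists J, p, c; split=> // k l; apply: (eqmod_trans nN.1 _ (cstd k l)).
apply: (eqmod_sym nN.1); rewrite /std; case: ifP => _ //.
by case: ifP => _; [exact: eqmodV|exact: eqmod_refl nN.1].
Qed.

(** Changes of group in both directions. [repr] is a homomorphism modulo the derived subgroup, which
    is [lower_central_series 1]; this yields cocycles modulo that subgroup, where the induction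
    along the series starts. *)
Lemma extends_cocycle_ab (G : groupType) : nilpotent_group G ->
  (forall g : G, extends_cocycle X [set: G] [set 1%g] g) <->
  (forall a : abelianization G, extends_cocycle X [set: abelianization G] [set 1%g] a).
Proof.
move=> nilG; have nab := trivial_normal (abelianization G); split=> E.
  move=> a; have [g <-] := to_ab_surj a.
  apply: (extends_cocycle_mor (V := [set: G]) (N := [set 1%g]) (phi := @to_ab G)) => //.
  - by move=> x y _ _; rewrite -ab_mulE; exact: eqmod_refl nab.1.
  - by move=> x y _ _ /eqmod1 ->; exact: eqmod_refl nab.1.
move=> g; apply: (extends_cocycle_nilpotent dimX) => // {}g.
have nD : normal_subgroup (lower_central_series 1%N) := normal_lower G 1.
have reprP (x : G) : eqmod (lower_central_series 1%N) (repr (to_ab x)) x.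
  by apply/to_abP; exact: reprK.
apply: (extends_cocycle_eqmod nD (reprP g)).
apply: (extends_cocycle_mor (V := [set: abelianization G]) (N := [set 1%g])
  (phi := fun a => repr a)) => //.
- by move=> a b _ _; exact: reprP.
- by move=> a b _ _ /eqmod1 ->; exact: eqmod_refl nD.1.
Qed.

End EilenbergMacLane.

Theorem theorem3p1 (R : realType) (G : groupType) (X : metricType R)
    (K L : topologicalType) :
  nilpotent_group G ->
  covering_dim_eq X 2 ->
  eilenberg_maclane1 R G K ->
  eilenberg_maclane1 R (abelianization G) L ->
  extension_property X K <-> extension_property X L.
Proof.
move=> nilG [dimX _] emK emL.
rewrite (extension_property_cocycle dimX emK) (extension_property_cocycle dimX emL).
exact: extends_cocycle_ab.
Qed.
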